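(* Consider the two-user Gaussian multiple-access wiretap channel with noiseless feedback described in the context, with power constraints $P_1,P_2>0$ and noise variances $\sigma_1^2,\sigma_2^2>0$. Its secrecy capacity region $\mathcal{C}^{f}_{s,gmac}$ equals \[ \mathcal{C}^{f}_{gmac}=\bigcup_{0\le\rho\le1}\Big\{(R_1\ge0,R_2\ge0):\ R_1\le\tfrac12\log\Big(1+\tfrac{P_1(1-\rho^2)}{\sigma_1^2}\Big),\ R_2\le\tfrac12\log\Big(1+\tfrac{P_2(1-\rho^2)}{\sigma_1^2}\Big),\ R_1+R_2\le\tfrac12\log\Big(1+\tfrac{P_1+P_2+2\sqrt{P_1P_2}\rho}{\sigma_1^2}\Big)\Big\}, \] i.e., $\mathcal{C}^{f}_{s,gmac}=\mathcal{C}^{f}_{gmac}$, the feedback capacity region of the same Gaussian multiple-access channel without any secrecy constraint.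
   Context: All logarithms are base 2. Channel (GMAC-WT with feedback): for $i=1,\dots,N$, $Y_i=X_{1,i}+X_{2,i}+\eta_{1,i}$ (legitimate receiver) and $Z_i=Y_i+\eta_{2,i}$ (wiretapper), where $\eta_{1,i}\sim\mathcal N(0,\sigma_1^2)$ and $\eta_{2,i}\sim\mathcal N(0,\sigma_2^2)$ are i.i.d. over $i$, mutually independent, and independent of the messages. Messages $W_1,W_2$ are independent, $W_j$ uniform on $\{1,\dots,|\mathcal W_j|\}$. For $j=1,2$, the input $X_{j,i}$ is a (possibly stochastic) function of $W_j$ and the noiseless feedback $Y^{i-1}=(Y_1,\dots,Y_{i-1})$, subject to the average power constraint $\frac1N\sum_{i=1}^N E[X_{j,i}^2]\le P_j$. The receiver outputs $(\hat W_1,\hat W_2)=\psi(Y^N)$; $P_e$ is the average (over uniformly chosen message pairs) probability that $\psi(Y^N)\neq(W_1,W_2)$. The equivocation is $\Delta=\frac1N H(W_1,W_2\mid Z^N)$. A pair $(R_1,R_2)$ is achievable with perfect weak secrecy if for every $\epsilon>0$ and all sufficiently large $N$ there exist encoders and a decoder with $\frac{\log|\mathcal W_1|}{N}=R_1$, $\frac{\log|\mathcal W_2|}{N}=R_2$, $\Delta\ge R_1+R_2-\epsilon$ and $P_e\le\epsilon$. The secrecy capacity region $\mathcal{C}^{f}_{s,gmac}$ is the set of all such pairs.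
   Formalization: The rate condition log|W_j|/N = R_j, which read literally for all large N forces 2^{R_j} to be an integer and makes the claim false, is replaced by |log|W_j|/N − R_j| ≤ ε for j = 1, 2. *)

(* Defs.v *)
From HB Require Import structures.
From mathcomp Require Import all_boot all_order all_algebra.
From mathcomp Require Import all_classical all_reals all_analysis.

Set Implicit Arguments.
Unset Strict Implicit.
Unset Printing Implicit Defensive.

Import Order.TTheory GRing.Theory Num.Theory.
Local Open Scope classical_set_scope.
Local Open Scope ring_scope.

Section GMACWT.
Context {R : realType}.

Definition log2 (x : R) : R := ln x / ln 2.

(** Iterated integral over R^n (coordinates integrated in order 1..n) of
    a function of an n-tuple, each coordinate weighted by the density g
    with respect to Lebesgue measure.  For nonnegative measurable F this is
    (Tonelli) the integral of F against the product measure (g dx)^{(x) n}. *)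
Fixpoint iter_int (g : R -> R) (n : nat) : (n.-tuple R -> \bar R) -> \bar R :=
  match n return (n.-tuple R -> \bar R) -> \bar R with
  | 0 => fun F => F [tuple]
  | k.+1 => fun F =>
      (\int[lebesgue_measure]_x ((g x)%:E * iter_int g (fun t => F (cons_tuple x t))))%E
  end.

(** A code of block length N with message sets 'I_M1, 'I_M2.
    Stochastic encoders are realised with private randomness u_j, uniform on
    [0,1]:  X_{j,i} = enc_j i W_j Y^{i-1} u_j  (times are numbered i = 0..N-1,
    Y^{i-1} is the list of the i previous channel outputs).  The decoder maps
    Y^N to a message pair. *)
Record gmac_code (M1 M2 : nat) := GmacCode {
  enc1 : nat -> 'I_M1 -> seq R -> R -> R;
  enc2 : nat -> 'I_M2 -> seq R -> R -> R;
  dec  : seq R -> 'I_M1 * 'I_M2 }.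

Definition code_measurable (N M1 M2 : nat) (c : gmac_code M1 M2) : Prop :=
  [/\ (forall (i : nat) (w : 'I_M1),
         measurable_fun [set: i.-tuple R * R]
           (fun p => enc1 c i w (tval p.1) p.2)),
      (forall (i : nat) (w : 'I_M2),
         measurable_fun [set: i.-tuple R * R]
           (fun p => enc2 c i w (tval p.1) p.2)) &
      (forall w : 'I_M1 * 'I_M2,
         measurable [set t : N.-tuple R | dec c (tval t) = w])].

Fixpoint outputs (M1 M2 : nat) (c : gmac_code M1 M2) (w1 : 'I_M1) (w2 : 'I_M2)
    (u1 u2 : R) (e : seq R) (k : nat) : seq R :=
  if k is k'.+1 then
    let p := outputs c w1 w2 u1 u2 e k' in
    rcons p (enc1 c k' w1 p u1 + enc2 c k' w2 p u2 + nth 0 e k')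
  else [::].

Definition input1 M1 M2 (c : gmac_code M1 M2) w1 w2 u1 u2 e k : R :=
  enc1 c k w1 (outputs c w1 w2 u1 u2 e k) u1.
Definition input2 M1 M2 (c : gmac_code M1 M2) w1 w2 u1 u2 e k : R :=
  enc2 c k w2 (outputs c w1 w2 u1 u2 e k) u2.

(** Conditional expectation given (W1,W2) = (w1,w2) of a nonnegative
    functional G of (u1,u2,eta_1^N): u_j ~ Unif[0,1], eta_{1,i} ~ N(0,var1)
    i.i.d., all independent. *)
Definition cexp (N : nat) (var1 : R)
    (G : R -> R -> seq R -> \bar R) : \bar R :=
  (\int[lebesgue_measure]_(u1 in `[0%R, 1%R])
    \int[lebesgue_measure]_(u2 in `[0%R, 1%R])
      iter_int (normal_pdf 0 (Num.sqrt var1)) (fun e : N.-tuple R => G u1 u2 (tval e)))%E.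

Definition mavg (M1 M2 : nat) (H : 'I_M1 -> 'I_M2 -> \bar R) : \bar R :=
  (((M1 * M2)%:R)^-1%:E * \sum_(w1 < M1) \sum_(w2 < M2) H w1 w2)%E.

Definition avg_power1 (N : nat) M1 M2 (c : gmac_code M1 M2) (var1 : R) : \bar R :=
  ((N%:R)^-1%:E * \sum_(i < N) mavg (fun w1 w2 =>
      cexp N var1 (fun u1 u2 e => ((input1 c w1 w2 u1 u2 e i) ^+ 2)%:E)))%E.
Definition avg_power2 (N : nat) M1 M2 (c : gmac_code M1 M2) (var1 : R) : \bar R :=
  ((N%:R)^-1%:E * \sum_(i < N) mavg (fun w1 w2 =>
      cexp N var1 (fun u1 u2 e => ((input2 c w1 w2 u1 u2 e i) ^+ 2)%:E)))%E.

Definition error_prob (N : nat) M1 M2 (c : gmac_code M1 M2) (var1 : R) : \bar R :=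
  mavg (fun w1 w2 => cexp N var1 (fun u1 u2 e =>
    (if dec c (outputs c w1 w2 u1 u2 e N) == (w1, w2) then 0 else 1)%:E)).

(** conditional density of the wiretapper's observation Z^N = Y^N + eta_2^N
    given (W1,W2) = (w1,w2), at z; eta_{2,i} ~ N(0,var2) i.i.d. *)
Definition zdens_cond (N : nat) M1 M2 (c : gmac_code M1 M2) (var1 var2 : R)
    (w1 : 'I_M1) (w2 : 'I_M2) (z : N.-tuple R) : R :=
  fine (cexp N var1 (fun u1 u2 e =>
    (\prod_(i < N) normal_pdf (nth 0 (outputs c w1 w2 u1 u2 e N) i)
                               (Num.sqrt var2) (tnth z i))%:E)).

Definition zdens (N : nat) M1 M2 (c : gmac_code M1 M2) (var1 var2 : R)
    (z : N.-tuple R) : R :=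
  ((M1 * M2)%:R)^-1 * \sum_(w1 < M1) \sum_(w2 < M2) zdens_cond c var1 var2 w1 w2 z.

(** conditional entropy H(W1,W2 | Z^N) (in bits):
    sum_w int p(w,z) log2 (p(z) / p(w,z)) dz,  p(w,z) = p(z|w)/(M1 M2);
    the integrand is 0 where p(w,z) = 0 (x/0 = 0 and ln 0 = 0 in MathComp). *)
Definition cond_entropy (N : nat) M1 M2 (c : gmac_code M1 M2) (var1 var2 : R) : \bar R :=
  (\sum_(w1 < M1) \sum_(w2 < M2)
     iter_int (fun _ : R => 1%R) (fun z : N.-tuple R =>
       (let pwz := ((M1 * M2)%:R)^-1 * zdens_cond c var1 var2 w1 w2 z in
        pwz * log2 (zdens c var1 var2 z / pwz))%:E))%E.

Definition equivocation (N : nat) M1 M2 (c : gmac_code M1 M2) (var1 var2 : R) : \bar R :=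
  ((N%:R)^-1%:E * cond_entropy N c var1 var2)%E.

Definition secrecy_achievable (P1 P2 var1 var2 : R) (R1 R2 : R) : Prop :=
  forall eps : R, 0 < eps ->
  exists N0 : nat, forall N : nat, (N0 <= N)%N ->
  exists (M1 M2 : nat) (c : gmac_code M1 M2),
    [/\ [/\ (0 < M1)%N, (0 < M2)%N & code_measurable N c],
        `| log2 M1%:R / N%:R - R1 | <= eps /\ `| log2 M2%:R / N%:R - R2 | <= eps,
        (avg_power1 N c var1 <= P1%:E)%E /\ (avg_power2 N c var1 <= P2%:E)%E,
        (equivocation N c var1 var2 >= (R1 + R2 - eps)%:E)%E &
        (error_prob N c var1 <= eps%:E)%E].

Definition secrecy_capacity_region (P1 P2 var1 var2 : R) : set (R * R) :=
  [set r | secrecy_achievable P1 P2 var1 var2 r.1 r.2].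

Definition gmac_feedback_region (P1 P2 var1 : R) : set (R * R) :=
  \bigcup_(rho in `[0%R, 1%R]) [set r : R * R |
     [/\ 0 <= r.1, 0 <= r.2,
         r.1 <= 2^-1 * log2 (1 + P1 * (1 - rho ^+ 2) / var1),
         r.2 <= 2^-1 * log2 (1 + P2 * (1 - rho ^+ 2) / var1) &
         r.1 + r.2 <= 2^-1 * log2 (1 + (P1 + P2 + 2 * Num.sqrt (P1 * P2) * rho) / var1)]].

End GMACWT.

(* Main.v *)
(* Converse: no secrecy is used. A correct guess of the message is compared with a law of
   the outputs that does not depend on it (outputs Gaussian around (1 + beta) x_2, around
   (1 + beta') x_1, or around 0); the likelihood ratio is quadratic in the inputs, so
   only their powers and their correlation rho enter.

   Achievability: at time 0 both users are silent, and the first output, pure noise, is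
   quantized into a key K that users and receiver share through the feedback. The
   messages, shifted by K, are then sent with a linear code of Schalkwijk-Kailath type.
   The wiretapper sees only a noisy version of the first output, so its conditional law of K
   has bounded density with respect to the uniform law, up to a factor of order sqrt N; given
   everything else its observation depends on the shifted message only. The leaked
   information is therefore O(log N) bits. For the code, user 1 runs two unstable scalar
   states and user 2 one; second moments and Chebyshev's inequality suffice. Corner
   points of the pentagon at correlation rho are reached whenever the sum constraint is
   active, and by the intermediate value theorem these corners dominate the region. *)
Require Import Defs.
From HB Require Import structures.
From mathcomp Require Import all_boot all_order all_algebra.
From mathcomp Require Import all_classical all_reals all_analysis.
From mathcomp Require Import measurable_realfun ring lra zify.
Set Implicit Arguments.
Unset Strict Implicit.
Unset Printing Implicit Defensive.
Import Order.TTheory GRing.Theory Num.Theory.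
Import numFieldNormedType.Exports.
Local Open Scope classical_set_scope.
Local Open Scope ring_scope.

(** * Gaussian integrals *)

(** Three choices shape the proof. First, one real noise sample can be cut into as many cells as
    there are message pairs, so a single slot protects exponentially many messages; the key need not
    be uniform, since the definition forgives any leakage that is sublinear in [N]. However small
    [var2] is, the density of the wiretapper's noise is bounded, and this is why [var2] leaves no
    trace in the region. Second, user 1 has two states because with one effective state per user the
    construction only reaches the correlation at which the sum bound equals the sum of the
    individual bounds. The second state is kept uncorrelated with the sum of the inputs, and an
    orthogonal map of the two states restores the covariance after each step. A reflection is taken
    and not a rotation: its negative determinant makes the eigenvalues real, so that the dynamics
    split into scalar recursions. Third, the converse uses likelihood ratios and second moments
    only, so that no entropy of a continuous variable and no chain rule is needed. *)

Section lebesgue_line.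
Context {R : realType}.
Notation mu := (@lebesgue_measure R).
Implicit Types F : R -> \bar R.

Lemma lebesgue_measure_shift (a : R) (A : set R) : measurable A ->
  pushforward mu (fun x : R => x + a : measurableTypeR R) A = mu A.
Proof.
move=> mA; have mphi : measurable_fun setT (fun x : R => x + a : measurableTypeR R).
  exact: measurable_funD.
pose mp := isMeasurableFun.Build _ _ _ _ _ mphi.
pose phi : {mfun _ >-> _} := HB.pack (fun x : R => x + a : measurableTypeR R) mp.
apply/esym/(@lebesgue_measure_unique R (pushforward mu phi)) => //= _ [[b c]] _ <-.
rewrite /pushforward (_ : _ @^-1` _ = `]b - a, c - a]%classic); last first.
  by apply/seteqP; split => x /=; rewrite !in_itv/= ltrBlDr lerBrDr.
rewrite !lebesgue_measure_itv/= !lte_fin ltrD2r.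
by case: ifP => // _; rewrite -!EFinD; congr EFin; ring.
Qed.

Lemma ge0_integral_shift (a : R) F : measurable_fun setT F ->
  (forall x, (0 <= F x)%E) -> (\int[mu]_x F (x + a)%R = \int[mu]_x F x)%E.
Proof.
move=> mF F0.
have mphi : measurable_fun setT (fun x : R => x + a : measurableTypeR R).
  exact: measurable_funD.
transitivity (\int[pushforward mu (fun x : R => x + a : measurableTypeR R)%R]_x F x)%E.
  by rewrite ge0_integral_pushforward.
by apply: eq_measure_integral => A mA _; exact: lebesgue_measure_shift.
Qed.

Lemma ge0_integral_opp F : measurable_fun setT F ->
  (forall x, (0 <= F x)%E) -> (\int[mu]_x F (- x)%R = \int[mu]_x F x)%E.
Proof.
move=> mF F0.
have mphi : measurable_fun setT (-%R : R -> measurableTypeR R) by exact: measurable_funN.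
transitivity (\int[pushforward mu (-%R : R -> measurableTypeR R)%R]_x F x)%E.
  by rewrite ge0_integral_pushforward.
by apply: eq_measure_integral => A mA _; exact: lebesgue_measureN.
Qed.

End lebesgue_line.

Section gaussian.
Context {R : realType}.
Notation mu := (@lebesgue_measure R).
Variable s : R.
Hypothesis s0 : 0 < s.

Lemma normal_pdf_gt0 (m x : R) : 0 < normal_pdf m s x.
Proof.
by rewrite normal_pdfE ?gt_eqF// mulr_gt0 ?normal_peak_gt0 ?gt_eqF ?expR_gt0.
Qed.

Lemma normal_pdf_center (m x : R) : normal_pdf m s x = normal_pdf 0 s (x - m).
Proof. by rewrite !normal_pdfE ?gt_eqF// normal_fun_center. Qed.

Lemma normal_pdfN (x : R) : normal_pdf 0 s (- x) = normal_pdf 0 s x.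
Proof. by rewrite !normal_pdfE ?gt_eqF// /normal_fun !subr0 sqrrN. Qed.

(** The factors involving [pi] cancel; all later comparisons of Gaussian densities (second moment,
    likelihood ratios, tails) use this exponential of a quadratic. *)
Lemma normal_pdf_ratio (t m n x : R) : 0 < t ->
  normal_pdf n t x / normal_pdf m s x =
  s / t * expR ((x - m) ^+ 2 / (s ^+ 2 *+ 2) - (x - n) ^+ 2 / (t ^+ 2 *+ 2)).
Proof.
move=> t0; rewrite !normal_pdfE ?gt_eqF// /normal_peak /normal_fun.
rewrite invfM mulrACA -expRN -expRD invrK; congr (_ * expR _); last first.
  by rewrite !mulNr opprK addrC.
have pi0 : 0 <= pi *+ 2 :> R by rewrite mulrn_wge0// pi_ge0.
rewrite -!mulrnAr !sqrtrM ?sqr_ge0//; [|exact: ltW|exact: ltW].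
rewrite -!expr2 !sqr_sqrtr ?ltW//.
have : Num.sqrt (pi *+ 2 : R) != 0.
  by rewrite gt_eqF// sqrtr_gt0 mulrn_wgt0// pi_gt0.
by move=> h; field; rewrite h gt_eqF.
Qed.

Lemma measurable_normal_pdfM (F : R -> \bar R) : measurable_fun setT F ->
  measurable_fun setT (fun x => (normal_pdf 0 s x)%:E * F x)%E.
Proof.
move=> mF; apply: emeasurable_funM => //.
by apply/measurable_EFinP; exact: measurable_normal_pdf.
Qed.

Let ge0_integral_pdfDsqr (p : R -> R) (a b : R) : 0 <= a -> 0 <= b ->
  measurable_fun setT p -> (forall x, 0 <= p x) ->
  (\int[mu]_x (a * p x + b * (p x * x ^+ 2))%:E =
   a%:E * \int[mu]_x (p x)%:E + b%:E * \int[mu]_x (p x * x ^+ 2)%:E)%E.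
Proof.
move=> a0 b0 mp p0; have mp2 : measurable_fun setT (fun x : R => p x * x ^+ 2).
  by apply: measurable_funM => //; exact: measurable_funX.
under eq_integral do rewrite EFinD (EFinM a) (EFinM b).
rewrite ge0_integralD//.
- rewrite !ge0_integralZl_EFin//; try exact/measurable_EFinP.
    by move=> x _; rewrite lee_fin mulr_ge0// sqr_ge0.
  by move=> x _; rewrite lee_fin.
- by move=> x _; rewrite -EFinM lee_fin mulr_ge0.
- by apply/measurable_EFinP; exact: measurable_funM.
- move=> x _; rewrite -EFinM lee_fin; apply: mulr_ge0 => //; apply: mulr_ge0 => //; exact: sqr_ge0.
- by apply/measurable_EFinP; exact: measurable_funM.
Qed.

(* Comparing with the density of standard deviation r s, the inequality
   1 + u <= exp u bounds the second moment from above by r^2 s^2 for r > 1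
   and from below by r^2 s^2 for r < 1. *)
Lemma integral_normal_pdf_sqr :
  (\int[mu]_x (normal_pdf 0 s x * x ^+ 2)%:E = (s ^+ 2)%:E)%E.
Proof.
pose p := normal_pdf 0 s; set I := (\int[mu]_x _)%E.
have p0 x : 0 <= p x by exact: normal_pdf_ge0.
have mp : measurable_fun setT p by exact: measurable_normal_pdf.
have mp2 : measurable_fun setT (fun x : R => p x * x ^+ 2).
  by apply: measurable_funM => //; exact: measurable_funX.
have Ip : (\int[mu]_x (p x)%:E = 1)%E by exact: integral_normal_pdf.
have I0 : (0 <= I)%E.
  by apply: integral_ge0 => x _; rewrite lee_fin mulr_ge0// sqr_ge0.
have ratio r x : 0 < r -> normal_pdf 0 (r * s) x =
    p x * (r^-1 * expR (x ^+ 2 * ((1 - (r ^+ 2)^-1) / (s ^+ 2 *+ 2)))).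
  move=> r0; have rs0 : 0 < r * s by rewrite mulr_gt0.
  rewrite -[LHS](divfK (lt0r_neq0 (normal_pdf_gt0 0 x))) mulrC /p; congr (_ * _).
  rewrite normal_pdf_ratio// subr0; congr (_ * expR _).
    by field; rewrite !gt_eqF.
  by rewrite exprMn; field; rewrite !gt_eqF.
have up y : 1 < y -> (I <= (s ^+ 2 * y)%:E)%E.
  move=> y1; have y0 : 0 < y by rewrite (lt_trans _ y1).
  pose r := Num.sqrt y; have r0 : 0 < r by rewrite sqrtr_gt0.
  have ry : r ^+ 2 = y by rewrite sqr_sqrtr// ltW.
  have r1 : 1 < r by rewrite -(@ltr_pXn2r _ 2) ?nnegrE ?ltW// expr1n ry.
  pose c := (1 - y^-1) / (s ^+ 2 *+ 2).
  have c0 : 0 < c.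
    by rewrite divr_gt0 ?subr_gt0 ?invf_lt1// mulrn_wgt0// exprn_gt0.
  have : (\int[mu]_x (r^-1 * p x + (c / r) * (p x * x ^+ 2))%:E <=
      \int[mu]_x (normal_pdf 0 (r * s) x)%:E)%E.
    apply: ge0_le_integral => //.
    - move=> x _; rewrite lee_fin; apply: addr_ge0; apply: mulr_ge0 => //.
      + by rewrite invr_ge0 ltW.
      + by rewrite divr_ge0 ?ltW.
      + by rewrite mulr_ge0 ?sqr_ge0.
    - apply/measurable_EFinP; apply: measurable_funD; exact: measurable_funM.
    - by apply/measurable_EFinP; exact: measurable_normal_pdf.
    - move=> x _; rewrite lee_fin ratio// ry -/c.
      have -> : r^-1 * p x + c / r * (p x * x ^+ 2) =
        p x * (r^-1 * (1 + x ^+ 2 * c)) by ring.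
      apply: ler_wpM2l => //; apply: ler_wpM2l; first by rewrite invr_ge0 ltW.
      exact: expR_ge1Dx.
  have rV0 : 0 <= r^-1 by rewrite invr_ge0 ltW.
  have crp : (0 < (c / r)%:E)%E by rewrite lte_fin; exact: divr_gt0.
  have cr0 : 0 <= c / r by exact: ltW.
  rewrite integral_normal_pdf ge0_integral_pdfDsqr//.
  rewrite Ip mule1 -/I.
  case: I I0 => [j| |]//= j0; last by rewrite gt0_muley.
  rewrite -!EFinM -EFinD !lee_fin.
  have -> : r^-1 + c / r * j = (1 + c * j) / r by ring.
  rewrite ler_pdivrMr// mul1r -lerBrDl mulrC -ler_pdivlMr// => /le_trans; apply.
  have -> : (r - 1) / c = s ^+ 2 * y * (2 / (r + 1)).
    have h : r ^+ 2 - 1 != 0 by rewrite ry gt_eqF// subr_gt0.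
    by rewrite /c -ry; field; rewrite h !gt_eqF ?addr_gt0.
  apply: ler_piMr; first by rewrite mulr_ge0 ?sqr_ge0 ?ltW.
  by rewrite ler_pdivrMr ?addr_gt0// mul1r; lra.
have lo y : 0 < y < 1 -> ((s ^+ 2 * y)%:E <= I)%E.
  move=> /andP[y0 y1].
  pose r := Num.sqrt y; have r0 : 0 < r by rewrite sqrtr_gt0.
  have ry : r ^+ 2 = y by rewrite sqr_sqrtr// ltW.
  have r1 : r < 1 by rewrite -(@ltr_pXn2r _ 2) ?nnegrE ?ltW// expr1n ry.
  pose c := (y^-1 - 1) / (s ^+ 2 *+ 2).
  have c0 : 0 < c.
    by rewrite divr_gt0 ?subr_gt0 ?invf_gt1// mulrn_wgt0// exprn_gt0.
  have crp : (0 < (c / r)%:E)%E by rewrite lte_fin; exact: divr_gt0.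
  have cr0 : 0 <= c / r by exact: ltW.
  have rV0 : 0 <= r^-1 by rewrite invr_ge0 ltW.
  have : (\int[mu]_x (r^-1 * p x)%:E <=
      \int[mu]_x ((normal_pdf 0 (r * s) x)%:E + ((c / r) * (p x * x ^+ 2))%:E))%E.
    apply: ge0_le_integral => //.
    - by move=> x _; rewrite lee_fin mulr_ge0// invr_ge0 ltW.
    - by apply/measurable_EFinP; exact: measurable_funM.
    - apply: emeasurable_funD; apply/measurable_EFinP.
        exact: measurable_normal_pdf.
      exact: measurable_funM.
    - move=> x _; rewrite -EFinD lee_fin ratio// ry.
      have -> : (1 - y^-1) / (s ^+ 2 *+ 2) = - c by rewrite /c -mulNr opprB.
      have -> : p x * (r^-1 * expR (x ^+ 2 * - c)) + c / r * (p x * x ^+ 2) =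
        p x * (r^-1 * (expR (x ^+ 2 * - c) + x ^+ 2 * c)) by ring.
      rewrite mulrC; apply: ler_wpM2l => //.
      apply: ler_peMr; first by rewrite invr_ge0 ltW.
      by have := expR_ge1Dx (x ^+ 2 * - c); lra.
  have -> : (\int[mu]_x ((normal_pdf 0 (r * s) x)%:E + ((c / r) * (p x * x ^+ 2))%:E) =
      1 + (c / r)%:E * I)%E.
    rewrite ge0_integralD//.
    - rewrite integral_normal_pdf; congr (_ + _)%E.
      under eq_integral do rewrite EFinM.
      rewrite ge0_integralZl_EFin//; last exact/measurable_EFinP.
      by move=> x _; rewrite lee_fin mulr_ge0 ?sqr_ge0.
    - by move=> x _; rewrite lee_fin normal_pdf_ge0.
    - by apply/measurable_EFinP; exact: measurable_normal_pdf.
    - by move=> x _; rewrite lee_fin; apply: mulr_ge0 => //; rewrite mulr_ge0 ?sqr_ge0.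
    - by apply/measurable_EFinP; exact: measurable_funM.
  under eq_integral do rewrite EFinM.
  rewrite ge0_integralZl_EFin//; last first.
  - exact/measurable_EFinP.
  - by move=> x _; rewrite lee_fin.
  rewrite Ip mule1.
  clear up; case: I I0 => [j| |]//= j0; last by rewrite leey.
  rewrite -EFinM -EFinD !lee_fin.
  have -> : 1 + c / r * j = (r + c * j) / r by field; rewrite gt_eqF.
  rewrite ler_pdivlMr// mulVf ?gt_eqF// -lerBlDl mulrC -ler_pdivrMr//; apply: le_trans.
  have -> : (1 - r) / c = s ^+ 2 * y * (2 / (r + 1)).
    have h : 1 + -1 * r ^+ 2 != 0 by rewrite mulN1r ry gt_eqF// subr_gt0.
    by rewrite /c -ry; field; rewrite h !gt_eqF ?addr_gt0.
  apply: ler_peMr; first by rewrite mulr_ge0 ?sqr_ge0 ?ltW.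
  by rewrite ler_pdivlMr ?addr_gt0// mul1r; lra.
have s20 : 0 < s ^+ 2 by rewrite exprn_gt0.
(* If [j] differed from [s ^+ 2], the midpoint of [1] and [j / s ^+ 2] put into [up] or [lo] would
   give a contradiction; [lo] asks for a positive argument, hence the separate case [j <= 0]. *)
have mid j : s ^+ 2 * ((j / s ^+ 2 + 1) / 2) = (j + s ^+ 2) / 2.
  by field; rewrite gt_eqF.
clear Ip ge0_integral_pdfDsqr.
case: I I0 up lo => [j| |]//= _ up lo; last by have := up 2 (ltr1n _ 2).
congr EFin; apply/eqP; rewrite eq_le; apply/andP; split; rewrite leNgt; apply/negP => h.
- have h1 : 1 < j / s ^+ 2 by rewrite ltr_pdivlMr// mul1r.
  have /up : 1 < (j / s ^+ 2 + 1) / 2 by lra.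
  by rewrite lee_fin mid => ?; lra.
- have [j0|j0] := leP j 0.
    have /lo : 0 < (1 / 2 : R) < 1 by apply/andP; split; lra.
    by rewrite lee_fin => ?; lra.
  have h1 : j / s ^+ 2 < 1 by rewrite ltr_pdivrMr// mul1r.
  have h2 : 0 < j / s ^+ 2 by rewrite divr_gt0.
  have /lo : 0 < (j / s ^+ 2 + 1) / 2 < 1 by apply/andP; split; lra.
  by rewrite lee_fin mid => ?; lra.
Qed.

(** The cross term [2 * b * c * x] is signed. Adding the integral with [- c] in place of [c], equal
    by symmetry, cancels it, so that only nonnegative functions are integrated. *)
Lemma integral_normal_pdf_quadratic (a b c : R) : 0 <= a ->
  (\int[mu]_x ((normal_pdf 0 s x)%:E * (a + (b + c * x) ^+ 2)%:E) =
   (a + b ^+ 2 + c ^+ 2 * s ^+ 2)%:E)%E.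
Proof.
move=> a0; pose p := normal_pdf 0 s.
have p0 x : 0 <= p x by exact: normal_pdf_ge0.
have mp : measurable_fun setT p by exact: measurable_normal_pdf.
pose F c x := ((p x)%:E * (a + (b + c * x) ^+ 2)%:E)%E.
have F0 c' x : (0 <= F c' x)%E.
  by rewrite /F -EFinM lee_fin mulr_ge0// addr_ge0// sqr_ge0.
have mF c' : measurable_fun setT (F c').
  apply: measurable_normal_pdfM; apply/measurable_EFinP.
  apply: measurable_funD => //; apply: measurable_funX.
  by apply: measurable_funD => //; exact: measurable_funM.
have FN : (\int[mu]_x F (- c)%R x = \int[mu]_x F c x)%E.
  rewrite -[RHS]ge0_integral_opp//; apply: eq_integral => x _.
  by rewrite /F /p normal_pdfN mulrN mulNr.
have : (\int[mu]_x F c x + \int[mu]_x F (- c)%R x =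
    ((a + b ^+ 2 + c ^+ 2 * s ^+ 2) *+ 2)%:E)%E.
  rewrite -ge0_integralD//; [|exact: mF|exact: mF].
  transitivity (\int[mu]_x (((a + b ^+ 2) *+ 2) * p x + (c ^+ 2 *+ 2) * (p x * x ^+ 2))%:E)%E.
    by apply: eq_integral => x _; rewrite /F -!EFinM -EFinD; congr EFin; ring.
  rewrite ge0_integral_pdfDsqr ?mulrn_wge0 ?addr_ge0 ?sqr_ge0//.
  rewrite integral_normal_pdf integral_normal_pdf_sqr mule1 -EFinM -EFinD.
  by congr EFin; ring.
rewrite FN; have : (0 <= \int[mu]_x F c x)%E by exact: integral_ge0.
clear ge0_integral_pdfDsqr; move=> I0 II; rewrite -[LHS]/(\int[mu]_x F c x)%E.
move: I0 II.
case: (\int[mu]_x F c x)%E {FN} => [j| |]//= _ [] h.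
by congr EFin; lra.
Qed.

End gaussian.

(** * Iterated integration against kernels *)

Section tuple_measurability.
Context {R : realType} d (T : measurableType d).

Lemma measurable_rcons n (f : T -> n.-tuple R) (g : T -> R) :
  measurable_fun setT f -> measurable_fun setT g ->
  measurable_fun setT (fun x => [tuple of rcons (f x) (g x)]).
Proof.
move=> mf mg; apply/measurable_fun_tnthP => i.
have [ni|ni] := ltnP i n.
  rewrite (_ : _ \o _ = (fun x => tnth (f x) (Ordinal ni))).
    exact: (measurableT_comp (measurable_tnth _)).
  by apply/funext => x /=; rewrite !(tnth_nth 0)/= nth_rcons size_tuple ni.
rewrite (_ : _ \o _ = g)//; apply/funext => x /=.
rewrite (tnth_nth 0)/= nth_rcons size_tuple ltnNge ni/=.
by have -> : nat_of_ord i == n by rewrite eqn_leq ni andbT -ltnS.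
Qed.

Lemma measurable_nth n (f : T -> n.-tuple R) i :
  measurable_fun setT f -> measurable_fun setT (fun x => nth 0 (f x) i).
Proof.
move=> mf; have [ni|ni] := ltnP i n.
  rewrite (_ : (fun _ => _) = (fun x => tnth (f x) (Ordinal ni))).
    exact: (measurableT_comp (measurable_tnth _)).
  by apply/funext => x /=; rewrite (tnth_nth 0).
rewrite (_ : (fun _ => _) = cst 0)//; apply/funext => x.
by rewrite nth_default ?size_tuple.
Qed.

Lemma measurable_tuple_nth n (f : T -> n.-tuple R) :
  (forall i, (i < n)%N -> measurable_fun setT (fun x => nth 0 (f x) i)) ->
  measurable_fun setT f.
Proof.
move=> mf; apply/measurable_fun_tnthP => i.
rewrite (_ : _ \o _ = (fun x => nth 0 (f x) i)); first exact: mf.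
by apply/funext => x /=; rewrite (tnth_nth 0).
Qed.

End tuple_measurability.

Section kint.
Context {R : realType}.
Notation mu := (@lebesgue_measure R).
Implicit Types (k : seq R -> R -> R) (p s : seq R) (F G : seq R -> \bar R).

(* [k p y] is a conditional density of the next sample y given the past p, and
   [kint k n p F] the expectation of F over the past p extended by n samples. *)
Fixpoint kint k (n : nat) p F : \bar R :=
  if n is n'.+1 then (\int[mu]_y ((k p y)%:E * kint k n' (rcons p y) F))%E
  else F p.

(** Functionals act on lists, so that pasts of all lengths share one type, while measurability is
    stated length by length on tuples. The parameter in [U] is there because Tonelli's theorem needs
    joint measurability. *)
Definition smeas d (U : measurableType d) n (F : U -> seq R -> \bar R) :=
  measurable_fun [set: U * n.-tuple R] (fun q => F q.1 q.2).

Definition ukmeas d (U : measurableType d) (k : U -> seq R -> R -> R) :=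
  forall n, measurable_fun [set: (U * n.-tuple R) * R] (fun q => k q.1.1 q.1.2 q.2).

Definition tmeas n F := measurable_fun [set: n.-tuple R] (fun t => F t).

Definition kmeas k :=
  forall n, measurable_fun [set: n.-tuple R * R] (fun q => k q.1 q.2).

Lemma smeas_comp d (U : measurableType d) d' (T : measurableType d') n
    (F : U -> seq R -> \bar R) (f : T -> U) (g : T -> n.-tuple R) :
  smeas n F -> measurable_fun setT f -> measurable_fun setT g ->
  measurable_fun setT (fun x => F (f x) (g x)).
Proof.
move=> mF mf mg.
exact: (measurableT_comp mF (measurable_fun_pair mf mg)).
Qed.

Lemma kint_ge0 k n p F : (forall p y, 0 <= k p y) ->
  (forall s, (0 <= F s)%E) -> (0 <= kint k n p F)%E.
Proof.
move=> k0 F0; elim: n p => [|n IH] p //=.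
by apply: integral_ge0 => y _; rewrite mule_ge0// lee_fin.
Qed.

Lemma smeas_kint d (U : measurableType d) (k : U -> seq R -> R -> R) N
    (F : U -> seq R -> \bar R) n m :
  (forall u p y, 0 <= k u p y) -> ukmeas k ->
  (forall u s, (0 <= F u s)%E) -> smeas N F -> (m + n)%N = N ->
  smeas m (fun u p => kint (k u) n p (F u)).
Proof.
move=> k0 mk F0 mF; elim: n m => [|n IH] m.
  by rewrite addn0 => ->.
rewrite addnS -addSn => /IH {}IH.
pose f (q : (U * m.-tuple R) * R) : \bar R :=
  ((k q.1.1 q.1.2 q.2)%:E * kint (k q.1.1) n (rcons q.1.2 q.2) (F q.1.1))%E.
have mf : measurable_fun setT f.
  apply: emeasurable_funM; first by apply/measurable_EFinP; exact: (mk m).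
  have := @smeas_comp _ U _ ((U * m.-tuple R) * R)%type m.+1
    (fun u p => kint (k u) n p (F u)) (fun q => q.1.1)
    (fun q => [tuple of rcons q.1.2 q.2]) IH; apply.
    exact: (measurableT_comp measurable_fst).
  by apply: measurable_rcons => //; exact: (measurableT_comp measurable_snd).
have f0 q : (0 <= f q)%E.
  by rewrite mule_ge0 ?lee_fin// kint_ge0.
have := @measurable_fun_fubini_tonelli_F _ _ _ _ R mu f mf f0.
by rewrite /smeas /fubini_F.
Qed.

Lemma tmeas_smeas d (U : measurableType d) n F :
  tmeas n F -> smeas n (fun _ : U => F).
Proof. by move=> mF; exact: (measurableT_comp mF). Qed.

Lemma smeas_tmeas d (U : measurableType d) n (F : U -> seq R -> \bar R) u :
  smeas n F -> tmeas n (F u).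
Proof. by move=> mF; apply: (smeas_comp (g := id) mF) => //; exact: measurable_id. Qed.

Lemma kmeas_ukmeas d (U : measurableType d) k : kmeas k -> ukmeas (fun _ : U => k).
Proof.
move=> mk n; apply: (measurableT_comp (mk n)
  (measurable_fun_pair (measurableT_comp measurable_snd measurable_fst) measurable_snd)).
Qed.

Lemma tmeas_seq d (T : measurableType d) n F (f : T -> n.-tuple R) :
  tmeas n F -> measurable_fun setT f -> measurable_fun setT (fun x => F (f x)).
Proof. by move=> mF mf; exact: (measurableT_comp mF). Qed.

Lemma kmeas_comp d (T : measurableType d) k n (f : T -> n.-tuple R) (g : T -> R) :
  kmeas k -> measurable_fun setT f -> measurable_fun setT g ->
  measurable_fun setT (fun x => k (f x) (g x)).
Proof.
by move=> mk mf mg; exact: (measurableT_comp (mk n) (measurable_fun_pair mf mg)).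
Qed.

Section fixed_kernel.
Variable k : seq R -> R -> R.
Hypotheses (k0 : forall p y, 0 <= k p y) (mk : kmeas k).

Lemma tmeas_kint N F n m : (forall s, (0 <= F s)%E) -> tmeas N F ->
  (m + n)%N = N -> tmeas m (fun p => kint k n p F).
Proof.
move=> F0 mF mnN; apply: (@smeas_tmeas _ R m (fun _ p => kint k n p F) 0).
apply: (smeas_kint (k := fun=> k) (F := fun=> F) _ _ _ _ mnN) => //.
  exact: kmeas_ukmeas.
exact: tmeas_smeas.
Qed.

Lemma measurable_kernel p : measurable_fun setT (k p).
Proof.
apply: (@kmeas_comp _ _ k (size p) (fun=> in_tuple p) id) => //.
Qed.

Lemma measurable_rconsr p :
  measurable_fun [set: R] (fun y => [tuple of rcons (in_tuple p) y]).
Proof. by apply: measurable_rcons => //; exact: measurable_id. Qed.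

Lemma measurable_kint N F n p : (forall s, (0 <= F s)%E) -> tmeas N F ->
  (size p + n.+1)%N = N ->
  measurable_fun setT (fun y => ((k p y)%:E * kint k n (rcons p y) F)%E).
Proof.
move=> F0 mF; rewrite addnS -addSn => e; apply: emeasurable_funM.
  by apply/measurable_EFinP; exact: measurable_kernel.
have := @tmeas_seq _ _ _ (fun p => kint k n p F) _ (tmeas_kint F0 mF e) (@measurable_rconsr p).
exact.
Qed.

Lemma eq_kint N F G n p : (forall s, size s = N -> F s = G s) ->
  (size p + n)%N = N -> kint k n p F = kint k n p G.
Proof.
move=> FG; elim: n p => [|n IH] p /=; first by rewrite addn0 => /FG.
rewrite addnS -addSn => e; apply: eq_integral => y _.
by rewrite IH ?size_rcons.
Qed.

Lemma kint_le N F G n p : (forall s, (0 <= F s)%E) -> tmeas N F ->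
  (forall s, (0 <= G s)%E) -> tmeas N G ->
  (forall s, size s = N -> (F s <= G s)%E) ->
  (size p + n)%N = N -> (kint k n p F <= kint k n p G)%E.
Proof.
move=> F0 mF G0 mG FG; elim: n p => [|n IH] p /=; first by rewrite addn0 => /FG.
move=> e; apply: ge0_le_integral => //.
- by move=> y _; rewrite mule_ge0 ?lee_fin// kint_ge0.
- exact: measurable_kint e.
- exact: measurable_kint e.
- move=> y _; apply: lee_wpmul2l; first by rewrite lee_fin.
  by apply: IH; rewrite size_rcons addSn -addnS.
Qed.

Lemma kintD N F G n p : (forall s, (0 <= F s)%E) -> tmeas N F ->
  (forall s, (0 <= G s)%E) -> tmeas N G -> (size p + n)%N = N ->
  (kint k n p (fun s => F s + G s) = kint k n p F + kint k n p G)%E.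
Proof.
move=> F0 mF G0 mG; elim: n p => [|n IH] p //= e.
rewrite -ge0_integralD//.
- apply: eq_integral => y _; rewrite IH ?size_rcons ?addSn -?addnS//.
  by rewrite ge0_muleDr// kint_ge0.
- by move=> y _; rewrite mule_ge0 ?lee_fin// kint_ge0.
- exact: measurable_kint e.
- by move=> y _; rewrite mule_ge0 ?lee_fin// kint_ge0.
- exact: measurable_kint e.
Qed.

Lemma kintZl N F n p (c : \bar R) : (0 <= c)%E -> (forall s, (0 <= F s)%E) -> tmeas N F ->
  (size p + n)%N = N -> (kint k n p (fun s => c * F s) = c * kint k n p F)%E.
Proof.
move=> c0 F0 mF; elim: n p => [|n IH] p //= e.
rewrite -ge0_integralZl//.
- by apply: eq_integral => y _; rewrite IH ?size_rcons ?addSn -?addnS// muleCA.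
- exact: measurable_kint e.
- by move=> y _; rewrite mule_ge0 ?lee_fin// kint_ge0.
Qed.

Lemma kint0 n p : kint k n p (fun=> 0%E) = 0%E.
Proof.
elim: n p => [|n IH] p //=.
by apply: integral0_eq => y _; rewrite IH mule0.
Qed.

Lemma kint_sum (I : Type) (r : seq I) N (F : I -> seq R -> \bar R) n p :
  (forall i s, (0 <= F i s)%E) -> (forall i, tmeas N (F i)) -> (size p + n)%N = N ->
  (kint k n p (fun s => \sum_(i <- r) F i s) = \sum_(i <- r) kint k n p (F i))%E.
Proof.
move=> F0 mF e; elim: r => [|i r IH].
  by under eq_fun do rewrite big_nil; rewrite big_nil kint0.
under eq_fun do rewrite big_cons.
rewrite big_cons (kintD _ _ _ _ e) ?IH//.
  by move=> s; exact: sume_ge0.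
by apply: emeasurable_sum => j; exact: mF.
Qed.

(** [kint] unfolds at the first new sample; arguments along time integrate out the last one. *)
Lemma kint_rcons F n p :
  kint k n.+1 p F = kint k n p (fun s => \int[mu]_y ((k s y)%:E * F (rcons s y)))%E.
Proof.
elim: n p => [//|n IH] p; apply: eq_integral => y _.
by congr (_ * _)%E; exact: IH.
Qed.

Hypothesis k1 : forall p, (\int[mu]_y (k p y)%:E = 1)%E.

Lemma kint_cst n p (c : \bar R) : (0 <= c)%E -> kint k n p (fun=> c) = c.
Proof.
move=> c0; elim: n p => [|n IH] p //=.
under eq_integral do rewrite IH.
rewrite ge0_integralZr// ?k1 ?mul1e//.
  by apply/measurable_EFinP; exact: measurable_kernel.
by move=> y _; rewrite lee_fin.
Qed.

(** Causality: the kernel has total mass one, so the samples after time [i] integrate out. *)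
Lemma kint_take F n i p : (i <= n)%N -> (forall s, (0 <= F s)%E) ->
  kint k n p (fun s => F (take (size p + i) s)) = kint k i p F.
Proof.
elim: n i p => [|n IH] i p.
  by rewrite leqn0 => /eqP -> F0 /=; rewrite addn0 take_size.
case: i => [_|i ni] F0.
  rewrite addn0 -[RHS](kint_cst n.+1 p (F0 p)).
  suff H m q : kint k m (p ++ q) (fun s => F (take (size p) s)) =
      kint k m (p ++ q) (fun=> F p) by have := H n.+1 [::]; rewrite cats0.
  elim: m q => [|m IHm] q /=; first by rewrite take_size_cat.
  by apply: eq_integral => y _; rewrite rcons_cat IHm.
apply: eq_integral => y _; congr (_ * _)%E.
have := IH i (rcons p y) ni F0.
by rewrite size_rcons addSn -addnS.
Qed.

End fixed_kernel.
End kint.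

Section kint_more.
Context {R : realType}.
Notation mu := (@lebesgue_measure R).
Implicit Types (k : seq R -> R -> R) (p s : seq R) (F G : seq R -> \bar R).

(** Change of measure, by induction on the last sample, where the factor [k' / k] turns an integral
    against [k] into one against [k']. Positivity of [k] is asked only beyond the initial past,
    because the uniform densities of the private variables vanish somewhere. *)
Lemma kint_lr k k' N F n p : (forall s y, 0 <= k' s y) -> kmeas k' ->
  (forall s y, (size p <= size s)%N -> 0 < k s y) ->
  (forall s, (0 <= F s)%E) -> tmeas N F -> (size p + n)%N = N ->
  kint k n p (fun s => ((\prod_(size p <= i < N)
     (k' (take i s) (nth 0 s i) / k (take i s) (nth 0 s i)))%:E * F s)%E) =
  kint k' n p F.
Proof.
move=> k'0 mk' k0; elim: n N F => [|n IH] N F F0 mF e.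
  by rewrite /= -e addn0 big_geq// mul1e.
rewrite kint_rcons [RHS]kint_rcons.
have e' : (size p + n)%N = N.-1 by rewrite -e addnS.
rewrite -(IH N.-1)//; last 2 first.
- by move=> s; apply: integral_ge0 => y _; rewrite mule_ge0 ?lee_fin.
- have := tmeas_kint k'0 mk' (n := 1) (m := N.-1) F0 mF; apply.
  by rewrite addn1 -e addnS.
apply: (@eq_kint _ k N.-1) => // s ss.
rewrite -ge0_integralZl//; last first.
- rewrite lee_fin big_nat; apply: prodr_ge0 => i /andP[pi iN].
  rewrite divr_ge0// ltW// k0// size_take_min.
  by rewrite ss; move: pi iN; lia.
- by move=> y _; rewrite mule_ge0 ?lee_fin.
- have := measurable_kint k'0 mk' (n := 0) (p := s) F0 mF; apply.
  by rewrite addn1 ss -e addnS.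
apply: eq_integral => y _.
have N0 : N = N.-1.+1 by rewrite -e addnS.
rewrite [in X in \prod_(_ <= _ < X) _]N0 big_nat_recr/=; last by rewrite -e' leq_addr.
rewrite -ss -cats1 take_size_cat// nth_cat ltnn subnn/=.
rewrite (_ : \prod_(_ <= _ < _) _ = \prod_(size p <= i < size s)
     (k' (take i s) (nth 0 s i) / k (take i s) (nth 0 s i))); last first.
  apply: eq_big_nat => i /andP[_ si].
  by rewrite take_cat nth_cat si.
rewrite !muleA -!EFinM; congr (_%:E * _)%E.
by field; rewrite gt_eqF// k0// ss -e' leq_addr.
Qed.

Lemma kint_integral_exchange k N (F : R -> seq R -> \bar R) n p :
  (forall s y, 0 <= k s y) -> kmeas k ->
  (forall y s, (0 <= F y s)%E) -> smeas N F -> (size p + n)%N = N ->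
  (\int[mu]_y kint k n p (F y) = kint k n p (fun s => \int[mu]_y F y s))%E.
Proof.
move=> k0 mk F0 mF; elim: n p => [//|n IH] p e.
have e' y : (size (rcons p y) + n)%N = N by rewrite size_rcons addSn -addnS.
have mS : smeas (size p).+1 (fun y p => kint k n p (F y)).
  apply: (smeas_kint (k := fun=> k) _ _ _ mF) => //.
    exact: kmeas_ukmeas.
  by rewrite addSn -addnS.
pose f (q : R * R) : \bar R := ((k p q.2)%:E * kint k n (rcons p q.2) (F q.1))%E.
have mf : measurable_fun setT f.
  apply: emeasurable_funM.
    apply/measurable_EFinP.
    exact: (measurableT_comp (@measurable_kernel _ _ mk p) measurable_snd).
  have := @smeas_comp R _ R _ (R * R)%type (size p).+1
    (fun y p => kint k n p (F y)) fst (fun q => [tuple of rcons (in_tuple p) q.2]) mS.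
  by apply => //; apply: measurable_rcons.
have f0 q : (0 <= f q)%E.
  by apply: mule_ge0; [rewrite lee_fin|exact: kint_ge0].
have := @fubini_tonelli _ _ _ _ R mu mu f mf f0; rewrite /f /= => ->.
apply: eq_integral => x _; rewrite -IH//.
rewrite ge0_integralZl ?lee_fin//; last by move=> y _; exact: kint_ge0.
have := @smeas_comp R _ R _ R (size p).+1
  (fun y p => kint k n p (F y)) id (fun=> [tuple of rcons (in_tuple p) x]) mS.
by apply => //; exact: measurable_id.
Qed.

Lemma kint_exchange k k' n m N M (G : seq R -> seq R -> \bar R) p q :
  (forall s y, 0 <= k s y) -> kmeas k -> (forall s y, 0 <= k' s y) -> kmeas k' ->
  (forall s z, (0 <= G s z)%E) ->
  measurable_fun [set: N.-tuple R * M.-tuple R] (fun x => G x.1 x.2) ->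
  (size p + n)%N = N -> (size q + m)%N = M ->
  kint k n p (fun s => kint k' m q (G s)) =
  kint k' m q (fun z => kint k n p (fun s => G s z)).
Proof.
move=> k0 mk k'0 mk' G0 mG + eM; elim: n p => [//|n IH] p e.
have mS : @smeas R _ (M.-tuple R) (size p).+1
    (fun z s => kint k n s (fun s => G s z)).
  apply: (@smeas_kint R _ _ (fun=> k) N (fun (z : M.-tuple R) s => G s z) n (size p).+1) => //.
  - exact: kmeas_ukmeas.
  - exact: (measurableT_comp mG (measurable_fun_pair measurable_snd measurable_fst)).
  - by rewrite addSn -addnS.
pose F y z := ((k p y)%:E * kint k n (rcons p y) (fun s => G s z))%E.
have F0 y z : (0 <= F y z)%E.
  by apply: mule_ge0; [rewrite lee_fin|exact: kint_ge0].
have mF : smeas M F.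
  apply: emeasurable_funM.
    apply/measurable_EFinP.
    exact: (measurableT_comp (@measurable_kernel _ _ mk p) measurable_fst).
  have := @smeas_comp R _ (M.-tuple R) _ (R * M.-tuple R)%type (size p).+1
    (fun z s => kint k n s (fun s => G s z)) snd
    (fun q => [tuple of rcons (in_tuple p) q.1]) mS.
  by apply => //; apply: measurable_rcons.
have := kint_integral_exchange k'0 mk' F0 mF eM; rewrite /= => <-.
apply: eq_integral => y _; rewrite IH; last by rewrite size_rcons addSn -addnS.
rewrite (@kintZl _ _ k'0 mk' M)//.
- by rewrite lee_fin.
- by move=> s; exact: kint_ge0.
- have := @smeas_comp R _ (M.-tuple R) _ (M.-tuple R)%type (size p).+1
    (fun z s => kint k n s (fun s => G s z)) id
    (fun q => [tuple of rcons (in_tuple p) y]) mS.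
  by apply => //; exact: measurable_id.
Qed.

Lemma iter_int_kint g n F :
  iter_int g (fun t : n.-tuple R => F t) = kint (fun=> g) n [::] F.
Proof.
suff H p : iter_int g (fun t : n.-tuple R => F (p ++ t)) = kint (fun=> g) n p F.
  exact: (H [::]).
elim: n p => [|n IH] p /=; first by rewrite cats0.
apply: eq_integral => y _; congr (_ * _)%E; rewrite -IH.
by congr (iter_int _ _); apply/funext => t /=; rewrite cat_rcons.
Qed.

(** Passage from noise to outputs: given the past, the next output is the noise translated by [a p],
    and Lebesgue measure is translation invariant. *)
Lemma iter_int_foldl (g : R -> R) (a : seq R -> R) N n p F :
  (forall y, 0 <= g y) -> kmeas (fun p y => g (y - a p)) ->
  (forall s, (0 <= F s)%E) -> tmeas N F -> (size p + n)%N = N ->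
  iter_int g (fun t : n.-tuple R => F (foldl (fun s x => rcons s (a s + x)) p t)) =
  kint (fun p y => g (y - a p)) n p F.
Proof.
move=> g0 mk F0 mF; elim: n p => [//|n IH] p e.
rewrite /= -[RHS](ge0_integral_shift (a p)); last 2 first.
- have := measurable_kint (fun p y => g0 (y - a p)) mk (n := n) (p := p) F0 mF e; exact.
- by move=> x; apply: mule_ge0; [rewrite lee_fin|exact: kint_ge0].
apply: eq_integral => y _.
rewrite addrK IH; last by rewrite size_rcons addSn -addnS.
by rewrite addrC.
Qed.

End kint_more.

(** * The Gaussian channel as a transition kernel *)

Section channel.
Context {R : realType}.
Notation mu := (@lebesgue_measure R).
Implicit Types (p s : seq R) (a : seq R -> R) (F : seq R -> \bar R).

Definition chan a (sd : R) : seq R -> R -> R := fun p y => normal_pdf 0 sd (y - a p).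

Definition rmeas a := forall n, measurable_fun [set: n.-tuple R] (fun t => a t).

Lemma chan_ge0 a sd p y : 0 <= chan a sd p y.
Proof. exact: normal_pdf_ge0. Qed.

Lemma kmeas_chan a sd : rmeas a -> kmeas (chan a sd).
Proof.
move=> ma n; apply: (measurableT_comp (measurable_normal_pdf 0 sd)).
apply: measurable_funB; first exact: measurable_snd.
exact: (measurableT_comp (ma n) measurable_fst).
Qed.

Lemma chan_quadratic a sd (b c d : R) p : 0 < sd -> 0 <= b ->
  (\int[mu]_y ((chan a sd p y)%:E * (b + (c + d * y) ^+ 2)%:E) =
   (b + (c + d * a p) ^+ 2 + d ^+ 2 * sd ^+ 2)%:E)%E.
Proof.
move=> sd0 b0; have := integral_normal_pdf_quadratic sd0 (c + d * a p) d b0.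
rewrite -(ge0_integral_shift (- a p)); last 2 first.
- apply: measurable_normal_pdfM; apply/measurable_EFinP.
  apply: measurable_funD => //; apply: measurable_funX.
  by apply: measurable_funD => //; exact: measurable_funM.
- by move=> x; rewrite -EFinM lee_fin mulr_ge0 ?normal_pdf_ge0 ?addr_ge0 ?sqr_ge0.
move=> <-; apply: eq_integral => y _; congr (_ * _%:E)%E.
by congr (_ + _ ^+ 2); ring.
Qed.

Lemma chan_prob a sd p : (\int[mu]_y (chan a sd p y)%:E = 1)%E.
Proof.
rewrite -(integral_normal_pdf 0 sd) -[RHS](ge0_integral_shift (- a p))//.
- by apply/measurable_EFinP; exact: measurable_normal_pdf.
- by move=> x; rewrite lee_fin normal_pdf_ge0.
Qed.

Lemma eq_kernel (k k' : seq R -> R -> R) n p F :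
  (forall s y, (size p <= size s)%N -> k s y = k' s y) -> kint k n p F = kint k' n p F.
Proof.
elim: n p => [//|n IH] p kk' /=; apply: eq_integral => y _.
rewrite kk'// IH// => s z; rewrite size_rcons => ps; apply: kk'; exact: ltnW.
Qed.

Lemma measurable_take n i d (T : measurableType d) (f : T -> n.-tuple R) :
  measurable_fun setT f -> measurable_fun setT (fun x => [tuple of take i (f x)]).
Proof.
move=> mf; apply: measurable_tuple_nth => j /=; rewrite leq_min => /andP[ji _].
by under eq_fun do rewrite nth_take//; exact: measurable_nth.
Qed.

Lemma measurable_drop n i d (T : measurableType d) (f : T -> n.-tuple R) :
  measurable_fun setT f -> measurable_fun setT (fun x => [tuple of drop i (f x)]).
Proof.
move=> mf; apply: measurable_tuple_nth => j /= _.
by under eq_fun do rewrite nth_drop//; exact: measurable_nth.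
Qed.

End channel.

(** * A code as one kernel for private randomness and outputs *)

Section code.
Context {R : realType}.
Notation mu := (@lebesgue_measure R).
Variables (N M1 M2 : nat) (c : gmac_code (R := R) M1 M2) (var1 : R).
Hypothesis mc : code_measurable N c.
Hypothesis var1_gt0 : 0 < var1.
Implicit Types (p s : seq R) (F : seq R -> \bar R).

(* In a sequence the two private variables u_1, u_2 come first and are followed
   by the channel outputs. *)
Definition x1 (w1 : 'I_M1) s := enc1 c (size s - 2) w1 (drop 2 s) (nth 0 s 0).
Definition x2 (w2 : 'I_M2) s := enc2 c (size s - 2) w2 (drop 2 s) (nth 0 s 1).

(** Positions 0 and 1 draw the uniform private variables, later ones use the channel; an expectation
    [cexp] is then a single [kint] of length [N.+2]. *)
Definition ckern w1 w2 p (y : R) : R :=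
  if (size p < 2)%N then \1_(`[0, 1] : set R) y
  else chan (fun p => x1 w1 p + x2 w2 p) (Num.sqrt var1) p y.

Lemma sqrt_var1_gt0 : 0 < Num.sqrt var1. Proof. by rewrite sqrtr_gt0. Qed.

Lemma ckern_ge0 w1 w2 p y : 0 <= ckern w1 w2 p y.
Proof. by rewrite /ckern; case: ifP => _; rewrite ?chan_ge0 ?indicE. Qed.

Lemma rmeas_x1 w1 : rmeas (x1 w1).
Proof.
move=> n; rewrite /x1; under eq_fun do rewrite size_tuple.
have [m _ _] := mc.
have := measurableT_comp (m (n - 2)%N w1) (measurable_fun_pair
  (@measurable_drop R n 2 _ (n.-tuple R) id (@measurable_id _ _ setT))
  (@measurable_nth R _ (n.-tuple R) n id 0 (@measurable_id _ _ setT))).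
exact.
Qed.

Lemma rmeas_x2 w2 : rmeas (x2 w2).
Proof.
move=> n; rewrite /x2; under eq_fun do rewrite size_tuple.
have [_ m _] := mc.
have := measurableT_comp (m (n - 2)%N w2) (measurable_fun_pair
  (@measurable_drop R n 2 _ (n.-tuple R) id (@measurable_id _ _ setT))
  (@measurable_nth R _ (n.-tuple R) n id 1 (@measurable_id _ _ setT))).
exact.
Qed.

Lemma rmeas_x12 w1 w2 : rmeas (fun p => x1 w1 p + x2 w2 p).
Proof.
by move=> n; apply: measurable_funD; [exact: rmeas_x1|exact: rmeas_x2].
Qed.

Lemma kmeas_ckern w1 w2 : kmeas (ckern w1 w2).
Proof.
move=> n; rewrite /ckern; under eq_fun do rewrite size_tuple.
have [_|_] := ltnP n 2; last by have := @kmeas_chan R _ (Num.sqrt var1) (rmeas_x12 w1 w2) n; exact.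
by apply: (measurableT_comp _ measurable_snd); exact: measurable_indic.
Qed.

Lemma ckern_prob w1 w2 p : (\int[mu]_y (ckern w1 w2 p y)%:E = 1)%E.
Proof.
rewrite /ckern; case: ltnP => _; last exact: chan_prob.
rewrite integral_indic//= setIT lebesgue_measure_itv/= lte_fin ltr01.
by rewrite -EFinB subr0.
Qed.

Lemma outputs_foldl w1 w2 u1 u2 (e : seq R) k : (k <= size e)%N ->
  outputs c w1 w2 u1 u2 e k =
  foldl (fun s x => rcons s (enc1 c (size s) w1 s u1 + enc2 c (size s) w2 s u2 + x))
    [::] (take k e).
Proof.
elim: k => [|k IH] ke; first by rewrite take0.
rewrite (take_nth 0)// foldl_rcons /= -IH; last exact: ltnW.
have -> // : size (outputs c w1 w2 u1 u2 e k) = k.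
by elim: (k) => //= n; rewrite size_rcons => ->.
Qed.

Lemma size_outputs w1 w2 u1 u2 (e : seq R) k : size (outputs c w1 w2 u1 u2 e k) = k.
Proof. by elim: k => //= n; rewrite size_rcons => ->. Qed.

Lemma take_outputs w1 w2 u1 u2 (e : seq R) k i : (i <= k)%N ->
  take i (outputs c w1 w2 u1 u2 e k) = outputs c w1 w2 u1 u2 e i.
Proof.
elim: k => [|k IH]; first by rewrite leqn0 => /eqP ->.
rewrite leq_eqVlt => /predU1P[->|].
  by rewrite take_oversize// size_outputs.
rewrite ltnS => ik; rewrite -IH//= -cats1 takel_cat//.
by rewrite size_outputs.
Qed.

Lemma foldl_prefix w1 w2 u1 u2 q (t : seq R) :
  foldl (fun s x => rcons s (x1 w1 s + x2 w2 s + x)) (u1 :: u2 :: q) t =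
  u1 :: u2 :: foldl (fun s x =>
    rcons s (enc1 c (size s) w1 s u1 + enc2 c (size s) w2 s u2 + x)) q t.
Proof.
elim: t q => [//|x t IH] q /=; rewrite -IH; congr foldl.
by rewrite /x1 /x2 /= drop0 !subSS subn0.
Qed.

Lemma cexp_kint w1 w2 (G : R -> R -> seq R -> \bar R) F :
  (forall u1 u2 y, size y = N -> G u1 u2 y = F [:: u1, u2 & y]) ->
  (forall s, (0 <= F s)%E) -> tmeas N.+2 F ->
  cexp N var1 (fun u1 u2 e => G u1 u2 (outputs c w1 w2 u1 u2 e N)) =
  kint (ckern w1 w2) N.+2 [::] F.
Proof.
move=> GF F0 mF; rewrite /cexp /= integral_mkcond; apply: eq_integral => u1 _.
rewrite /ckern/= /patch indicE; case: ifPn => u1I; rewrite ?mul1e ?mul0e//.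
rewrite integral_mkcond; apply: eq_integral => u2 _.
rewrite /patch indicE; case: ifPn => u2I; rewrite ?mul1e ?mul0e//.
rewrite -/(ckern w1 w2).
under eq_fun do rewrite GF ?size_outputs// outputs_foldl ?size_tuple//
  take_oversize ?size_tuple// -foldl_prefix.
rewrite (iter_int_foldl (N := N.+2))//; last 2 first.
- by move=> y; exact: normal_pdf_ge0.
- exact: (@kmeas_chan R _ (Num.sqrt var1) (rmeas_x12 w1 w2)).
by apply: eq_kernel => s y /= ss; rewrite /ckern ltnNge ss.
Qed.

End code.

(** * Converse *)

Section message_average.
Context {R : realType}.
Variables (M1 M2 : nat).
Hypotheses (M1_gt0 : (0 < M1)%N) (M2_gt0 : (0 < M2)%N).
Implicit Types H : 'I_M1 -> 'I_M2 -> \bar R.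

Let Minv_ge0 : (0 <= (((M1 * M2)%:R)^-1)%:E :> \bar R)%E.
Proof. by rewrite lee_fin invr_ge0 ler0n. Qed.

Lemma mavg_ge0 H : (forall w1 w2, (0 <= H w1 w2)%E) -> (0 <= mavg H)%E.
Proof.
move=> H0; apply: mule_ge0 => //.
by apply: sume_ge0 => w1 _; apply: sume_ge0 => w2 _.
Qed.

Lemma mavg_le H H' : (forall w1 w2, (H w1 w2 <= H' w1 w2)%E) -> (mavg H <= mavg H')%E.
Proof.
move=> HH; apply: lee_wpmul2l => //.
by apply: lee_sum => w1 _; apply: lee_sum => w2 _.
Qed.

Lemma eq_mavg H H' : (forall w1 w2, H w1 w2 = H' w1 w2) -> mavg H = mavg H'.
Proof. by move=> HH; rewrite /mavg; under eq_bigr do under eq_bigr do rewrite HH. Qed.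

Lemma mavgD H H' : (forall w1 w2, (0 <= H w1 w2)%E) -> (forall w1 w2, (0 <= H' w1 w2)%E) ->
  (mavg (fun w1 w2 => H w1 w2 + H' w1 w2) = mavg H + mavg H')%E.
Proof.
move=> H0 H'0; rewrite /mavg.
under eq_bigr do rewrite big_split/=.
rewrite big_split/= ge0_muleDr//; apply: sume_ge0 => w1 _; exact: sume_ge0.
Qed.

Lemma mavgZl H (c : \bar R) : (0 <= c)%E -> (forall w1 w2, (0 <= H w1 w2)%E) ->
  (mavg (fun w1 w2 => c * H w1 w2) = c * mavg H)%E.
Proof.
move=> c0 H0; rewrite /mavg [RHS]muleCA; congr (_ * _)%E.
rewrite ge0_sume_distrr; last by move=> w1 _; exact: sume_ge0.
by apply: eq_bigr => w1 _; rewrite ge0_sume_distrr.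
Qed.

Lemma mavg_cst (c : R) : mavg (fun (_ : 'I_M1) (_ : 'I_M2) => c%:E) = c%:E.
Proof.
rewrite /mavg; under eq_bigr do rewrite sumEFin.
rewrite sumEFin -EFinM; congr EFin.
rewrite !sumr_const !card_ord -mulrnA mulnC -(mulr_natl c) mulrA mulVf ?mul1r//.
by rewrite pnatr_eq0 -lt0n muln_gt0 M1_gt0 M2_gt0.
Qed.

Lemma mavg_sum (I : Type) (r : seq I) (H : I -> 'I_M1 -> 'I_M2 -> \bar R) :
  (forall i w1 w2, (0 <= H i w1 w2)%E) ->
  (mavg (fun w1 w2 => \sum_(i <- r) H i w1 w2) = \sum_(i <- r) mavg (H i))%E.
Proof.
move=> H0; elim: r => [|i r IH].
  rewrite big_nil /mavg; under eq_bigr do under eq_bigr do rewrite big_nil.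
  by rewrite big1 ?mule0// => w1 _; rewrite big1.
rewrite big_cons -IH -mavgD//; last by move=> w1 w2; exact: sume_ge0.
by congr mavg; apply/funext => w1; apply/funext => w2; rewrite big_cons.
Qed.

Lemma mavg_affine_le (H1 H2 H3 : 'I_M1 -> 'I_M2 -> \bar R) (a b c d e f : R) :
  0 <= a -> 0 <= b -> 0 <= c -> 0 <= d -> 0 <= e -> 0 <= f ->
  (forall w1 w2, (0 <= H1 w1 w2)%E) -> (forall w1 w2, (0 <= H2 w1 w2)%E) ->
  (forall w1 w2, (0 <= H3 w1 w2)%E) ->
  (forall w1 w2, (a%:E * H1 w1 w2 + b%:E <=
     c%:E + (d%:E * H2 w1 w2 + e%:E * (1 + f%:E * H3 w1 w2)))%E) ->
  (a%:E * mavg H1 + b%:E <= c%:E + (d%:E * mavg H2 + e%:E * (1 + f%:E * mavg H3)))%E.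
Proof.
move=> a0 b0 c0 d0 e0 f0 H10 H20 H30 /mavg_le.
have P0 (x y : \bar R) : (0 <= x -> 0 <= y -> 0 <= x + y)%E by exact: adde_ge0.
have T0 (x : R) (y : \bar R) : 0 <= x -> (0 <= y -> 0 <= x%:E * y)%E.
  by move=> ?; apply: mule_ge0; rewrite lee_fin.
have F0 (x : R) : 0 <= x -> (0 <= x%:E)%E by rewrite lee_fin.
have one : (0 <= 1 :> \bar R)%E by [].
by rewrite !(mavgD, mavgZl, mavg_cst); auto 10.
Qed.

End message_average.

(** * Likelihood ratios against a reference law *)

Section converse.
Context {R : realType}.
Notation mu := (@lebesgue_measure R).
Variables (N M1 M2 : nat) (c : gmac_code (R := R) M1 M2) (var1 : R).
Hypothesis mc : code_measurable N c.
Hypothesis var1_gt0 : 0 < var1.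
Implicit Types (p s : seq R) (F : seq R -> \bar R).

Notation sd := (Num.sqrt var1).
Notation K w1 w2 := (kint (ckern c var1 w1 w2) N.+2 [::]).
Notation x1 := (x1 c).
Notation x2 := (x2 c).

(* The reference law: the outputs are Gaussian of standard deviation tau around
   a prediction m that does not involve the message to be guessed. *)
Definition qkern (m : seq R -> R) (tau : R) p (y : R) : R :=
  if (size p < 2)%N then \1_(`[0, 1] : set R) y else chan m tau p y.

Lemma qkern_ge0 m tau p y : 0 <= qkern m tau p y.
Proof. by rewrite /qkern; case: ifP => _; rewrite ?chan_ge0 ?indicE. Qed.

Lemma kmeas_qkern m tau : rmeas m -> kmeas (qkern m tau).
Proof.
move=> mm n; rewrite /qkern; under eq_fun do rewrite size_tuple.
have [_|_] := ltnP n 2; last by have := @kmeas_chan R _ tau mm n; exact.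
by apply: (measurableT_comp _ measurable_snd); exact: measurable_indic.
Qed.

Lemma qkern_prob m tau p : (\int[mu]_y (qkern m tau p y)%:E = 1)%E.
Proof.
rewrite /qkern; case: ltnP => _; last exact: chan_prob.
rewrite integral_indic//= setIT lebesgue_measure_itv/= lte_fin ltr01.
by rewrite -EFinB subr0.
Qed.

Lemma rmeas_take m n i : rmeas m ->
  measurable_fun [set: n.-tuple R] (fun t => m (take i t)).
Proof.
move=> mm; have := measurableT_comp (mm _)
  (@measurable_take R n i _ (n.-tuple R) id (@measurable_id _ _ setT)).
exact.
Qed.

Lemma measurable_nth_tuple n i : measurable_fun [set: n.-tuple R] (fun t => nth 0 t i).
Proof. exact: (@measurable_nth R _ _ n id i (@measurable_id _ _ setT)). Qed.

Definition innov (m : seq R -> R) i s : R := nth 0 s i - m (take i s).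

Lemma measurable_innov m n i : rmeas m ->
  measurable_fun [set: n.-tuple R] (fun t => innov m i t).
Proof.
move=> mm; apply: measurable_funB; first exact: measurable_nth_tuple.
exact: rmeas_take.
Qed.

(** The noise at time [i] is centered and independent of the past, so the noise variance and the
    mean square bias of the predictor [m] add up. *)
Lemma kint_innov w1 w2 (m : seq R -> R) i : rmeas m -> (2 <= i < N.+2)%N ->
  (K w1 w2 (fun s => (innov m i s ^+ 2)%:E) =
   var1%:E + K w1 w2 (fun s => ((x1 w1 (take i s) + x2 w2 (take i s) - m (take i s)) ^+ 2)%:E))%E.
Proof.
move=> mm /andP[i2 iN].
pose k := ckern c var1 w1 w2.
have k0 := ckern_ge0 c var1 w1 w2; have mk := kmeas_ckern var1 mc w1 w2.
have k1 := ckern_prob c var1 w1 w2.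
transitivity (K w1 w2 (fun s => (innov m i (take (size (Nil R) + i.+1) s) ^+ 2)%:E)).
  apply: (@eq_kint _ _ N.+2) => // s ss; congr ((_ ^+ 2)%:E).
  by rewrite /innov add0n nth_take// take_takel// ltnW.
rewrite (kint_take k0 mk k1 [::] (F := fun s => (innov m i s ^+ 2)%:E))//; last first.
  by move=> s; rewrite lee_fin sqr_ge0.
rewrite kint_rcons.
pose D s := x1 w1 s + x2 w2 s - m s.
have mD : rmeas D.
  by move=> n; apply: measurable_funB; [exact: (rmeas_x12 mc)|exact: mm].
have -> : kint k i [::] (fun s => \int[mu]_y ((k s y)%:E * (innov m i (rcons s y) ^+ 2)%:E))%E =
    kint k i [::] (fun s => (D s ^+ 2)%:E + var1%:E)%E.
  apply: (@eq_kint _ _ i) => // s ss.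
  have := @chan_quadratic R (fun p => x1 w1 p + x2 w2 p) sd 0 (- m s) 1 s
    (sqrt_var1_gt0 var1_gt0) (lexx _).
  rewrite !mul1r add0r expr1n mul1r sqr_sqrtr ?ltW// => h.
  rewrite -EFinD {1}/D addrC -addrC [x1 w1 s + _ - _]addrC -h; apply: eq_integral => y _.
  rewrite /k /ckern ltnNge ss i2/= add0r mul1r; congr (_ * (_ ^+ 2)%:E)%E.
  by rewrite /innov nth_rcons ss ltnn eqxx -cats1 take_size_cat// addrC.
rewrite (@kintD _ _ k0 mk i)//; last 4 first.
- by move=> s; rewrite lee_fin sqr_ge0.
- by apply/measurable_EFinP; apply: measurable_funX; exact: mD.
- by move=> s; rewrite lee_fin ltW.
- exact: measurable_cst.
rewrite (kint_cst k0 mk k1) ?lee_fin ?ltW// addeC; congr (_ + _)%E.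
rewrite -(kint_take k0 mk k1 [::] (ltnW iN))//.
by move=> s; rewrite lee_fin sqr_ge0.
Qed.

(** Both laws draw [u1] and [u2] from the same density, which vanishes outside [[0, 1]]; these two
    integrals are peeled off and [kint_lr] is applied from position 2 on. *)
Lemma kint_ckern_lr w1 w2 m tau F : 0 < tau -> rmeas m -> (forall s, (0 <= F s)%E) ->
  tmeas N.+2 F ->
  K w1 w2 (fun s => ((\prod_(2 <= i < N.+2)
     (chan m tau (take i s) (nth 0 s i) /
      chan (fun p => x1 w1 p + x2 w2 p)%R sd (take i s) (nth 0 s i)))%:E * F s)%E) =
  kint (qkern m tau) N.+2 [::] F.
Proof.
move=> tau0 mm F0 mF; apply: eq_integral => u1 _.
congr (_ * _)%E.
apply: eq_integral => u2 _.
congr (_ * _)%E.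
etransitivity; last first.
  apply: (@eq_kernel _ (chan m tau)) => s y /= ss.
  by rewrite /qkern ltnNge ss.
etransitivity.
  apply: (@eq_kernel _ _ (chan (fun p => x1 w1 p + x2 w2 p) sd)) => s y /= ss.
  by rewrite /ckern ltnNge ss.
have := @kint_lr R (chan (fun p => x1 w1 p + x2 w2 p) sd) (chan m tau) N.+2 F N [:: u1; u2].
apply => //; first exact: chan_ge0.
- exact: kmeas_chan.
- by move=> s y _; apply: normal_pdf_gt0; exact: sqrt_var1_gt0.
Qed.

End converse.

Local Opaque kint.

Section converse_pair.
Context {R : realType}.
Notation mu := (@lebesgue_measure R).
Variables (N M1 M2 : nat) (c : gmac_code (R := R) M1 M2) (var1 : R).
Hypothesis mc : code_measurable N c.
Hypothesis var1_gt0 : 0 < var1.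
Implicit Types (p s : seq R) (F : seq R -> \bar R).

Notation sd := (Num.sqrt var1).
Notation K w1 w2 := (kint (ckern c var1 w1 w2) N.+2 [::]).
Notation x1 := (x1 c).
Notation x2 := (x2 c).

(* Fano's inequality before integration: [L <= expR L - 1], where [L] is the log-likelihood ratio
   with [ln M] added on the event A of a correct guess; this avoids any entropy. *)
Lemma lr_pointwise (a m : seq R -> R) (tau M : R) (A : bool) s : 0 < tau -> 1 <= M ->
  A%:R * ln M + (var1 *+ 2)^-1 * (\sum_(i < N) innov a i.+2 s ^+ 2) + 1 <=
  ln 2 + N%:R * ln (tau / sd) + (tau ^+ 2 *+ 2)^-1 * (\sum_(i < N) innov m i.+2 s ^+ 2)
  + \prod_(2 <= i < N.+2) (chan m tau (take i s) (nth 0 s i) / chan a sd (take i s) (nth 0 s i))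
    * (2^-1 * (1 + M * A%:R)).
Proof.
move=> tau0 M1'; have sd0 : 0 < sd by rewrite sqrtr_gt0.
have M0 : 0 < M by rewrite (lt_le_trans _ M1').
rewrite !big_add1 big_mkord/=.
pose e i := innov a i.+2 s ^+ 2 / (var1 *+ 2) - innov m i.+2 s ^+ 2 / (tau ^+ 2 *+ 2).
have -> : \prod_(i < N) (chan m tau (take i.+2 s) (nth 0 s i.+2) /
    chan a sd (take i.+2 s) (nth 0 s i.+2)) = (sd / tau) ^+ N * expR (\sum_(i < N) e i).
  have -> : (sd / tau) ^+ N = \prod_(i < N) (sd / tau) by rewrite prodr_const card_ord.
  rewrite expR_sum -big_split; apply: eq_bigr => i _ /=.
  rewrite /chan -!normal_pdf_center// normal_pdf_ratio// /e /innov.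
  by rewrite sqr_sqrtr// ltW.
(* The summand [- ln 2] produces the weight [2^-1 * (1 + M * A%:R)], whose mean under the reference
   law is at most 1 as soon as a correct guess has probability at most [M^-1] there. *)
pose L := - ln 2 + A%:R * ln M + N%:R * ln (sd / tau) + \sum_(i < N) e i.
have st0 : 0 < sd / tau by rewrite divr_gt0.
have : expR L <= (sd / tau) ^+ N * expR (\sum_(i < N) e i) * (2^-1 * (1 + M * A%:R)).
  rewrite /L !expRD expRN lnK ?posrE// !expRM_natl !lnK ?posrE//.
  have hA : M ^+ A <= 1 + M * A%:R.
    by case: (A); rewrite ?mulr1 ?mulr0 ?addr0 ?expr0 ?expr1// lerDr.
  set t := (sd / tau) ^+ N; set e' := expR (\sum_(i < N) e i).
  have -> : 2^-1 * M ^+ A * t * e' = t * e' * 2^-1 * M ^+ A by ring.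
  rewrite [leRHS]mulrA; apply: ler_wpM2l => //.
  by rewrite !mulr_ge0 ?exprn_ge0 ?expR_ge0 ?invr_ge0// ltW.
have := expR_ge1Dx L; rewrite /L.
have -> : ln (tau / sd) = - ln (sd / tau) by rewrite -lnV ?posrE// invf_div.
rewrite sumrB -!mulr_suml; lra.
Qed.

Lemma measurable_chan_ratio (a m : seq R -> R) tau i : 0 < tau -> rmeas a -> rmeas m ->
  measurable_fun [set: N.+2.-tuple R] (fun s : N.+2.-tuple R =>
    chan m tau (take i s) (nth 0 s i) / chan a sd (take i s) (nth 0 s i)).
Proof.
move=> tau0 ma mm; rewrite /chan.
under eq_fun do rewrite -!normal_pdf_center ?sqrtr_gt0// normal_pdf_ratio ?sqrtr_gt0//.
apply: measurable_funM => //; apply: measurableT_comp => //.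
by apply: measurable_funB; apply: measurable_funM => //; apply: measurable_funX;
  exact: measurable_innov.
Qed.

Notation a w1 w2 := (fun p => x1 w1 p + x2 w2 p).

Definition dist2 w1 w2 (m : seq R -> R) i s : R :=
  (x1 w1 (take i s) + x2 w2 (take i s) - m (take i s)) ^+ 2.

(** This is [lr_pointwise] integrated over the true law: [kint_innov] evaluates the innovations, and
    the likelihood ratio moves its term to the reference law. Nothing is subtracted, since the
    powers are not yet known to be finite. *)
Lemma fano_pair w1 w2 (m : seq R -> R) (tau M : R) (A : pred (seq R)) :
  rmeas m -> sd <= tau -> 1 <= M -> tmeas N.+2 (fun s => ((A s)%:R : R)%:E) ->
  ((ln M)%:E * K w1 w2 (fun s => ((A s)%:R)%:E) + (N%:R / 2 + 1)%:E <=
   (ln 2 + N%:R * ln (tau / sd) + N%:R * var1 * (tau ^+ 2 *+ 2)^-1)%:E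
   + ((tau ^+ 2 *+ 2)^-1%:E * (\sum_(i < N) K w1 w2 (fun s => (dist2 w1 w2 m i.+2 s)%:E))
   + 2^-1%:E * (1 + M%:E * kint (qkern m tau) N.+2 [::] (fun s => ((A s)%:R)%:E))))%E.
Proof.
move=> mm sdtau M1' mA.
have sd0 : 0 < sd := sqrt_var1_gt0 var1_gt0.
have tau0 : 0 < tau := lt_le_trans sd0 sdtau.
have M0 : 0 < M by rewrite (lt_le_trans _ M1').
have k0 := ckern_ge0 c var1 w1 w2; have mk := kmeas_ckern var1 mc w1 w2.
have k1 := ckern_prob c var1 w1 w2.
have ma : rmeas (a w1 w2) := rmeas_x12 mc w1 w2.
have A0 s : (0 <= ((A s)%:R : R)%:E)%E by rewrite lee_fin.
have mI m' i : rmeas m' -> tmeas N.+2 (fun s => (innov m' i s ^+ 2)%:E).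
  move=> mm'; apply/measurable_EFinP; apply: measurable_funX; exact: measurable_innov.
have I0 m' i s : (0 <= (innov m' i s ^+ 2)%:E)%E by rewrite lee_fin sqr_ge0.
have mIs m' : rmeas m' -> tmeas N.+2 (fun s => \sum_(i < N) (innov m' i.+2 s ^+ 2)%:E)%E.
  by move=> mm'; apply: emeasurable_sum => i; exact: mI.
have Is0 m' s : (0 <= \sum_(i < N) (innov m' i.+2 s ^+ 2)%:E)%E by apply: sume_ge0 => i _.
have KI m' : rmeas m' -> (K w1 w2 (fun s => \sum_(i < N) (innov m' i.+2 s ^+ 2)%:E) =
    (N%:R * var1)%:E + \sum_(i < N) K w1 w2 (fun s => (dist2 w1 w2 m' i.+2 s)%:E))%E.
  move=> mm'; rewrite (@kint_sum _ _ k0 mk _ _ N.+2)//; last by move=> i; exact: mI.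
  rewrite (eq_bigr (fun i : 'I_N =>
    var1%:E + K w1 w2 (fun s => (dist2 w1 w2 m' i.+2 s)%:E)))%E; last first.
    by move=> i _; rewrite (kint_innov mc var1_gt0)//= !ltnS.
  by rewrite big_split/= sumEFin sumr_const card_ord -[var1 *+ N]mulr_natl.
have KIa : (K w1 w2 (fun s => \sum_(i < N) (innov (a w1 w2) i.+2 s ^+ 2)%:E) =
    (N%:R * var1)%:E)%E.
  rewrite KI// big1 ?adde0// => i _; rewrite /dist2.
  by under eq_fun do rewrite subrr expr0n/=; rewrite kint0.
pose W s := \prod_(2 <= i < N.+2) (chan m tau (take i s) (nth 0 s i) /
  chan (a w1 w2) sd (take i s) (nth 0 s i)).
have W0 s : (0 <= (W s)%:E)%E.
  by rewrite lee_fin; apply: prodr_ge0 => i _; rewrite divr_ge0// chan_ge0.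
have mW : tmeas N.+2 (fun s => (W s)%:E).
  apply/measurable_EFinP; apply: measurable_prod => i _.
  exact: measurable_chan_ratio.
pose FM s := (2^-1%:E * (1 + M%:E * ((A s)%:R)%:E))%E.
have FM0 s : (0 <= FM s)%E.
  by apply: mule_ge0 => //; apply: adde_ge0 => //; apply: mule_ge0 => //; rewrite lee_fin ltW.
have mFM : tmeas N.+2 FM.
  by apply: measurable_funeM; apply: emeasurable_funD => //; exact: measurable_funeM.
have lnM0 : (0 <= (ln M)%:E)%E by rewrite lee_fin ln_ge0.
have iv0 : (0 <= ((var1 *+ 2)^-1)%:E)%E by rewrite lee_fin invr_ge0 mulrn_wge0// ltW.
have it0 : (0 <= ((tau ^+ 2 *+ 2)^-1)%:E)%E by rewrite lee_fin invr_ge0 mulrn_wge0// sqr_ge0.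
have C0 : (0 <= (ln 2 + N%:R * ln (tau / sd))%:E)%E.
  rewrite lee_fin addr_ge0 ?ln_ge0 ?ler1n// mulr_ge0// ln_ge0//.
  by rewrite ler_pdivlMr// mul1r.
have : (K w1 w2 (fun s => ((ln M)%:E * ((A s)%:R)%:E) +
          (((var1 *+ 2)^-1)%:E * (\sum_(i < N) (innov (a w1 w2) i.+2 s ^+ 2)%:E) + 1)) <=
        K w1 w2 (fun s => (ln 2 + N%:R * ln (tau / sd))%:E +
          (((tau ^+ 2 *+ 2)^-1)%:E * (\sum_(i < N) (innov m i.+2 s ^+ 2)%:E) +
          (W s)%:E * FM s)))%E.
  apply: (@kint_le _ _ k0 mk N.+2) => //.
  - by move=> s; rewrite !adde_ge0// mule_ge0.
  - apply: emeasurable_funD; first exact: measurable_funeM.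
    by apply: emeasurable_funD => //; apply: measurable_funeM; exact: mIs.
  - by move=> s; rewrite !adde_ge0// mule_ge0.
  - apply: emeasurable_funD => //; apply: emeasurable_funD; last exact: emeasurable_funM.
    by apply: measurable_funeM; exact: mIs.
  - move=> s _; rewrite !sumEFin /FM -!EFinM -!EFinD lee_fin.
    have := lr_pointwise (a w1 w2) m (A s) s tau0 M1'; rewrite /W.
    by rewrite [ln M * _]mulrC !addrA.
have mIa := mIs _ ma; have mIm := mIs _ mm.
have M0E : (0 <= M%:E)%E by rewrite lee_fin ltW.
have P0 (x y : \bar R) : (0 <= x -> 0 <= y -> 0 <= x + y)%E by exact: adde_ge0.
have T0 (x y : \bar R) : (0 <= x -> 0 <= y -> 0 <= x * y)%E by exact: mule_ge0.
have mcst (x : \bar R) : tmeas N.+2 (fun=> x) by exact: measurable_cst.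
have mP F G : tmeas N.+2 F -> tmeas N.+2 G -> tmeas N.+2 (fun s => F s + G s)%E.
  exact: emeasurable_funD.
have mT F G : tmeas N.+2 F -> tmeas N.+2 G -> tmeas N.+2 (fun s => F s * G s)%E.
  exact: emeasurable_funM.
have q0 := qkern_ge0 m tau; have mq := kmeas_qkern tau mm; have q1 := qkern_prob m tau.
have KD F G := @kintD _ _ k0 mk N.+2 F G N.+2 [::].
have KZ F := @kintZl _ _ k0 mk N.+2 F N.+2 [::].
have QD F G := @kintD _ _ q0 mq N.+2 F G N.+2 [::].
have QZ F := @kintZl _ _ q0 mq N.+2 F N.+2 [::].
rewrite !(KD, KZ, kint_cst k0 mk k1, KIa, KI); try by auto.
rewrite (kint_ckern_lr c var1_gt0); try by auto.
rewrite !(QD, QZ, kint_cst q0 mq q1); try by auto.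
rewrite -EFinM (@ge0_muleDr _ ((tau ^+ 2 *+ 2)^-1)%:E (N%:R * var1)%:E)//; last 2 first.
- by rewrite lee_fin mulr_ge0// ltW.
- by apply: sume_ge0 => i _; apply: kint_ge0 => // s; rewrite lee_fin sqr_ge0.
rewrite -EFinM !addeA -!EFinD.
have -> : (var1 *+ 2)^-1 * (N%:R * var1) = N%:R / 2 by field; rewrite gt_eqF.
by rewrite [(tau ^+ 2 *+ 2)^-1 * _]mulrC -addeA.
Qed.

End converse_pair.

(** * Averaging over the messages *)

Section converse_code.
Context {R : realType}.
Notation mu := (@lebesgue_measure R).
Variables (N M1 M2 : nat) (c : gmac_code (R := R) M1 M2) (var1 : R).
Hypothesis mc : code_measurable N c.
Hypothesis var1_gt0 : 0 < var1.
Hypotheses (N_gt0 : (0 < N)%N) (M1_gt0 : (0 < M1)%N) (M2_gt0 : (0 < M2)%N).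
Implicit Types (p s : seq R) (F : seq R -> \bar R).

Notation sd := (Num.sqrt var1).
Notation K w1 w2 := (kint (ckern c var1 w1 w2) N.+2 [::]).
Notation x1 := (x1 c).
Notation x2 := (x2 c).

Let k0 w1 w2 := ckern_ge0 c var1 w1 w2.
Let mk w1 w2 : kmeas (ckern c var1 w1 w2) := kmeas_ckern var1 mc w1 w2.
Let k1 w1 w2 := ckern_prob c var1 w1 w2.

Lemma tmeas_drop n i m F : tmeas m F -> (n - i)%N = m -> tmeas n (fun s => F (drop i s)).
Proof.
move=> mF e; subst m.
have := @tmeas_seq R _ (n.-tuple R) (n - i)%N F _ mF
  (@measurable_drop R n i _ (n.-tuple R) id (@measurable_id _ _ setT)).
exact.
Qed.

Lemma measurable_dec (h : 'I_M1 * 'I_M2 -> R) :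
  tmeas N.+2 (fun s => (h (dec c (drop 2 s)))%:E).
Proof.
apply: (@tmeas_drop _ 2 N (fun s => (h (dec c s))%:E)); last by rewrite -addn2 addnK.
apply/measurable_EFinP.
rewrite (_ : (fun _ => _) = (fun t : N.-tuple R =>
  \sum_(w : 'I_M1 * 'I_M2) h w * \1_[set t : N.-tuple R | dec c t = w] t)).
  apply: measurable_sum => w; apply: measurable_funM => //.
  by apply: measurable_indic; have [_ _] := mc; apply.
apply/funext => t; rewrite (bigD1 (dec c t))//= big1 => [|w wt].
  by rewrite addr0 indicE mem_set//= mulr1.
rewrite indicE memNset ?mulr0//= => tw.
by rewrite tw eqxx in wt.
Qed.

(* N times the power of the linear combination of the two inputs. *)
Definition sqpow (al be : R) : \bar R :=
  (\sum_(i < N) mavg (fun w1 w2 => K w1 w2 (fun s =>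
     ((al * x1 w1 (take i.+2 s) + be * x2 w2 (take i.+2 s)) ^+ 2)%:E)))%E.

Let sq al be w1 w2 i s := (al * x1 w1 (take i s) + be * x2 w2 (take i s)) ^+ 2.

Let msq al be w1 w2 i : tmeas N.+2 (fun s => (sq al be w1 w2 i s)%:E).
Proof.
apply/measurable_EFinP; apply: measurable_funX; apply: measurable_funD.
  by apply: measurable_funM => //; have := @rmeas_take R _ N.+2 i (rmeas_x1 mc w1); exact.
by apply: measurable_funM => //; have := @rmeas_take R _ N.+2 i (rmeas_x2 mc w2); exact.
Qed.

Let sq0 al be w1 w2 i s : (0 <= (sq al be w1 w2 i s)%:E)%E.
Proof. by rewrite lee_fin sqr_ge0. Qed.

Lemma sqpow_ge0 al be : (0 <= sqpow al be)%E.
Proof.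
apply: sume_ge0 => i _; apply: mavg_ge0 => w1 w2.
by apply: kint_ge0 => [|s]; [exact: k0|rewrite lee_fin sqr_ge0].
Qed.

(** A pointwise identity between quadratic forms of the inputs passes to powers. Nonnegative
    coefficients on both sides avoid subtracting values that may be infinite. *)
Lemma sqpow_lin (a1 a2 al1 be1 al2 be2 b1 b2 ga1 de1 ga2 de2 : R) :
  0 <= a1 -> 0 <= a2 -> 0 <= b1 -> 0 <= b2 ->
  (forall x y : R, a1 * (al1 * x + be1 * y) ^+ 2 + a2 * (al2 * x + be2 * y) ^+ 2 =
     b1 * (ga1 * x + de1 * y) ^+ 2 + b2 * (ga2 * x + de2 * y) ^+ 2) ->
  (a1%:E * sqpow al1 be1 + a2%:E * sqpow al2 be2 =
   b1%:E * sqpow ga1 de1 + b2%:E * sqpow ga2 de2)%E.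
Proof.
have lin a1' a2' al1' be1' al2' be2' : 0 <= a1' -> 0 <= a2' ->
  (a1'%:E * sqpow al1' be1' + a2'%:E * sqpow al2' be2' =
   \sum_(i < N) mavg (fun w1 w2 => K w1 w2 (fun s =>
     (a1' * sq al1' be1' w1 w2 i.+2 s + a2' * sq al2' be2' w1 w2 i.+2 s)%:E)))%E.
  move=> a10 a20; have K0 al be w1 w2 i :
      (0 <= K w1 w2 (fun s => (sq al be w1 w2 i s)%:E))%E.
    by apply: kint_ge0; [exact: k0|exact: sq0].
  rewrite /sqpow !ge0_sume_distrr; try by move=> i _; apply: mavg_ge0 => w1 w2; exact: (K0 _ _ w1 w2 i.+2).
  rewrite -big_split; apply: eq_bigr => i _ /=.
  rewrite -!mavgZl ?lee_fin//; try by move=> w1 w2; exact: K0.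
  rewrite -mavgD; try by move=> w1 w2; apply: mule_ge0; [rewrite lee_fin|exact: K0].
  apply: eq_mavg => w1 w2.
  have KZ al be c' : 0 <= c' -> (c'%:E * K w1 w2 (fun s => (sq al be w1 w2 i.+2 s)%:E) =
      K w1 w2 (fun s => c'%:E * (sq al be w1 w2 i.+2 s)%:E))%E.
    by move=> c0; rewrite (@kintZl _ _ (k0 w1 w2) (mk w1 w2) N.+2)// => s; exact: sq0.
  rewrite !KZ// -(@kintD _ _ (k0 w1 w2) (mk w1 w2) N.+2)//.
  - by move=> s; apply: mule_ge0 => //; rewrite lee_fin.
  - by apply: measurable_funeM; exact: msq.
  - by move=> s; apply: mule_ge0 => //; rewrite lee_fin.
  - by apply: measurable_funeM; exact: msq.
move=> a1_0 a2_0 b1_0 b2_0 h.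
apply: (etrans (lin _ _ _ _ _ _ a1_0 a2_0)).
apply: (etrans _ (esym (lin _ _ _ _ _ _ b1_0 b2_0))).
apply: eq_bigr => i _; apply: eq_mavg => w1 w2.
by apply: (@eq_kint _ _ N.+2) => // s _; rewrite /sq h.
Qed.

Lemma avg_power1E : avg_power1 N c var1 = ((N%:R)^-1%:E * sqpow 1 0)%E.
Proof.
rewrite /avg_power1; congr (_ * _)%E; apply: eq_bigr => i _.
apply: eq_mavg => w1 w2.
rewrite -(@cexp_kint R N M1 M2 c var1 mc w1 w2 (fun u1 u2 y => ((enc1 c i w1 (take i y) u1) ^+ 2)%:E)).
- congr cexp; apply/funext => u1; apply/funext => u2; apply/funext => e.
  by rewrite take_outputs// ltnW.
- move=> u1 u2 y sy /=; congr (_ ^+ 2)%:E.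
  by rewrite mul1r mul0r addr0 /x1 /= drop0 size_take sy ltn_ord !subSS subn0.
- by move=> s; rewrite lee_fin sqr_ge0.
- exact: (msq 1 0 w1 w2 i.+2).
Qed.

Lemma avg_power2E : avg_power2 N c var1 = ((N%:R)^-1%:E * sqpow 0 1)%E.
Proof.
rewrite /avg_power2; congr (_ * _)%E; apply: eq_bigr => i _.
apply: eq_mavg => w1 w2.
rewrite -(@cexp_kint R N M1 M2 c var1 mc w1 w2 (fun u1 u2 y => ((enc2 c i w2 (take i y) u2) ^+ 2)%:E)).
- congr cexp; apply/funext => u1; apply/funext => u2; apply/funext => e.
  by rewrite take_outputs// ltnW.
- move=> u1 u2 y sy /=; congr (_ ^+ 2)%:E.
  by rewrite mul1r mul0r add0r /x2 /= drop0 size_take sy ltn_ord !subSS subn0.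
- by move=> s; rewrite lee_fin sqr_ge0.
- exact: (msq 0 1 w1 w2 i.+2).
Qed.

Lemma error_probE : error_prob N c var1 =
  mavg (fun w1 w2 => K w1 w2 (fun s => ((dec c (drop 2 s) != (w1, w2))%:R)%:E)).
Proof.
rewrite /error_prob; apply: eq_mavg => w1 w2.
rewrite -(@cexp_kint R N M1 M2 c var1 mc w1 w2 (fun u1 u2 y => ((dec c y != (w1, w2))%:R)%:E)).
- congr cexp; apply/funext => u1; apply/funext => u2; apply/funext => e.
  by case: (_ == _).
- by move=> u1 u2 y sy /=; rewrite drop0.
- by move=> s; rewrite lee_fin.
- exact: (measurable_dec (fun w => (w != (w1, w2))%:R)).
Qed.

(** The predictor [ga1 * x1 + ga2 * x2] leaves a bias of power at most [V], hence the term
    [ln (1 + V / var1)]. The last hypothesis expresses that guessing under the reference law is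
    blind. *)
Lemma fano_avg (eps ga1 ga2 M V : R) (A : 'I_M1 -> 'I_M2 -> pred ('I_M1 * 'I_M2)) :
  (forall w1 w2, A w1 w2 (w1, w2)) -> (error_prob N c var1 <= eps%:E)%E ->
  1 <= M -> 0 <= V -> (sqpow (1 - ga1) (1 - ga2) <= (N%:R * V)%:E)%E ->
  (forall tau, mavg (fun w1 w2 =>
     kint (qkern (fun p => ga1 * x1 w1 p + ga2 * x2 w2 p)%R tau) N.+2 [::]
       (fun s => ((A w1 w2 (dec c (drop 2 s)))%:R)%:E)) <= (M^-1)%:E)%E ->
  ln M * (1 - eps) <= ln 2 + N%:R / 2 * ln (1 + V / var1).
Proof.
move=> AA err M_ge1 V0 powV QM.
(* The standard deviation of an output around a prediction with bias power [V]; with this value the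
   quadratic terms add up to [N / 2] (see [e1]) and cancel. *)
pose tau := Num.sqrt (var1 + V).
have vV0 : 0 < var1 + V by rewrite ltr_wpDr.
have tau2 : tau ^+ 2 = var1 + V by rewrite sqr_sqrtr// ltW.
have tau0 : 0 < tau by rewrite sqrtr_gt0.
have sdtau : sd <= tau by rewrite ler_wsqrtr// lerDl.
have M0 : 0 < M by rewrite (lt_le_trans _ M_ge1).
have lnM0 : 0 <= ln M by rewrite ln_ge0.
pose m w1 w2 p := ga1 * x1 w1 p + ga2 * x2 w2 p.
have mm w1 w2 : rmeas (m w1 w2).
  by move=> n; apply: measurable_funD; apply: measurable_funM => //;
    [exact: (rmeas_x1 mc)|exact: (rmeas_x2 mc)].
have mA w1 w2 : tmeas N.+2 (fun s => ((A w1 w2 (dec c (drop 2 s)))%:R : R)%:E).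
  exact: (measurable_dec (fun w => (A w1 w2 w)%:R)).
have KA0 w1 w2 : (0 <= K w1 w2 (fun s => ((A w1 w2 (dec c (drop 2 s)))%:R)%:E))%E.
  by apply: kint_ge0 => [|s]; [exact: k0|rewrite lee_fin].
have QA0 w1 w2 : (0 <= kint (qkern (m w1 w2) tau) N.+2 [::]
    (fun s => ((A w1 w2 (dec c (drop 2 s)))%:R)%:E))%E.
  by apply: kint_ge0 => [|s]; [exact: qkern_ge0|rewrite lee_fin].
have KD0 w1 w2 (i : 'I_N) : (0 <= K w1 w2 (fun s => (dist2 c w1 w2 (m w1 w2) i.+2 s)%:E))%E.
  by apply: kint_ge0 => [|s]; [exact: k0|rewrite lee_fin sqr_ge0].
have S0 w1 w2 : (0 <= \sum_(i < N) K w1 w2 (fun s => (dist2 c w1 w2 (m w1 w2) i.+2 s)%:E))%E.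
  by apply: sume_ge0 => i _.
have it0 : 0 <= (tau ^+ 2 *+ 2)^-1 by rewrite invr_ge0 mulrn_wge0// sqr_ge0.
have C0 : 0 <= ln 2 + N%:R * ln (tau / sd) + N%:R * var1 / (tau ^+ 2 *+ 2).
  rewrite !addr_ge0 ?ln_ge0 ?ler1n//.
    by rewrite mulr_ge0// ln_ge0// ler_pdivlMr// ?mul1r// sqrt_var1_gt0.
  by rewrite !mulr_ge0 ?invr_ge0 ?mulrn_wge0 ?sqr_ge0// ltW.
have N0 : 0 <= N%:R / 2 + 1 :> R by rewrite addr_ge0// divr_ge0.
have half0 : 0 <= 2^-1 :> R by rewrite invr_ge0.
have main := mavg_affine_le M1_gt0 M2_gt0 lnM0 N0 C0 it0 half0 (ltW M0) KA0 S0 QA0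
  (fun w1 w2 => fano_pair mc var1_gt0 w1 w2 (mm w1 w2) sdtau M_ge1 (mA w1 w2)).
have powE : mavg (fun w1 w2 => \sum_(i < N)
    K w1 w2 (fun s => (dist2 c w1 w2 (m w1 w2) i.+2 s)%:E))%E = sqpow (1 - ga1) (1 - ga2).
  apply: (etrans (mavg_sum (index_enum 'I_N) (fun i w1 w2 => KD0 w1 w2 i))).
  apply: eq_bigr => i _.
  apply: eq_mavg => w1 w2; apply: (@eq_kint _ _ N.+2) => // s _.
  by rewrite /dist2 /m; congr ((_ ^+ 2)%:E); ring.
rewrite powE in main; have {}QM := QM tau.
have X1 : (1 <= mavg (fun w1 w2 => K w1 w2 (fun s =>
    ((A w1 w2 (dec c (drop 2 s)))%:R)%:E)) + error_prob N c var1)%E.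
  rewrite error_probE -mavgD; [|exact: KA0|]; last first.
    by move=> w1 w2; apply: kint_ge0 => [|s]; [exact: k0|rewrite lee_fin].
  rewrite -[leLHS](mavg_cst M1_gt0 M2_gt0); apply: mavg_le => w1 w2.
  have mE : tmeas N.+2 (fun s => ((dec c (drop 2 s) != (w1, w2))%:R : R)%:E).
    exact: (measurable_dec (fun w => (w != (w1, w2))%:R)).
  rewrite -(@kintD _ _ (k0 w1 w2) (mk w1 w2) N.+2)//.
  have c01 : (0 <= 1 :> \bar R)%E by [].
  apply: (le_trans (y := K w1 w2 (fun=> 1%E))).
    by rewrite (kint_cst (k0 w1 w2) (mk w1 w2) (k1 w1 w2) N.+2 [::] c01).
  apply: (@kint_le _ _ (k0 w1 w2) (mk w1 w2) N.+2) => //.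
  - exact: measurable_cst.
  - by move=> s; rewrite -EFinD lee_fin addr_ge0.
  - by apply: emeasurable_funD; [exact: mA|exact: mE].
  - move=> s _; rewrite -EFinD lee_fin; case: eqP => [->|_]; last by rewrite lerDr.
    by rewrite AA addr0.
have {X1 QM main} [X [Y [X1 QM main]]] : exists X Y : \bar R,
  [/\ (1 <= X + error_prob N c var1)%E, (Y <= (M^-1)%:E)%E &
   ((ln M)%:E * X + (N%:R / 2 + 1)%:E <=
   (ln 2 + N%:R * ln (tau / sd) + N%:R * var1 * (tau ^+ 2 *+ 2)^-1)%:E
   + ((tau ^+ 2 *+ 2)^-1%:E * sqpow (1 - ga1) (1 - ga2) + 2^-1%:E * (1 + M%:E * Y)))%E].
  by eexists; eexists; split; [exact: X1|exact: QM|exact: main].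
have Xe : ((1 - eps)%:E <= X)%E.
  have : (1 <= X + eps%:E)%E by apply: (le_trans X1); exact: leeD2l.
  by rewrite EFinB leeBlDr.
have {main} : (((ln M) * (1 - eps) + (N%:R / 2 + 1))%:E <=
    (ln 2 + N%:R * ln (tau / sd) + N%:R * var1 / (tau ^+ 2 *+ 2) +
    ((tau ^+ 2 *+ 2)^-1 * (N%:R * V) + 2^-1 * (1 + M * M^-1)))%:E)%E.
  apply: (le_trans _ (le_trans main _)).
    by rewrite EFinD EFinM leeD2r// lee_wpmul2l ?lee_fin.
  rewrite [leRHS]EFinD leeD2l// EFinD leeD//.
    by rewrite EFinM lee_wpmul2l ?lee_fin.
  rewrite EFinM EFinD EFinM; apply: lee_wpmul2l; rewrite ?lee_fin//.
  by apply: leeD2l; apply: lee_wpmul2l; [rewrite lee_fin ltW|exact: QM].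
rewrite lee_fin mulfV ?gt_eqF//.
have -> : N%:R * ln (tau / sd) = N%:R / 2 * ln (1 + V / var1).
  have -> : 1 + V / var1 = (tau / sd) ^+ 2.
    by rewrite expr_div_n tau2 sqr_sqrtr ?ltW//; field; rewrite gt_eqF.
  have ts0 : 0 < tau / sd by rewrite divr_gt0 ?sqrt_var1_gt0.
  by rewrite lnXn// -mulr_natl; field.
have e1 : N%:R * var1 / (tau ^+ 2 *+ 2) + (tau ^+ 2 *+ 2)^-1 * (N%:R * V) = N%:R / 2.
  by rewrite tau2; field; rewrite gt_eqF.
by move=> h; lra.
Qed.

End converse_code.

Local Opaque sqpow.

(** * The three converse bounds at one correlation *)

Section converse_bounds.
Context {R : realType}.
Variables (N M1 M2 : nat) (c : gmac_code (R := R) M1 M2) (var1 P1 P2 eps : R).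
Hypothesis mc : code_measurable N c.
Hypothesis var1_gt0 : 0 < var1.
Hypotheses (N_gt0 : (0 < N)%N) (M1_gt0 : (0 < M1)%N) (M2_gt0 : (0 < M2)%N).
Hypotheses (P1_gt0 : 0 < P1) (P2_gt0 : 0 < P2).
Hypothesis pow1 : (avg_power1 N c var1 <= P1%:E)%E.
Hypothesis pow2 : (avg_power2 N c var1 <= P2%:E)%E.
Hypothesis err : (error_prob N c var1 <= eps%:E)%E.

Let N0 : 0 < N%:R :> R. Proof. by rewrite ltr0n. Qed.

(* co is the average correlation of the two inputs; only expectations of squares
   occur, so that it is read off from the power of the sum. *)
Lemma sqpow_correlation : exists p1 p2 co : R,
  [/\ p1 <= P1, p2 <= P2,
   sqpow N c var1 1 1 = (N%:R * (p1 + p2 + 2 * co))%:E,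
   forall be, 0 <= be -> sqpow N c var1 1 (- be) =
     (N%:R * (p1 + be ^+ 2 * p2 - 2 * be * co))%:E &
   forall be, 0 <= be -> sqpow N c var1 (- be) 1 =
     (N%:R * (p2 + be ^+ 2 * p1 - 2 * be * co))%:E].
Proof.
have fin (x : \bar R) (P : R) : (0 <= x)%E -> (N%:R^-1%:E * x <= P%:E)%E ->
    exists2 p : R, p <= P & x = (N%:R * p)%:E.
  case: x => [x| |]// x0 h.
    exists (x / N%:R); last by congr EFin; field; rewrite gt_eqF.
    by move: h; rewrite -EFinM lee_fin mulrC.
  by move: h; rewrite gt0_muley ?lte_fin ?invr_gt0.
have [p1 p1P e10] : exists2 p : R, p <= P1 & sqpow N c var1 1 0 = (N%:R * p)%:E.
  by apply: fin; [exact: sqpow_ge0|rewrite -avg_power1E].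
have [p2 p2P e01] : exists2 p : R, p <= P2 & sqpow N c var1 0 1 = (N%:R * p)%:E.
  by apply: fin; [exact: sqpow_ge0|rewrite -avg_power2E].
(* The parallelogram identity makes the power of the sum finite. *)
have [S eS] : exists S : R, sqpow N c var1 1 1 = (N%:R * S)%:E.
  have : (1%:E * sqpow N c var1 1 1 + 1%:E * sqpow N c var1 1 (- 1) =
      2%:E * (N%:R * p1)%:E + 2%:E * (N%:R * p2)%:E)%E.
    by rewrite -e10 -e01; apply: sqpow_lin => // x y; ring.
  move: (sqpow_ge0 N c var1 1 1) (sqpow_ge0 N c var1 1 (- 1)).
  case: (sqpow N c var1 1 1) => [x| |]//.
    by move=> _ _; exists (x / N%:R); congr EFin; field; rewrite gt_eqF.
  by case: (sqpow N c var1 1 (- 1)) => [y| |]// _ _; rewrite !mul1e.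
have sub (x : \bar R) be y : (0 <= x)%E -> (x + be%:E * (N%:R * S)%:E = y%:E)%E ->
    x = (y - be * (N%:R * S))%:E.
  case: x => [x| |]// _; rewrite -EFinM -?EFinD => -[<-].
  by congr EFin; ring.
exists p1, p2, ((S - p1 - p2) / 2); split => //.
- by rewrite eS; congr EFin; field.
(* From [(x - be * y)^2 + be * (x + y)^2 = (1 + be) * x^2 + (be^2 + be) * y^2]. *)
- move=> be be0; apply: (etrans (@sub _ be ((1 + be) * (N%:R * p1) +
    (be ^+ 2 + be) * (N%:R * p2)) (sqpow_ge0 _ _ _ _ _) _)); last by congr EFin; field.
  rewrite -[X in (X + _)%E]mul1e -eS EFinD 2!(EFinM (_ + _)) -e10 -e01.
  by apply: sqpow_lin; rewrite ?addr_ge0 ?sqr_ge0// => x y; ring.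
- move=> be be0; apply: (etrans (@sub _ be ((be ^+ 2 + be) * (N%:R * p1) +
    (1 + be) * (N%:R * p2)) (sqpow_ge0 _ _ _ _ _) _)); last by congr EFin; field.
  rewrite -[X in (X + _)%E]mul1e -eS EFinD 2!(EFinM (_ + _)) -e10 -e01.
  by apply: sqpow_lin; rewrite ?addr_ge0 ?sqr_ge0// => x y; ring.
Qed.

Let Q (m : seq R -> R) tau (A : pred ('I_M1 * 'I_M2)) :=
  kint (qkern m tau) N.+2 [::] (fun s => ((A (dec c (drop 2 s)))%:R : R)%:E).

(** The events form a partition. When the reference law ignores the message to be guessed, averaging
    over that message therefore gives the success probability [M^-1]. *)
Lemma sum_qkern (I : finType) (f : 'I_M1 * 'I_M2 -> I) m tau : rmeas m ->
  (\sum_(i : I) Q m tau (fun w => f w == i) = 1)%E.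
Proof.
move=> mm; have k0 := qkern_ge0 m tau; have mk := kmeas_qkern tau mm.
pose F i s := ((f (dec c (drop 2 s)) == i)%:R : R)%:E.
have F0 i s : (0 <= F i s)%E by rewrite lee_fin.
have mF i : tmeas N.+2 (F i) by exact: (measurable_dec mc (fun w => (f w == i)%:R)).
apply: (etrans (esym (kint_sum k0 mk (index_enum I) (n := N.+2) (p := [::]) F0 mF erefl))).
have c01 : (0 <= 1 :> \bar R)%E by [].
apply: (etrans _ (kint_cst k0 mk (qkern_prob m tau) N.+2 [::] c01)).
apply: (@eq_kint _ _ N.+2) => // s _; rewrite sumEFin (bigD1 (f (dec c (drop 2 s))))//=.
rewrite eqxx big1 ?addr0// => i /negbTE.
by rewrite eq_sym => ->.
Qed.

Let fano := @fano_avg R N M1 M2 c var1 mc var1_gt0 M1_gt0 M2_gt0 eps.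

Let rmeas_lin ga1 ga2 w1 w2 : rmeas (fun p => ga1 * x1 c w1 p + ga2 * x2 c w2 p).
Proof.
by move=> n; apply: measurable_funD; apply: measurable_funM => //;
    [exact: (rmeas_x1 mc)|exact: (rmeas_x2 mc)].
Qed.

Lemma converse_bounds : exists2 rho : R, 0 <= rho <= 1 &
  [/\ ln M1%:R * (1 - eps) <= ln 2 + N%:R / 2 * ln (1 + P1 * (1 - rho ^+ 2) / var1),
      ln M2%:R * (1 - eps) <= ln 2 + N%:R / 2 * ln (1 + P2 * (1 - rho ^+ 2) / var1) &
      ln (M1 * M2)%:R * (1 - eps) <= ln 2 + N%:R / 2 *
        ln (1 + (P1 + P2 + 2 * Num.sqrt (P1 * P2) * rho) / var1)].
Proof.
have [p1 [p2 [co [p1P p2P eS eV1 eV2]]]] := sqpow_correlation.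
pose q1 := Num.sqrt P1; pose q2 := Num.sqrt P2.
have q10 : 0 < q1 by rewrite sqrtr_gt0.
have q20 : 0 < q2 by rewrite sqrtr_gt0.
have q1E : q1 ^+ 2 = P1 by rewrite sqr_sqrtr ?ltW.
have q2E : q2 ^+ 2 = P2 by rewrite sqr_sqrtr ?ltW.
(* The region asks for [rho] in [[0, 1]], while [co] may be negative. Its positive part serves: of
   the correlation, the residual powers use only [cp * co = cp ^+ 2], the power of the sum only
   [co <= cp]. *)
pose cp := Num.max co 0; pose rho := cp / (q1 * q2).
have cp0 : 0 <= cp by rewrite le_max lexx orbT.
have cpc : cp * co = cp ^+ 2.
  by rewrite /cp; case: (leP co 0) => h; rewrite ?mul0r ?expr0n// expr2.
have cocp : co <= cp by rewrite le_max lexx.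
have q12 : 0 < q1 * q2 by rewrite mulr_gt0.
have rho0 : 0 <= rho by apply: divr_ge0 => //; exact: ltW.
(* Cauchy-Schwarz inequality, from the nonnegative power of [x1 - (q1 / q2) * x2]. *)
have co_le : co <= q1 * q2.
  have be0 : 0 <= q1 / q2 by rewrite divr_ge0 ?ltW.
  have := sqpow_ge0 N c var1 1 (- (q1 / q2)).
  rewrite eV1// lee_fin pmulr_rge0// => h.
  have h1 : 2 * (q1 / q2) * co <= 2 * P1.
    have : (q1 / q2) ^+ 2 * p2 <= (q1 / q2) ^+ 2 * P2 by rewrite ler_wpM2l ?sqr_ge0.
    have -> : (q1 / q2) ^+ 2 * P2 = P1.
      by rewrite expr_div_n q2E q1E; field; rewrite gt_eqF.
    by move=> ?; lra.
  have : 2 * (q1 / q2) * co <= 2 * (q1 / q2) * (q1 * q2).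
    by rewrite (_ : _ * (q1 * q2) = 2 * P1)// -q1E; field; rewrite gt_eqF.
  by rewrite ler_pM2l// mulr_gt0 ?divr_gt0.
have rho1 : rho <= 1.
  by rewrite ler_pdivrMr// mul1r ge_max co_le ltW.
have rho2 : rho ^+ 2 = cp ^+ 2 / (P1 * P2) by rewrite expr_div_n exprMn q1E q2E.
exists rho; first by rewrite rho0.
have rho2_le1 : rho ^+ 2 <= 1 by rewrite expr_le1.
split.
(* The output is predicted from [x2] alone, with [cp / P2] as regression coefficient of [x1] on
   [x2]. Using [P2] for the actual power [p2] is harmless because [p2 <= P2]. *)
- apply: (fano (ga1 := 0) (ga2 := 1 + cp / P2) (A := fun w1 w2 w => w.1 == w1)) => //.
  + by rewrite ler1n.
  + by rewrite mulr_ge0 ?subr_ge0// ltW.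
  + have be0 : 0 <= cp / P2 by apply: divr_ge0 => //; exact: ltW.
    have -> : 1 - (1 + cp / P2) = - (cp / P2) by ring.
    rewrite subr0 eV1// lee_fin ler_pM2l//.
    have : (cp / P2) ^+ 2 * p2 <= (cp / P2) ^+ 2 * P2 by rewrite ler_wpM2l ?sqr_ge0.
    have -> : (cp / P2) ^+ 2 * P2 = cp ^+ 2 / P2 by field; rewrite gt_eqF.
    have -> : 2 * (cp / P2) * co = 2 * (cp ^+ 2 / P2) by rewrite -cpc; field; rewrite gt_eqF.
    have -> : P1 * (1 - rho ^+ 2) = P1 - cp ^+ 2 / P2.
      by rewrite rho2; field; rewrite !gt_eqF.
    by move=> ?; lra.
  + move=> tau; rewrite /mavg exchange_big/=.
    rewrite (eq_bigr (fun=> 1%E)) => [|w2 _]; last first.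
      rewrite -(sum_qkern (fun w => w.1) tau (@rmeas_lin 0 (1 + cp / P2) (Ordinal M1_gt0) w2)).
      apply: eq_bigr => w1 _; rewrite /Q; apply: eq_kernel => s y _; rewrite /qkern /chan.
      by rewrite !mul0r.
    rewrite sumEFin sumr_const card_ord -EFinM lee_fin natrM.
    have ? : M1%:R != 0 :> R by rewrite pnatr_eq0 -lt0n.
    have ? : M2%:R != 0 :> R by rewrite pnatr_eq0 -lt0n.
    by rewrite le_eqVlt; apply/orP; left; apply/eqP; field; apply/andP.
- apply: (fano (ga1 := 1 + cp / P1) (ga2 := 0) (A := fun w1 w2 w => w.2 == w2)) => //.
  + by rewrite ler1n.
  + by rewrite mulr_ge0 ?subr_ge0// ltW.
  + have be0 : 0 <= cp / P1 by apply: divr_ge0 => //; exact: ltW.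
    have -> : 1 - (1 + cp / P1) = - (cp / P1) by ring.
    rewrite subr0 eV2// lee_fin ler_pM2l//.
    have : (cp / P1) ^+ 2 * p1 <= (cp / P1) ^+ 2 * P1 by rewrite ler_wpM2l ?sqr_ge0.
    have -> : (cp / P1) ^+ 2 * P1 = cp ^+ 2 / P1 by field; rewrite gt_eqF.
    have -> : 2 * (cp / P1) * co = 2 * (cp ^+ 2 / P1) by rewrite -cpc; field; rewrite gt_eqF.
    have -> : P2 * (1 - rho ^+ 2) = P2 - cp ^+ 2 / P1.
      by rewrite rho2; field; rewrite !gt_eqF.
    by move=> ?; lra.
  + move=> tau; rewrite /mavg.
    rewrite (eq_bigr (fun=> 1%E)) => [|w1 _]; last first.
      rewrite -(sum_qkern (fun w => w.2) tau (@rmeas_lin (1 + cp / P1) 0 w1 (Ordinal M2_gt0))).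
      apply: eq_bigr => w2 _; rewrite /Q; apply: eq_kernel => s y _; rewrite /qkern /chan.
      by rewrite !mul0r.
    rewrite sumEFin sumr_const card_ord -EFinM lee_fin natrM.
    have ? : M1%:R != 0 :> R by rewrite pnatr_eq0 -lt0n.
    have ? : M2%:R != 0 :> R by rewrite pnatr_eq0 -lt0n.
    by rewrite le_eqVlt; apply/orP; left; apply/eqP; field; apply/andP.
(* When the pair is guessed, neither input may enter the prediction, so the reference outputs are
   centered at 0. *)
- apply: (fano (ga1 := 0) (ga2 := 0) (A := fun w1 w2 w => w == (w1, w2))) => //.
  + by rewrite ler1n muln_gt0 M1_gt0.
  + apply: addr_ge0; first by rewrite addr_ge0 ?ltW.
    by apply: mulr_ge0 => //; rewrite mulr_ge0 ?sqrtr_ge0.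
  + rewrite subr0 eS lee_fin ler_pM2l//.
    have -> : 2 * Num.sqrt (P1 * P2) * rho = 2 * cp.
      rewrite (_ : Num.sqrt (P1 * P2) = q1 * q2); last by rewrite sqrtrM// ltW.
      by rewrite /rho -mulrA [_ * (cp / _)]mulrC divfK// gt_eqF.
    by rewrite !lerD// ler_pM2l.
  + move=> tau; rewrite /mavg.
    rewrite (eq_bigr (fun w1 => \sum_(w2 < M2) Q (fun=> 0%R) tau (fun w => w == (w1, w2))))%E.
      rewrite pair_big/= (eq_bigr (fun i => Q (fun=> 0%R) tau (fun w => w == i))).
        have m0 : rmeas (fun=> 0%R : R) by move=> n; exact: measurable_cst.
        by rewrite (sum_qkern id tau m0) mule1.
      by case.
    move=> w1 _; apply: eq_bigr => w2 _; rewrite /Q; apply: eq_kernel => s y _; rewrite /qkern /chan.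
    by rewrite !mul0r addr0.
Qed.

End converse_bounds.

(** * Passage to the limit in the converse *)

Section converse_limit.
Context {R : realType}.
Variables (P1 P2 var1 var2 : R).
Hypotheses (P1_gt0 : 0 < P1) (P2_gt0 : 0 < P2) (var1_gt0 : 0 < var1).

Lemma ln2_gt0 : 0 < ln 2 :> R. Proof. by rewrite ln_gt0// ltr1n. Qed.

Definition cap (x : R) : R := 2^-1 * log2 (1 + x / var1).
Definition cap1 rho := cap (P1 * (1 - rho ^+ 2)).
Definition cap2 rho := cap (P2 * (1 - rho ^+ 2)).
Definition cap12 rho := cap (P1 + P2 + 2 * Num.sqrt (P1 * P2) * rho).

Lemma cap1_arg rho : 0 <= rho <= 1 -> 0 <= P1 * (1 - rho ^+ 2).
Proof.
by case/andP=> r0 r1; rewrite mulr_ge0 ?(ltW P1_gt0)// subr_ge0 expr_le1.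
Qed.

Lemma cap2_arg rho : 0 <= rho <= 1 -> 0 <= P2 * (1 - rho ^+ 2).
Proof.
by case/andP=> r0 r1; rewrite mulr_ge0 ?(ltW P2_gt0)// subr_ge0 expr_le1.
Qed.

Lemma cap12_arg rho : 0 <= rho <= 1 -> 0 <= P1 + P2 + 2 * Num.sqrt (P1 * P2) * rho.
Proof.
case/andP=> r0 r1; apply: addr_ge0; first by rewrite addr_ge0 ?ltW.
by rewrite !mulr_ge0 ?sqrtr_ge0.
Qed.

Lemma cap_continuous (f : R -> R) x : 0 <= f x -> {for x, continuous f} ->
  {for x, continuous (fun r => cap (f r))}.
Proof.
move=> f0 cf; rewrite /cap /log2.
apply: cvgM; first exact: cvg_cst.
apply: cvgM; last exact: cvg_cst.
apply: (cvg_comp (fun r => 1 + f r / var1) (@ln R)).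
  apply: cvgD; first exact: cvg_cst.
  by apply: cvgM; [exact: cf|exact: cvg_cst].
have h : 0 < 1 + f x / var1 by rewrite ltr_pwDl// divr_ge0// ltW.
exact: (continuous_ln h).
Qed.

(** The correlation may depend on [e]. Compactness removes this: the largest violation [h] of the
    three bounds attains its minimum on [[0, 1]], and that minimum is at most every [e > 0]. *)
Lemma region_of_approx R1 R2 : 0 <= R1 -> 0 <= R2 ->
  (forall e, 0 < e -> exists2 rho : R, 0 <= rho <= 1 &
    [/\ R1 <= cap1 rho + e, R2 <= cap2 rho + e & R1 + R2 <= cap12 rho + e]) ->
  gmac_feedback_region P1 P2 var1 (R1, R2).
Proof.
move=> R10 R20 approx.
pose h (r : R) : R^o := Num.max (R1 - cap1 r) (Num.max (R2 - cap2 r) (R1 + R2 - cap12 r)).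
have ch : {within `[0, 1], continuous h}.
  apply: continuous_in_subspaceT => x /[!inE] /=; rewrite in_itv/= => x01.
  have cB a (f : R -> R) : {for x, continuous f} -> {for x, continuous (fun r => a - f r : R^o)}.
    by move=> cf; apply: cvgB; [exact: cvg_cst|exact: cf].
  have c1 : {for x, continuous (fun r : R => 1 - r ^+ 2)}.
    by apply: (cB 1 (fun r => r ^+ 2)); exact: exprn_continuous.
  apply: (@continuous_max R R (fun r => R1 - cap1 r : R^o) (fun r =>
    Num.max (R2 - cap2 r) (R1 + R2 - cap12 r) : R^o)).
    apply: cB; apply: cap_continuous; first exact: cap1_arg.
    by apply: cvgM; [exact: cvg_cst|exact: c1].
  apply: (@continuous_max R R (fun r => R2 - cap2 r : R^o) (fun r => R1 + R2 - cap12 r : R^o)).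
    apply: cB; apply: cap_continuous; first exact: cap2_arg.
    by apply: cvgM; [exact: cvg_cst|exact: c1].
  apply: cB; apply: cap_continuous; first exact: cap12_arg.
  apply: cvgD; first exact: cvg_cst.
  by apply: cvgM; [exact: cvg_cst|exact: cvg_id].
have [rho] := EVT_min (@ler01 R) ch.
rewrite in_itv/= => rho01 hmin.
have h0 : h rho <= 0.
  apply/ler_addgt0Pl => e e0; rewrite addr0.
  have [r r01 [h1 h2 h12]] := approx e e0.
  apply: (le_trans (hmin r _)); first by rewrite in_itv.
  by rewrite /h !ge_max !lerBlDl h1 h2 h12.
move: h0; rewrite /h !ge_max !subr_le0 => /and3P[h1 h2 h12].
by exists rho => //=; rewrite in_itv.
Qed.

Lemma converse R1 R2 : secrecy_achievable P1 P2 var1 var2 R1 R2 ->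
  gmac_feedback_region P1 P2 var1 (R1, R2).
Proof.
move=> ach; have l2 := ln2_gt0.
have key eps : 0 < eps -> eps <= 1 -> [/\ - eps <= R1, - eps <= R2 &
    exists2 rho, 0 <= rho <= 1 & [/\ (1 - eps) * (R1 - eps) <= cap1 rho + eps,
      (1 - eps) * (R2 - eps) <= cap2 rho + eps &
      (1 - eps) * (R1 + R2 - 2 * eps) <= cap12 rho + eps]].
  move=> e0 e1; have [N0 HN] := ach eps e0.
  (* Larger than [eps^-1], so that the term [ln 2] of Fano's inequality costs at most [eps] bits per
     symbol. *)
  pose N := (maxn N0 (Num.truncn eps^-1).+1).
  have [M1 [M2 [c [[M10 M20 mc] [r1 r2] [p1 p2] _ err]]]] := HN N (leq_maxl _ _).
  have N_gt0 : (0 < N)%N by rewrite leq_max orbT.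
  have NR : 0 < N%:R :> R by rewrite ltr0n.
  have Ne : N%:R^-1 <= eps.
    rewrite -[leRHS]invrK lef_pV2 ?posrE ?invr_gt0//.
    apply: (le_trans (ltW (truncnS_gt _))).
    by rewrite ler_nat leq_maxr.
  have [rho rho01 [b1 b2 b12]] := converse_bounds mc var1_gt0 N_gt0 M10 M20 P1_gt0 P2_gt0 p1 p2 err.
  have lM M : (0 < M)%N -> 0 <= log2 M%:R / N%:R :> R.
    by move=> M0; rewrite !divr_ge0 ?ln_ge0 ?ler1n.
  move: r1 r2; rewrite !ler_distl => /andP[r1 r1'] /andP[r2 r2'].
  have conv (M : nat) x r : r <= log2 M%:R / N%:R ->
      ln M%:R * (1 - eps) <= ln 2 + N%:R / 2 * ln (1 + x / var1) ->
      (1 - eps) * r <= cap x + eps.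
    move=> rM h; apply: (@le_trans _ _ ((1 - eps) * (log2 M%:R / N%:R))).
      by rewrite ler_wpM2l ?subr_ge0.
    apply: (@le_trans _ _ (cap x + N%:R^-1)); last by rewrite lerD2l.
    rewrite /cap /log2.
    have -> : (1 - eps) * (ln M%:R / ln 2 / N%:R) = (ln M%:R * (1 - eps)) / (ln 2 * N%:R).
      by field; rewrite !gt_eqF.
    rewrite ler_pdivrMr ?mulr_gt0//; apply: (le_trans h).
    by rewrite le_eqVlt; apply/orP; left; apply/eqP; field; rewrite !gt_eqF.
  have := lM _ M10; have := lM _ M20 => lM2 lM1.
  split; [lra|lra|].
  exists rho => //; split; [apply: conv b1|apply: conv b2|apply: conv b12].
  - lra.
  - lra.
  - rewrite natrM /log2 lnM ?posrE ?ltr0n// 2!mulrDl.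
    move: r1 r2; rewrite /log2; lra.
have R10 : 0 <= R1.
  rewrite leNgt; apply/negP => R1lt.
  have [||h _ _] := key (Num.min 1 (- R1 / 2)).
  - by rewrite lt_min ltr01/=; lra.
  - by rewrite ge_min lexx.
  - have : Num.min 1 (- R1 / 2) <= - R1 / 2 by rewrite ge_min lexx orbT.
    by move=> ?; lra.
have R20 : 0 <= R2.
  rewrite leNgt; apply/negP => R2lt.
  have [||_ h _] := key (Num.min 1 (- R2 / 2)).
  - by rewrite lt_min ltr01/=; lra.
  - by rewrite ge_min lexx.
  - have : Num.min 1 (- R2 / 2) <= - R2 / 2 by rewrite ge_min lexx orbT.
    by move=> ?; lra.
apply: region_of_approx => // e e0.
(* Expanding [(1 - eps) * (R1 + R2 - 2 * eps)] leaves an error of at most [eps * (3 + R1 + R2)], the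
   [eps] on the right included. *)
pose B := 3 + R1 + R2; have B0 : 0 < B by rewrite /B; lra.
pose eps := Num.min 1 (e / B).
have eps0 : 0 < eps by rewrite lt_min ltr01 divr_gt0.
have eps1 : eps <= 1 by rewrite ge_min lexx.
have epsB : eps * B <= e by rewrite -ler_pdivlMr// ge_min lexx orbT.
have [_ _ [rho rho01 [b1 b2 b12]]] := key eps eps0 eps1.
exists rho => //; move: epsB; rewrite /B => epsB.
have e2 : 0 <= eps ^+ 2 by rewrite sqr_ge0.
have eR1 : 0 <= eps * R1 by rewrite mulr_ge0// ltW.
have eR2 : 0 <= eps * R2 by rewrite mulr_ge0// ltW.
split; nra.
Qed.

End converse_limit.

(** * Linear feedback codes *)

Section scheme_algebra.
Context {R : realType}.

(* The states evolve as s_i' = la_i s_i - b_i y with y = sum_i c_i s_i + noise; user 1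
   transmits c1 s_1 + c2 s_2 and user 2 transmits c3 s_3. Q is the stationary covariance
   form: Q x y z is the second moment of x s_1 + y s_2 + z s_3. A contribution th_i to the
   initial state grows like la_i^n, so user 1 can send at rate log |la1 la2|, user 2
   at rate log |la3|. *)
Definition linear_scheme (v P1 P2 r1 r2 : R) (la1 la2 la3 c1 c2 c3 b1 b2 b3 : R)
    (Q : R -> R -> R -> R) : Prop :=
  [/\ [/\ 1 <= `|la1|, 1 <= `|la2| & 1 <= `|la3|],
      (la1 * la2) ^+ 2 = r1 /\ la3 ^+ 2 = r2,
      (forall x y z : R, let be := b1 * x + b2 * y + b3 * z in
         Q (la1 * x - c1 * be) (la2 * y - c2 * be) (la3 * z - c3 * be) + v * be ^+ 2 = Q x y z),
      Q c1 c2 0 = P1 /\ Q 0 0 c3 = P2 &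
      (exists2 ka : R, 0 < ka & forall x y z, ka * (x ^+ 2 + y ^+ 2 + z ^+ 2) <= Q x y z) /\
      (forall a x y z, Q (a * x) (a * y) (a * z) = a ^+ 2 * Q x y z)].

(** One step of a Kalman filter in unit noise. The sum of the inputs has coefficients
    [l * f - p2 * k1], [- (p2 * k2)], [p2] on the states, so it is uncorrelated with the second one,
    and the output has variance [(l * m) ^+ 2]. As [be] is the optimal coefficient, the left side is
    [Q z1 z2 z3 - X ^+ 2 / (l * m) ^+ 2]; its cross correlations [w1], [w2] are taken back to [k1],
    [k2] by the reflection with rows [c, s] and [s, - c]. *)
Lemma stationary_z (m l f e t p2 k1 k2 c s w1 w2 : R) :
  m != 0 -> l != 0 -> f != 0 ->
  f ^+ 2 = m ^+ 2 - 1 -> l ^+ 2 = 1 + e ^+ 2 -> e = p2 * t ->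
  k1 = e * (m - t) / (l * f) -> k1 ^+ 2 + k2 ^+ 2 = 1 - t ^+ 2 ->
  w1 = e * (m * t - 1) / f -> w2 = - l * k2 ->
  c * w1 + s * w2 = k1 -> s * w1 - c * w2 = k2 -> c ^+ 2 + s ^+ 2 = 1 ->
  let Q x y z := x ^+ 2 + y ^+ 2 + z ^+ 2 + 2 * z * (k1 * x + k2 * y) in
  forall x y z,
    let z1 := m * (c * x + s * y) in let z2 := s * x - c * y in let z3 := - l * z in
    let be := (l * f * z1 + m * e * z3) / (l * m) ^+ 2 in
    Q (z1 - (l * f - p2 * k1) * be) (z2 + p2 * k2 * be) (z3 - p2 * be) + be ^+ 2 = Q x y z.
Proof.
move=> m0 l0 f0 f2 l2 ep k1E k12 w1E w2E ew1 ew2 cs Q x y z z1 z2 z3 be.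
have k1g : l * f * k1 = e * (m - t) by rewrite k1E; field; rewrite f0 l0.
pose X := l * f * z1 + m * e * z3.
have S1 : (l * f - p2 * k1) * (l * f) + p2 * (m * e) = (l * m) ^+ 2 - 1.
  have -> : (l * f - p2 * k1) * (l * f) + p2 * (m * e) =
    l ^+ 2 * f ^+ 2 - p2 * (l * f * k1) + p2 * (m * e) by ring.
  rewrite k1g f2 exprMn.
  have -> : p2 * (e * (m - t)) = p2 * (m * e) - e ^+ 2.
    have h : e * e = e * (p2 * t) by rewrite -ep.
    by rewrite expr2 h; ring.
  by rewrite l2; ring.
have gs : k1 * (l * f - p2 * k1) - k2 * (p2 * k2) + p2 = m * e.
  have -> : k1 * (l * f - p2 * k1) - k2 * (p2 * k2) + p2 =
    l * f * k1 - p2 * (k1 ^+ 2 + k2 ^+ 2) + p2 by ring.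
  by rewrite k1g k12 ep; ring.
have step1 : Q (z1 - (l * f - p2 * k1) * be) (z2 + p2 * k2 * be) (z3 - p2 * be) + be ^+ 2 =
    Q z1 z2 z3 - 2 * be * X + be ^+ 2 * (l * m) ^+ 2.
  have -> : be ^+ 2 * (l * m) ^+ 2 = be ^+ 2 * ((l * f - p2 * k1) * (l * f) + p2 * (m * e)) + be ^+ 2.
    by rewrite S1; ring.
  by rewrite /X -gs /Q; ring.
have beX : be * (l * m) ^+ 2 = X by rewrite /be divfK// expf_neq0// mulf_neq0.
have step2 : Q z1 z2 z3 - 2 * be * X + be ^+ 2 * (l * m) ^+ 2 = Q z1 z2 z3 - X ^+ 2 / (l * m) ^+ 2.
  have -> : be ^+ 2 * (l * m) ^+ 2 = be * X by rewrite -beX; ring.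
  have -> : X ^+ 2 / (l * m) ^+ 2 = be * X by rewrite /be /X; ring.
  by ring.
rewrite step1 step2.
have w1E' : - l * m * (k1 - f * e / (l * m)) = w1.
  have -> : - l * m * (k1 - f * e / (l * m)) = - m * (l * f * k1) / f + f ^+ 2 * e / f.
    by field; rewrite f0 m0 l0.
  by rewrite k1g f2 w1E; field.
have step3 : Q z1 z2 z3 - X ^+ 2 / (l * m) ^+ 2 =
  (c * x + s * y) ^+ 2 + z2 ^+ 2 + z ^+ 2 +
  2 * z * (- l * m * (k1 - f * e / (l * m)) * (c * x + s * y) + w2 * z2).
  rewrite w2E /Q /X /z1 /z3.
  have -> : (l * f * (m * (c * x + s * y)) + m * e * (- l * z)) ^+ 2 / (l * m) ^+ 2 =
     f ^+ 2 * (c * x + s * y) ^+ 2 + e ^+ 2 * z ^+ 2 - 2 * f * e * (c * x + s * y) * z.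
    by field; rewrite m0 l0.
  rewrite f2 exprMn [(- l * z) ^+ 2]exprMn sqrrN l2.
  by field; rewrite m0 l0.
rewrite step3 w1E' /z2 /Q -ew1 -ew2.
have -> : x ^+ 2 + y ^+ 2 = (c ^+ 2 + s ^+ 2) * (x ^+ 2 + y ^+ 2) by rewrite cs mul1r.
by ring.
Qed.

(* Eigenvalues of a reflection composed with diag(m, 1). The product of the moduli
   is m, hence the two states of user 1 carry the rate log m in any real splitting. *)
Lemma reflection_eigenvalues (m c : R) : 1 <= m -> c ^+ 2 <= 1 ->
  exists u v, [/\ 1 <= u, v <= -1, u + v = (m - 1) * c & u * v = - m].
Proof.
move=> m1 c1; pose T := (m - 1) * c; pose d := Num.sqrt (T ^+ 2 + 4 * m).
have D0 : 0 <= T ^+ 2 + 4 * m by rewrite addr_ge0 ?sqr_ge0// mulr_ge0//; lra.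
have d2 : d ^+ 2 = T ^+ 2 + 4 * m by rewrite sqr_sqrtr.
have d0 : 0 <= d by exact: sqrtr_ge0.
have /andP[c_ge c_le] : -1 <= c <= 1 by rewrite -ler_norml -sqrtr_sqr -sqrtr1 ler_sqrt.
have T_ge : - (m - 1) <= T by rewrite /T; nra.
have T_le : T <= m - 1 by rewrite /T; nra.
have le_d x : x ^+ 2 <= d ^+ 2 -> x <= d.
  by move=> h; rewrite (le_trans (ler_norm _))// -(ger0_norm d0) -!sqrtr_sqr ler_sqrt ?sqr_ge0.
have h1 : 2 - T <= d by apply: le_d; rewrite d2 sqrrB; nra.
have h2 : 2 + T <= d by apply: le_d; rewrite d2 sqrrD; nra.
exists ((T + d) / 2), ((T - d) / 2); split; [lra|lra|by rewrite /T; field|].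
have -> : (T + d) / 2 * ((T - d) / 2) = (T ^+ 2 - d ^+ 2) / 4 by field.
by rewrite d2; field.
Qed.

(** The two states of user 1 evolve by a reflection times a diagonal matrix. Passing to the
    eigenvectors [(w + c, s)], where [w] is [u] or [v], gives the scalar recursions of
    [linear_scheme]. *)
Lemma scheme_diagonalize (m l c s al1 al2 p2 g h ka : R) (Q : R -> R -> R -> R) :
  1 <= m -> 1 <= l -> c ^+ 2 + s ^+ 2 = 1 -> 0 < ka ->
  (forall x y z, ka * (x ^+ 2 + y ^+ 2 + z ^+ 2) <= Q x y z) ->
  (forall a x y z, Q (a * x) (a * y) (a * z) = a ^+ 2 * Q x y z) ->
  (forall x y z,
    let z1 := m * (c * x + s * y) in let z2 := s * x - c * y in let z3 := - l * z in
    let be := g * z1 + h * z3 in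
    Q (z1 - al1 * be) (z2 - al2 * be) (z3 - p2 * be) + be ^+ 2 = Q x y z) ->
  exists la1 la2 la3 c1 c2 c3 b1 b2 b3 Q',
    linear_scheme 1 (Q al1 al2 0) (Q 0 0 p2) (m ^+ 2) (l ^+ 2) la1 la2 la3 c1 c2 c3 b1 b2 b3 Q'.
Proof.
move=> m1 l1 cs ka0 Qpd Qhom Qst.
(* For [s = 0] the matrix is already diagonal, while the eigenvectors used below would be
   collinear. *)
have [s0|s_neq0] := eqVneq s 0.
  have c2 : c ^+ 2 = 1 by rewrite -cs s0 expr0n addr0.
  have nc : `|c| = 1 by rewrite -sqrtr_sqr c2 sqrtr1.
  exists (m * c), (- c), (- l), al1, al2, p2, (g * (m * c)), 0, (- h * l), Q; split => //.
  - by rewrite normrM nc normrN nc normrN mulr1 !ger0_norm// ?(le_trans ler01).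
  - by split; rewrite ?sqrrN// mulrN sqrrN -mulrA -expr2 c2 mulr1.
  - move=> x y z be; rewrite -(Qst x y z) s0 /=.
    have e1 : m * (c * x + 0 * y) = m * c * x by ring.
    have e2 : 0 * x - c * y = - c * y by ring.
    have e3 : g * (m * c * x) + h * (- l * z) = be by rewrite /be; ring.
    by rewrite e1 e2 e3 mul1r.
  - by split => //; exists ka.
have c2 : c ^+ 2 <= 1 by rewrite -cs lerDl sqr_ge0.
have s2 : s ^+ 2 = 1 - c ^+ 2 by rewrite -cs addrAC subrr add0r.
have [u [v [u1 v1 uDv uMv]]] := reflection_eigenvalues m1 c2.
have uv0 : u - v != 0 by rewrite gt_eqF//; lra.
have eig w : w ^+ 2 = (m - 1) * c * w + m -> m * (c * (w + c) + s ^+ 2) = w * (w + c).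
  by move=> w2; rewrite s2 [RHS]mulrDr -expr2 w2; ring.
have eu : u ^+ 2 = (m - 1) * c * u + m.
  by rewrite -uDv -[m]opprK -uMv; ring.
have ev : v ^+ 2 = (m - 1) * c * v + m.
  by rewrite -uDv -[m]opprK -uMv; ring.
pose c1 := (al1 - (v + c) * (al2 / s)) / (u - v).
pose c2' := ((u + c) * (al2 / s) - al1) / (u - v).
have c12 : s * (c1 + c2') = al2 by rewrite /c1 /c2'; field; rewrite uv0 s_neq0.
have c12' : c1 * (u + c) + c2' * (v + c) = al1.
  by rewrite /c1 /c2'; field; rewrite uv0 s_neq0.
pose Q' x y z := Q (x * (u + c) + y * (v + c)) (s * (x + y)) z.
exists u, v, (- l), c1, c2', p2, (g * (u * (u + c))), (g * (v * (v + c))), (- h * l), Q'.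
split.
- by split; [rewrite ger0_norm; lra|rewrite ler0_norm; lra|rewrite normrN ger0_norm; lra].
- by rewrite uMv !sqrrN.
- move=> x y z be; rewrite /Q' -(Qst (x * (u + c) + y * (v + c)) (s * (x + y)) z) /=.
  have e1 : m * (c * (x * (u + c) + y * (v + c)) + s * (s * (x + y))) =
      u * (u + c) * x + v * (v + c) * y.
    by rewrite -!eig//; ring.
  have e2 : s * (x * (u + c) + y * (v + c)) - c * (s * (x + y)) = s * (u * x + v * y) by ring.
  have e3 : g * (u * (u + c) * x + v * (v + c) * y) + h * (- l * z) = be by rewrite /be; ring.
  rewrite e1 e2 e3 mul1r; congr (Q _ _ _ + _).
    by rewrite -c12'; ring.
  by rewrite -c12; ring.
- by rewrite /Q' c12' c12 !mul0r !addr0 mulr0.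
- split; last first.
    by move=> a x y z; rewrite /Q' -Qhom; congr Q; ring.
  (* [a], [r1], [r2] describe the inverse change of basis and [C] bounds its squared norm, so that
     positive definiteness survives. *)
  pose a := (u - v)^-1; pose r1 := (v + c) / s; pose r2 := (u + c) / s.
  pose C := 1 + 2 * a ^+ 2 * (2 + r1 ^+ 2 + r2 ^+ 2).
  have C0 : 0 < C.
    apply: ltr_pwDl => //; apply: mulr_ge0; first by apply: mulr_ge0 => //; exact: sqr_ge0.
    by apply: addr_ge0; [apply: addr_ge0 => //|]; exact: sqr_ge0.
  exists (ka / C); first by rewrite divr_gt0.
  move=> x y z; rewrite /Q'; set X := _ + _ * (v + c); set Y := s * _.
  apply: le_trans (Qpd X Y z); rewrite -mulrA ler_pM2l// mulrC ler_pdivrMr//.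
  have ex : x = a * (X - r1 * Y) by rewrite /X /Y /a /r1; field; rewrite uv0 s_neq0.
  have ey : y = a * (r2 * Y - X) by rewrite /X /Y /a /r2; field; rewrite uv0 s_neq0.
  have x2 : x ^+ 2 <= 2 * a ^+ 2 * (X ^+ 2 + r1 ^+ 2 * Y ^+ 2).
    rewrite (_ : 2 * a ^+ 2 * _ = a ^+ 2 * (2 * (X ^+ 2 + r1 ^+ 2 * Y ^+ 2))); last by ring.
    rewrite {1}ex exprMn; apply: ler_wpM2l; first exact: sqr_ge0.
    by have := sqr_ge0 (X + r1 * Y); rewrite sqrrD sqrrB exprMn; lra.
  have y2 : y ^+ 2 <= 2 * a ^+ 2 * (X ^+ 2 + r2 ^+ 2 * Y ^+ 2).
    rewrite (_ : 2 * a ^+ 2 * _ = a ^+ 2 * (2 * (X ^+ 2 + r2 ^+ 2 * Y ^+ 2))); last by ring.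
    rewrite {1}ey exprMn; apply: ler_wpM2l; first exact: sqr_ge0.
    by have := sqr_ge0 (X + r2 * Y); rewrite sqrrD sqrrB exprMn; lra.
  have -> : (X ^+ 2 + Y ^+ 2 + z ^+ 2) * C = 2 * a ^+ 2 * (X ^+ 2 + r1 ^+ 2 * Y ^+ 2) +
     2 * a ^+ 2 * (X ^+ 2 + r2 ^+ 2 * Y ^+ 2) + z ^+ 2 + (X ^+ 2 + Y ^+ 2 +
     2 * a ^+ 2 * ((r1 ^+ 2 + r2 ^+ 2) * X ^+ 2 + 2 * Y ^+ 2 + z ^+ 2 * (2 + r1 ^+ 2 + r2 ^+ 2))).
    by rewrite /C; ring.
  rewrite -[leLHS]addr0; apply: lerD; first by apply: lerD => //; exact: lerD.
  have s0 (w : R) : 0 <= w ^+ 2 by exact: sqr_ge0.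
  have P (w w' : R) : 0 <= w -> 0 <= w' -> 0 <= w + w' by exact: addr_ge0.
  have T (w w' : R) : 0 <= w -> 0 <= w' -> 0 <= w * w' by exact: mulr_ge0.
  by apply: (P); [auto|apply: (T); auto 10].
Qed.

(** The parameters of [stationary_z] are solved for: [m ^+ 2] is the individual factor of user 1,
    [(l * m) ^+ 2] the total factor [S], and [e * m] the covariance [p2 + p1 * rho] of user 2's
    state with the sum of the inputs. The hypothesis on [S] amounts to [t ^+ 2 <= D]. *)
Lemma exists_unit_scheme (p1 p2 rho : R) : 0 < p1 -> 0 < p2 -> 0 <= rho < 1 ->
  let S := 1 + (p1 ^+ 2 + p2 ^+ 2 + 2 * p1 * p2 * rho) in
  S <= (1 + p1 ^+ 2 * (1 - rho ^+ 2)) * (1 + p2 ^+ 2 * (1 - rho ^+ 2)) ->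
  exists la1 la2 la3 c1 c2 c3 b1 b2 b3 Q,
    linear_scheme 1 (p1 ^+ 2) (p2 ^+ 2) (1 + p1 ^+ 2 * (1 - rho ^+ 2))
      (S / (1 + p1 ^+ 2 * (1 - rho ^+ 2))) la1 la2 la3 c1 c2 c3 b1 b2 b3 Q.
Proof.
move=> p10 p20 /andP[rho0 rho1] S hS.
pose D := 1 - rho ^+ 2.
have D0 : 0 < D by rewrite subr_gt0 expr_lt1.
pose f := p1 * Num.sqrt D; pose m := Num.sqrt (1 + p1 ^+ 2 * D).
have pD0 : 0 < p1 ^+ 2 * D by rewrite mulr_gt0// exprn_gt0.
have m2 : m ^+ 2 = 1 + p1 ^+ 2 * D by rewrite sqr_sqrtr// addr_ge0// ltW.
have f2 : f ^+ 2 = m ^+ 2 - 1.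
  by rewrite exprMn sqr_sqrtr ?ltW// m2 addrAC subrr add0r.
have f0 : 0 < f by rewrite mulr_gt0// sqrtr_gt0.
have m1 : 1 < m by rewrite -sqrtr1 ltr_sqrt ?ltrDl// addr_gt0.
have m0 : 0 < m by rewrite (lt_trans _ m1).
pose t := (1 + p1 * rho / p2) / m; pose e := p2 * t; pose l := Num.sqrt (1 + e ^+ 2).
have t0 : 0 < t.
  apply: divr_gt0 => //; apply: ltr_pwDl => //; apply: divr_ge0; last exact: ltW.
  by apply: mulr_ge0 => //; exact: ltW.
have e0 : 0 < e by rewrite mulr_gt0.
have l2 : l ^+ 2 = 1 + e ^+ 2 by rewrite sqr_sqrtr// addr_ge0// sqr_ge0.
have l1 : 1 < l by rewrite -sqrtr1 ltr_sqrt ?ltrDl ?exprn_gt0// addr_gt0// exprn_gt0.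
have l0 : 0 < l by rewrite (lt_trans _ l1).
have em : e * m = p2 + p1 * rho by rewrite /e /t; field; rewrite !gt_eqF.
have em2 : e ^+ 2 * m ^+ 2 = (p2 + p1 * rho) ^+ 2 by rewrite -exprMn em.
have SE : S = l ^+ 2 * m ^+ 2.
  by rewrite l2 mulrDl em2 mul1r m2 /S /D; ring.
have tD : t ^+ 2 <= D.
  move: hS; rewrite SE -m2 mulrC ler_pM2l ?exprn_gt0// l2 lerD2l /e exprMn.
  by rewrite ler_pM2l// exprn_gt0.
(* Strictness allows division by [1 - t ^+ 2]: equality would force [rho = 0], and then
   [t = m^-1 < 1]. *)
have t1 : t ^+ 2 < 1.
  rewrite lt_neqAle (le_trans tD) ?lerBlDr ?lerDl ?sqr_ge0// andbT; apply/eqP => t21.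
  have rho_0 : rho = 0.
    apply/eqP; rewrite -sqrf_eq0 eq_le sqr_ge0 andbT.
    by move: tD; rewrite t21 /D; lra.
  have : t < 1 by rewrite /t rho_0 mulr0 mul0r addr0 div1r invf_lt1.
  by rewrite -(@ltr_pXn2r _ 2) ?nnegrE ?ltW// t21 expr1n ltxx.
pose k1 := e * (m - t) / (l * f).
have k1g : l * f * k1 = e * (m - t) by rewrite /k1; field; rewrite !gt_eqF.
have k12_le : k1 ^+ 2 <= 1 - t ^+ 2.
  have : 0 <= (1 - t ^+ 2) * (l * f) ^+ 2 - (l * f * k1) ^+ 2.
    suff -> : (1 - t ^+ 2) * (l * f) ^+ 2 - (l * f * k1) ^+ 2 = p1 ^+ 2 * (D - t ^+ 2).
      by rewrite mulr_ge0 ?sqr_ge0// subr_ge0.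
    rewrite k1g [(l * f) ^+ 2]exprMn [(e * (m - t)) ^+ 2]exprMn l2 f2.
    have h1 : e ^+ 2 * (m - t) ^+ 2 = (p1 * rho + p2 * (1 - t ^+ 2)) ^+ 2.
      rewrite -exprMn mulrBr em /e; congr (_ ^+ 2); ring.
    have h2 : (1 + e ^+ 2) * (m ^+ 2 - 1) = p1 ^+ 2 * D + ((p2 + p1 * rho) ^+ 2 - p2 ^+ 2 * t ^+ 2).
      rewrite -em2 mulrDl mul1r mulrBr mulr1 /e [(p2 * t) ^+ 2]exprMn m2; ring.
    by rewrite h1 h2 /D; ring.
  rewrite (_ : _ - _ = (l * f) ^+ 2 * (1 - t ^+ 2 - k1 ^+ 2)); last by ring.
  have lf0 : 0 < (l * f) ^+ 2 by apply: exprn_gt0; exact: mulr_gt0.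
  by rewrite pmulr_rge0// subr_ge0.
(* The correlation of user 1's second state with user 2's state; it vanishes exactly when
   [t ^+ 2 = D], that is at equality in the hypothesis on [S]. *)
pose k2 := Num.sqrt (1 - t ^+ 2 - k1 ^+ 2).
have k12 : k1 ^+ 2 + k2 ^+ 2 = 1 - t ^+ 2 by rewrite sqr_sqrtr ?subr_ge0// addrC subrK.
pose w1 := e * (m * t - 1) / f; pose w2 := - l * k2.
have w12 : w1 ^+ 2 + w2 ^+ 2 = 1 - t ^+ 2.
  have h1 : l ^+ 2 * k2 ^+ 2 = (1 + e ^+ 2) * (1 - t ^+ 2) - (e * (m - t)) ^+ 2 / f ^+ 2.
    rewrite -k1g -l2 -k12; field; rewrite gt_eqF//.
  rewrite /w2 mulNr sqrrN [(l * k2) ^+ 2]exprMn h1 /w1 expr_div_n exprMn [(e * (m - t)) ^+ 2]exprMn f2.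
  by field; rewrite -f2 gt_eqF// exprn_gt0.
have r0 : 0 < 1 - t ^+ 2 by rewrite subr_gt0.
(* The reflection taking [(w1, w2)] to [(k1, k2)]; it exists since both have squared length
   [1 - t ^+ 2]. *)
pose c := (k1 * w1 - k2 * w2) / (1 - t ^+ 2).
pose s := (k1 * w2 + k2 * w1) / (1 - t ^+ 2).
have cs : c ^+ 2 + s ^+ 2 = 1.
  have -> : c ^+ 2 + s ^+ 2 =
      (k1 ^+ 2 + k2 ^+ 2) * (w1 ^+ 2 + w2 ^+ 2) / (1 - t ^+ 2) ^+ 2.
    by rewrite /c /s; field; rewrite gt_eqF.
  by rewrite k12 w12 -expr2 divff// gt_eqF// exprn_gt0.
have ew1 : c * w1 + s * w2 = k1.
  have -> : c * w1 + s * w2 = k1 * (w1 ^+ 2 + w2 ^+ 2) / (1 - t ^+ 2).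
    by rewrite /c /s; field; rewrite gt_eqF.
  by rewrite w12 mulfK// gt_eqF.
have ew2 : s * w1 - c * w2 = k2.
  have -> : s * w1 - c * w2 = k2 * (w1 ^+ 2 + w2 ^+ 2) / (1 - t ^+ 2).
    by rewrite /c /s; field; rewrite gt_eqF.
  by rewrite w12 mulfK// gt_eqF.
have state := @stationary_z m l f e t p2 k1 k2 c s w1 w2 (lt0r_neq0 m0) (lt0r_neq0 l0)
  (lt0r_neq0 f0) f2 l2 erefl erefl k12 erefl erefl ew1 ew2 cs.
clearbody c s; clear ew1 ew2 w12; clear w1 w2; clearbody k2; clearbody k1.
pose Q x y z := x ^+ 2 + y ^+ 2 + z ^+ 2 + 2 * z * (k1 * x + k2 * y).
have Qpd x y z : t ^+ 2 / 3 * (x ^+ 2 + y ^+ 2 + z ^+ 2) <= Q x y z.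
  have -> : Q x y z = (x + k1 * z) ^+ 2 + (y + k2 * z) ^+ 2 + t ^+ 2 * z ^+ 2.
    have -> : t ^+ 2 = 1 - (k1 ^+ 2 + k2 ^+ 2) by rewrite k12; ring.
    by rewrite /Q; ring.
  set A := x + k1 * z; set B := y + k2 * z.
  have hx : x ^+ 2 + y ^+ 2 <= 2 * (A ^+ 2 + B ^+ 2) + 2 * z ^+ 2.
    have -> : x = A - k1 * z by rewrite /A; ring.
    have -> : y = B - k2 * z by rewrite /B; ring.
    have h1 := sqr_ge0 (A + k1 * z); have h2 := sqr_ge0 (B + k2 * z).
    have h3 : (k1 ^+ 2 + k2 ^+ 2) * z ^+ 2 <= 1 * z ^+ 2.
      by rewrite ler_wpM2r ?sqr_ge0// k12 gerBl sqr_ge0.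
    rewrite !sqrrB !exprMn; move: h1 h2; rewrite !sqrrD !exprMn.
    by move: h3; rewrite mulrDl mul1r; lra.
  have hAB : t ^+ 2 * (A ^+ 2 + B ^+ 2) <= 1 * (A ^+ 2 + B ^+ 2).
    by rewrite ler_wpM2r ?addr_ge0 ?sqr_ge0// ltW.
  have hm : t ^+ 2 / 3 * (x ^+ 2 + y ^+ 2 + z ^+ 2) <=
     t ^+ 2 / 3 * (2 * (A ^+ 2 + B ^+ 2) + 3 * z ^+ 2).
    by rewrite ler_wpM2l ?divr_ge0 ?sqr_ge0//; lra.
  apply: (le_trans hm).
  have -> : t ^+ 2 / 3 * (2 * (A ^+ 2 + B ^+ 2) + 3 * z ^+ 2) =
    2 / 3 * (t ^+ 2 * (A ^+ 2 + B ^+ 2)) + t ^+ 2 * z ^+ 2 by field.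
  have := sqr_ge0 A; have := sqr_ge0 B; lra.
have ka0 : 0 < t ^+ 2 / 3 by rewrite divr_gt0// exprn_gt0.
have Qhom a x y z : Q (a * x) (a * y) (a * z) = a ^+ 2 * Q x y z by rewrite /Q; ring.
have lm0 : l * m != 0 by rewrite mulf_neq0 ?gt_eqF.
have := @scheme_diagonalize m l c s (l * f - p2 * k1) (- (p2 * k2)) p2
  (l * f / (l * m) ^+ 2) (m * e / (l * m) ^+ 2) (t ^+ 2 / 3) Q (ltW m1) (ltW l1) cs ka0 Qpd Qhom.
have -> : Q (l * f - p2 * k1) (- (p2 * k2)) 0 = p1 ^+ 2.
  have -> : Q (l * f - p2 * k1) (- (p2 * k2)) 0 =
    l ^+ 2 * f ^+ 2 - 2 * p2 * (l * f * k1) + p2 ^+ 2 * (k1 ^+ 2 + k2 ^+ 2).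
    by rewrite /Q; ring.
  rewrite k1g k12 l2 f2.
  have -> : (1 + e ^+ 2) * (m ^+ 2 - 1) - 2 * p2 * (e * (m - t)) + p2 ^+ 2 * (1 - t ^+ 2) =
    m ^+ 2 - 1 + (e * m - p2) ^+ 2 - e ^+ 2 + 2 * p2 * e * t - (p2 * t) ^+ 2 by ring.
  by rewrite em m2 -/e /D; rewrite /e; ring.
have -> : Q 0 0 p2 = p2 ^+ 2 by rewrite /Q; ring.
rewrite m2 -/D SE (_ : l ^+ 2 * m ^+ 2 / (1 + p1 ^+ 2 * D) = l ^+ 2); last first.
  by rewrite -m2 mulfK// gt_eqF// exprn_gt0.
apply => x y z z1 z2 z3 be; apply: (etrans _ (state x y z)) => /=; rewrite -/(Q _ _ _).
have -> : (l * f * (m * (c * x + s * y)) + m * e * (- l * z)) / (l * m) ^+ 2 = be.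
  by rewrite /be /z1 /z3; ring.
by rewrite mulNr opprK.
Qed.

Lemma exists_scheme (v P1 P2 rho : R) : 0 < v -> 0 < P1 -> 0 < P2 -> 0 <= rho < 1 ->
  let S := P1 + P2 + 2 * Num.sqrt (P1 * P2) * rho in
  v * (v + S) <= (v + P1 * (1 - rho ^+ 2)) * (v + P2 * (1 - rho ^+ 2)) ->
  exists la1 la2 la3 c1 c2 c3 b1 b2 b3 Q,
    linear_scheme v P1 P2 (1 + P1 * (1 - rho ^+ 2) / v)
      ((1 + S / v) / (1 + P1 * (1 - rho ^+ 2) / v)) la1 la2 la3 c1 c2 c3 b1 b2 b3 Q.
Proof.
move=> v0 P10 P20 rho01 S hS.
pose sg := Num.sqrt v; have sg0 : 0 < sg by rewrite sqrtr_gt0.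
have sg2 : sg ^+ 2 = v by rewrite sqr_sqrtr// ltW.
pose p1 := Num.sqrt P1 / sg; pose p2 := Num.sqrt P2 / sg.
have p10 : 0 < p1 by rewrite divr_gt0// sqrtr_gt0.
have p20 : 0 < p2 by rewrite divr_gt0// sqrtr_gt0.
have p12 : p1 ^+ 2 = P1 / v by rewrite expr_div_n sg2 sqr_sqrtr// ltW.
have p22 : p2 ^+ 2 = P2 / v by rewrite expr_div_n sg2 sqr_sqrtr// ltW.
have SE : p1 ^+ 2 + p2 ^+ 2 + 2 * p1 * p2 * rho = S / v.
  rewrite p12 p22 /S sqrtrM ?(ltW P10)// -sg2 /p1 /p2; field.
  by rewrite gt_eqF.
have [|la1 [la2 [la3 [c1 [c2 [c3 [b1 [b2 [b3 [Q [h1 h2 h3 [h4 h4'] [h5 h6]]]]]]]]]]]] :=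
  @exists_unit_scheme p1 p2 rho p10 p20 rho01.
  rewrite SE p12 p22.
  have -> : 1 + S / v = (v * (v + S)) / v ^+ 2 by field; rewrite gt_eqF.
  rewrite ler_pdivrMr ?exprn_gt0//; apply: (le_trans hS).
  by rewrite le_eqVlt; apply/orP; left; apply/eqP; field; rewrite gt_eqF.
exists la1, la2, la3, (sg * c1), (sg * c2), (sg * c3), (b1 / sg), (b2 / sg), (b3 / sg), Q.
split => //.
- by move: h2; rewrite SE p12 [P1 / v * _]mulrAC.
- move=> x y z be; rewrite -(h3 x y z) /=.
  have -> : b1 * x + b2 * y + b3 * z = sg * be by rewrite /be; field; rewrite gt_eqF.
  rewrite mul1r exprMn sg2; congr (Q _ _ _ + _); ring.
- have -> : Q (sg * c1) (sg * c2) 0 = Q (sg * c1) (sg * c2) (sg * 0) by rewrite mulr0.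
  have -> : Q 0 0 (sg * c3) = Q (sg * 0) (sg * 0) (sg * c3) by rewrite mulr0.
  rewrite !h6 h4 h4' sg2 p12 p22.
  by split; rewrite mulrC divfK// gt_eqF.
Qed.

End scheme_algebra.

(** * From a linear scheme to a code *)

Section feedback_code.
Context {R : realType}.
Notation mu := (@lebesgue_measure R).
Implicit Types p s : seq R.

(** Error and power are bounded for every message pair, and power at every time, instead of on
    average; shifting the messages by a key then changes no bound. *)
Definition det_scheme (v P1 P2 : R) (n M1 M2 : nat) (err : R) : Prop :=
  exists (X1 : 'I_M1 -> seq R -> R) (X2 : 'I_M2 -> seq R -> R)
    (D : seq R -> 'I_M1 * 'I_M2),
  let k w1 w2 := chan (fun p => X1 w1 p + X2 w2 p) (Num.sqrt v) in
  [/\ forall w, rmeas (X1 w), forall w, rmeas (X2 w),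
      forall w, measurable [set t : n.-tuple R | D t = w],
      forall w1 w2 i, (kint (k w1 w2) i [::] (fun p => (X1 w1 p ^+ 2)%:E) <= P1%:E)%E /\
        (kint (k w1 w2) i [::] (fun p => (X2 w2 p ^+ 2)%:E) <= P2%:E)%E &
      forall w1 w2, (kint (k w1 w2) n [::] (fun p => ((D p != (w1, w2))%:R)%:E) <= err%:E)%E].

Definition state (la b th : R) p : R := foldl (fun s y : R => la * s - b * y) th p.

Lemma state_rcons la b th p y : state la b th (rcons p y) = la * state la b th p - b * y.
Proof. by rewrite /state foldl_rcons. Qed.

(** The receiver knows the outputs and can run the recursion from any candidate initial state; the
    difference of two such runs is free of noise and is governed by [la] alone. *)
Lemma state_sub la b th th' p : state la b th p - state la b th' p = la ^+ size p * (th - th').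
Proof.
elim/last_ind: p => [|p y IH]; first by rewrite mul1r.
by rewrite !state_rcons size_rcons exprS -mulrA -IH; ring.
Qed.

Lemma rmeas_state la b th : rmeas (state la b th).
Proof.
suff H n d (T : measurableType d) (g : T -> n.-tuple R) (h : T -> R) :
    measurable_fun setT g -> measurable_fun setT h ->
    measurable_fun setT (fun x => state la b (h x) (g x)).
  move=> n; apply: (H n _ (n.-tuple R) id (fun=> th)) => //; exact: measurable_id.
elim: n d T g h => [|n IH] d T g h mg mh.
  by under eq_fun do rewrite tuple0.
under eq_fun do rewrite [g _]tuple_eta.
have := IH d T (fun x => [tuple of behead (g x)]) (fun x => la * h x - b * thead (g x)).
apply.
  exact: (measurableT_comp (@measurable_behead _ _ n) mg).
apply: measurable_funB; apply: measurable_funM => //.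
rewrite (_ : (fun x => thead (g x)) = (fun x => tnth (g x) ord0))//.
exact: (measurableT_comp (measurable_tnth _) mg).
Qed.

Lemma measurable_has (I : Type) (r : seq I) d (T : measurableType d) (g : I -> T -> bool) :
  (forall i, measurable_fun setT (g i)) -> measurable_fun setT (fun x => has (g^~ x) r).
Proof.
move=> mg; elim: r => [|i r IH] //=.
exact: measurable_or.
Qed.

Lemma measurable_pick (I : finType) d (T : measurableType d) (g : I -> T -> bool) (i0 i : I) :
  (forall i, measurable_fun setT (g i)) -> (forall x i j, g i x -> g j x -> i = j) ->
  measurable [set x | odflt i0 [pick i | g i x] = i].
Proof.
move=> mg g_inj.
have mD : measurable_fun setT (fun x => g i x || ((i == i0) && ~~ has (g^~ x) (enum I))).
  apply: measurable_or => //; apply: measurable_and; first exact: measurable_cst.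
  by apply: measurable_neg; exact: measurable_has.
rewrite (_ : [set x | _] =
    (fun x => g i x || ((i == i0) && ~~ has (g^~ x) (enum I))) @^-1` [set true]).
  by rewrite -[X in measurable X]setTI; exact: mD.
apply/seteqP; split => x /=.
- case: pickP => [j gj /= <-|none /= <-]; first by rewrite gj.
  by rewrite none eqxx/=; apply/hasPn => j _; rewrite none.
- case: pickP => [j gj|none] /=.
    case/orP => [gi|/andP[_ /hasPn h]]; first exact: (g_inj x).
    by have := h j; rewrite mem_enum gj => /(_ isT).
  by rewrite none/= => /andP[/eqP -> _].
Qed.

Section linear_code.
Variables (v P1 P2 r1 r2 la1 la2 la3 c1 c2 c3 b1 b2 b3 : R) (Q : R -> R -> R -> R).
Hypothesis v_gt0 : 0 < v.
Hypothesis LS : linear_scheme v P1 P2 r1 r2 la1 la2 la3 c1 c2 c3 b1 b2 b3 Q.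

Notation sd := (Num.sqrt v).

Section moments.
Variables (th1 th2 th3 : R).
Hypothesis init : forall x y z, (x * th1 + y * th2 + z * th3) ^+ 2 <= Q x y z.
Let s1 := state la1 b1 th1.
Let s2 := state la2 b2 th2.
Let s3 := state la3 b3 th3.

Let a p := c1 * s1 p + c2 * s2 p + c3 * s3 p.

(** The last noise is fresh, so one step changes the coefficients as in the fixed point equation of
    [Q] and adds [v * be ^+ 2]. A bound by [Q] at time 0 therefore persists for all [n]. *)
Lemma state_moment n x y z :
  (kint (chan a sd) n [::] (fun p => ((x * s1 p + y * s2 p + z * s3 p) ^+ 2)%:E) <=
   (Q x y z)%:E)%E.
Proof.
have ma : rmeas a.
  by move=> k; do 2?[apply: measurable_funD]; apply: measurable_funM => //; exact: rmeas_state.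
have k0 := chan_ge0 a sd; have mk := kmeas_chan sd ma.
have k1 := chan_prob a sd.
elim: n x y z => [|n IH] x y z; first by rewrite lee_fin.
rewrite kint_rcons.
have [_ _ Qst _ _] := LS; rewrite -(Qst x y z).
set be := b1 * x + b2 * y + b3 * z.
set x' := la1 * x - c1 * be; set y' := la2 * y - c2 * be; set z' := la3 * z - c3 * be.
pose F p := ((x' * s1 p + y' * s2 p + z' * s3 p) ^+ 2)%:E.
have F0 p : (0 <= F p)%E by rewrite lee_fin sqr_ge0.
have mF : tmeas n F.
  apply/measurable_EFinP; apply: measurable_funX.
  by do 2?[apply: measurable_funD]; apply: measurable_funM => //; exact: rmeas_state.
have vb0 : (0 <= (v * be ^+ 2)%:E)%E by rewrite lee_fin mulr_ge0 ?sqr_ge0// ltW.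
apply: (@le_trans _ _ (kint (chan a sd) n [::] (fun p => F p + (v * be ^+ 2)%:E)%E)).
  rewrite le_eqVlt; apply/orP; left; apply/eqP.
  apply: (@eq_kint _ _ n) => // p sp.
  have sd0 : 0 < sd by rewrite sqrtr_gt0.
  have := chan_quadratic a (x * la1 * s1 p + y * la2 * s2 p + z * la3 * s3 p) (- be) p
    sd0 (lexx 0).
  rewrite !add0r sqrrN sqr_sqrtr ?ltW// => h.
  have -> : F p + (v * be ^+ 2)%:E = ((x * la1 * s1 p + y * la2 * s2 p + z * la3 * s3 p +
       - be * a p) ^+ 2 + be ^+ 2 * v)%:E.
    rewrite /F -EFinD; congr EFin; rewrite /x' /y' /z' /a; ring.
  rewrite -h; apply: eq_integral => w _; congr (_ * _%:E)%E.
  by rewrite add0r /s1 /s2 /s3 !state_rcons /be; ring.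
rewrite (@kintD _ _ k0 mk n)//; last exact: measurable_cst.
rewrite (kint_cst k0 mk k1)// EFinD; apply: leeD => //.
exact: IH.
Qed.

End moments.

Variables (n Ma Mb Mc : nat) (q ka : R).
Hypotheses (Ma_gt0 : (0 < Ma)%N) (Mb_gt0 : (0 < Mb)%N) (Mc_gt0 : (0 < Mc)%N).
Hypotheses (q_gt0 : 0 < q) (ka_gt0 : 0 < ka).
Hypothesis Qpd : forall x y z, ka * (x ^+ 2 + y ^+ 2 + z ^+ 2) <= Q x y z.
Hypothesis Ma_le : (Ma.-1)%:R * (2 * q) <= Num.sqrt (ka / 3) * `|la1| ^+ n.
Hypothesis Mb_le : (Mb.-1)%:R * (2 * q) <= Num.sqrt (ka / 3) * `|la2| ^+ n.
Hypothesis Mc_le : (Mc.-1)%:R * (2 * q) <= Num.sqrt (ka / 3) * `|la3| ^+ n.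

(* The messages are grid points of the initial states; after n steps two grid points
   differ by a multiple of 2 q, and the bounded second moment keeps the true one below q. *)
Definition grid (la : R) (i : nat) : R := i%:R * (2 * q / `|la| ^+ n).

(** Each of the three initial states gets a third of [ka], so that Cauchy-Schwarz and [Qpd] yield
    the initial bound of [state_moment]. *)
Lemma grid_le la M i : 1 <= `|la| -> M.-1%:R * (2 * q) <= Num.sqrt (ka / 3) * `|la| ^+ n ->
  (i < M)%N -> grid la i ^+ 2 <= ka / 3.
Proof.
move=> la1' h iM; have la0 : 0 < `|la| ^+ n by rewrite exprn_gt0// (lt_le_trans _ la1').
have k3 : 0 <= ka / 3 by apply: divr_ge0 => //; exact: ltW.
rewrite -[leRHS](sqr_sqrtr k3).
have q2_ge0 : 0 <= 2 * q by apply: mulr_ge0 => //; exact: ltW.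
have g0 : 0 <= grid la i.
  by apply: mulr_ge0 => //; apply: divr_ge0 => //; exact: ltW.
rewrite ler_pXn2r ?nnegrE ?sqrtr_ge0// /grid mulrA ler_pdivrMr//; apply: (le_trans _ h).
by apply: ler_wpM2r => //; rewrite ler_nat; case: (M) iM.
Qed.

Lemma grid_inj la b i j p : 1 <= `|la| -> size p = n ->
  `|state la b (grid la i) p| < q -> `|state la b (grid la j) p| < q -> i = j.
Proof.
move=> la1' sp hi hj; have la0 : 0 < `|la| ^+ n by rewrite exprn_gt0// (lt_le_trans _ la1').
have : `|state la b (grid la i) p - state la b (grid la j) p| < q + q.
  by apply: (le_lt_trans (ler_normB _ _)); exact: ltrD.
rewrite state_sub sp /grid -mulrBl normrM normrX normrM.
rewrite [`|2 * q / _|]ger0_norm; last first.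
  by apply: divr_ge0; [apply: mulr_ge0 => //|]; exact: ltW.
have -> : `|la| ^+ n * (`|i%:R - j%:R| * (2 * q / `|la| ^+ n)) = `|i%:R - j%:R| * (2 * q).
  by field; rewrite gt_eqF.
have -> : q + q = 1 * (2 * q) by ring.
rewrite ltr_pM2r ?mulr_gt0// => h.
apply/eqP; rewrite eqn_leq; apply/andP; split; rewrite leqNgt; apply/negP => ij.
- by move: h; rewrite -natrB ?(ltnW ij)// normr_nat -[1]/(1%:R) ltr_nat ltnS leqn0 subn_eq0 leqNgt ij.
- by move: h; rewrite distrC -natrB ?(ltnW ij)// normr_nat -[1]/(1%:R) ltr_nat ltnS leqn0 subn_eq0 leqNgt ij.
Qed.

(** The message of user 1 is written with two digits in base [Mb], one for each of its states. *)
Let s1 (w : 'I_(Ma * Mb)) := state la1 b1 (grid la1 (w %/ Mb)).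
Let s2 (w : 'I_(Ma * Mb)) := state la2 b2 (grid la2 (w %% Mb)).
Let s3 (w : 'I_Mc) := state la3 b3 (grid la3 w).

Definition decodable (w : 'I_(Ma * Mb) * 'I_Mc) p : bool :=
  [&& `|s1 w.1 p| < q, `|s2 w.1 p| < q & `|s3 w.2 p| < q].

Lemma decodable_inj w w' p : size p = n -> decodable w p -> decodable w' p -> w = w'.
Proof.
have [[l1 l2 l3] _ _ _ _] := LS.
move=> sp /and3P[h1 h2 h3] /and3P[h1' h2' h3'].
rewrite [w]surjective_pairing [w']surjective_pairing; congr pair; apply/val_inj => /=.
  rewrite [val w.1 in LHS](divn_eq _ Mb) [val w'.1 in RHS](divn_eq _ Mb).
  by rewrite (grid_inj l1 sp h1 h1') (grid_inj l2 sp h2 h2').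
exact: (grid_inj l3 sp h3 h3').
Qed.

(** Decoding fails only if some state of the true message has reached modulus [q]; Chebyshev's
    inequality for the three states gives the error. *)
Lemma linear_code_det : det_scheme v P1 P2 n (Ma * Mb) Mc ((Q 1 0 0 + Q 0 1 0 + Q 0 0 1) / q ^+ 2).
Proof.
have M12 : (0 < Ma * Mb)%N by rewrite muln_gt0 Ma_gt0.
have [[l1 l2 l3] _ _ [QP1 QP2] _] := LS.
pose w0 := (Ordinal M12, Ordinal Mc_gt0).
pose X1 w p := c1 * s1 w p + c2 * s2 w p.
pose X2 w p := c3 * s3 w p.
pose D p := odflt w0 [pick w | decodable w p].
have ms1 w : rmeas (s1 w) by exact: rmeas_state.
have ms2 w : rmeas (s2 w) by exact: rmeas_state.
have ms3 w : rmeas (s3 w) by exact: rmeas_state.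
have mX1 w : rmeas (X1 w).
  by move=> k; apply: measurable_funD; apply: measurable_funM => //; [exact: ms1|exact: ms2].
have mX2 w : rmeas (X2 w) by move=> k; apply: measurable_funM => //; exact: ms3.
have init (w1 : 'I_(Ma * Mb)) (w2 : 'I_Mc) x y z :
    (x * grid la1 (w1 %/ Mb) + y * grid la2 (w1 %% Mb) + z * grid la3 w2) ^+ 2 <= Q x y z.
  have g1 : grid la1 (w1 %/ Mb) ^+ 2 <= ka / 3.
    by apply: (grid_le l1 Ma_le); rewrite ltn_divLR.
  have g2 : grid la2 (w1 %% Mb) ^+ 2 <= ka / 3.
    by apply: (grid_le l2 Mb_le); rewrite ltn_pmod.
  have g3 := grid_le l3 Mc_le (ltn_ord w2).
  apply: le_trans (Qpd x y z).
  move: (grid la1 _) (grid la2 _) (grid la3 _) g1 g2 g3 => A B C g1 g2 g3.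
  have cs : (x * A + y * B + z * C) ^+ 2 <= (A ^+ 2 + B ^+ 2 + C ^+ 2) * (x ^+ 2 + y ^+ 2 + z ^+ 2).
    have h3 := sqr_ge0 (x * B - y * A); have h4 := sqr_ge0 (x * C - z * A).
    have h5 := sqr_ge0 (y * C - z * B); rewrite -subr_ge0.
    rewrite (_ : _ - _ = (x * B - y * A) ^+ 2 + (x * C - z * A) ^+ 2 + (y * C - z * B) ^+ 2); last by ring.
    by rewrite !addr_ge0.
  apply: (le_trans cs); apply: ler_wpM2r; first by rewrite !addr_ge0 ?sqr_ge0.
  lra.
have mDw w : measurable [set t : n.-tuple R | D t = w].
  have mst f : rmeas f -> measurable_fun [set: n.-tuple R] (fun t => `|f t| < q).
    move=> mf; apply: measurable_fun_ltr => //.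
    by apply: measurableT_comp; [exact: normr_measurable|exact: mf].
  apply: (measurable_pick (g := fun w (t : n.-tuple R) => decodable w t)) => [w'|t w' w''].
    apply: measurable_and; first exact: mst.
    by apply: measurable_and; exact: mst.
  by apply: decodable_inj; rewrite size_tuple.
exists X1, X2, D => k; split => //.
- move=> w1 w2 i; have mom := state_moment (init w1 w2) i.
  split.
  + rewrite -QP1; apply: le_trans (mom c1 c2 0).
    rewrite le_eqVlt; apply/orP; left; apply/eqP.
    by apply: (@eq_kint _ _ i) => // p _; rewrite mul0r addr0.
  + rewrite -QP2; apply: le_trans (mom 0 0 c3).
    rewrite le_eqVlt; apply/orP; left; apply/eqP.
    by apply: (@eq_kint _ _ i) => // p _; rewrite !mul0r !add0r.
- move=> w1 w2; have mom := state_moment (init w1 w2) n.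
  have ma : rmeas (fun p => X1 w1 p + X2 w2 p).
    by move=> j; apply: measurable_funD; [exact: mX1|exact: mX2].
  have k0 := chan_ge0 (fun p => X1 w1 p + X2 w2 p) sd.
  have mk := kmeas_chan sd ma.
  pose lin x y z p := ((x * s1 w1 p + y * s2 w1 p + z * s3 w2 p) ^+ 2)%:E.
  have lin0 x y z p : (0 <= lin x y z p)%E by rewrite lee_fin sqr_ge0.
  have mlin x y z : tmeas n (lin x y z).
    apply/measurable_EFinP; apply: measurable_funX.
    apply: measurable_funD; last by apply: measurable_funM => //; exact: ms3.
    by apply: measurable_funD; apply: measurable_funM => //; [exact: ms1|exact: ms2].
  pose S p := (lin 1%R 0%R 0%R p + (lin 0%R 1%R 0%R p + lin 0%R 0%R 1%R p))%E.
  have m23 : tmeas n (fun p => lin 0%R 1%R 0%R p + lin 0%R 0%R 1%R p)%E.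
    by apply: emeasurable_funD; exact: mlin.
  have mS : tmeas n S by apply: emeasurable_funD; [exact: mlin|exact: m23].
  have q2 : 0 < q ^+ 2 by rewrite exprn_gt0.
  have qi0 : (0 <= ((q ^+ 2)^-1)%:E)%E by rewrite lee_fin invr_ge0 ltW.
  apply: (@le_trans _ _ (kint (k w1 w2) n [::] (fun p => ((q ^+ 2)^-1)%:E * S p)%E)).
    apply: (@kint_le _ _ k0 mk n) => //.
    + rewrite /tmeas; apply/measurable_EFinP.
      rewrite (_ : (fun _ => _) = \1_(~` [set t : n.-tuple R | D t = (w1, w2)])).
        by apply: measurable_indic; exact: measurableC.
      apply/funext => t; rewrite indicE; case: eqP => /= h.
        by rewrite memNset//= => /(_ h).
      by rewrite mem_set.
    + by move=> p; rewrite mule_ge0// !adde_ge0.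
    + exact: measurable_funeM.
    + move=> p sp; rewrite /S /lin -!EFinD -EFinM lee_fin !mul1r !mul0r !addr0 !add0r.
      have bad f : q <= `|f| -> 1 <= (q ^+ 2)^-1 * f ^+ 2 :> R.
        move=> qf; rewrite mulrC ler_pdivlMr// mul1r -real_normK ?num_real//.
        by rewrite ler_pXn2r ?nnegrE ?normr_ge0// ltW.
      have pos f : 0 <= (q ^+ 2)^-1 * f ^+ 2 :> R by rewrite mulr_ge0 ?sqr_ge0 ?invr_ge0// ltW.
      rewrite !mulrDr.
      have [gw|] := boolP (decodable (w1, w2) p).
        have -> : D p = (w1, w2).
          rewrite /D; case: pickP => [w' gw'|/(_ (w1, w2))]; last by rewrite gw.
          exact: (decodable_inj sp gw' gw).
        by rewrite eqxx/= !addr_ge0.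
      have := pos (s1 w1 p); have := pos (s2 w1 p); have := pos (s3 w2 p).
      have : ((D p != (w1, w2))%:R : R) <= 1 by case: (_ != _).
      rewrite /decodable !negb_and -!leNgt /= => h p3 p2 p1 /orP[/bad|/orP[/bad|/bad]]; lra.
  rewrite (@kintZl _ _ k0 mk n)//; last first.
    by move=> p; rewrite !adde_ge0.
  rewrite (@kintD _ _ k0 mk n)//; last first.
    by move=> p; rewrite adde_ge0.
  rewrite (@kintD _ _ k0 mk n)// mulrC EFinM; apply: lee_wpmul2l => //.
  by rewrite !EFinD -addeA; apply: leeD; [exact: mom|apply: leeD; exact: mom].
Qed.

End linear_code.
End feedback_code.

Local Transparent kint.

(** * Secrecy from the first output *)

Section secret_key.
Context {R : realType}.
Notation mu := (@lebesgue_measure R).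
Variables (v : R) (W : finType) (w0 : W).
Hypothesis v_gt0 : 0 < v.
Notation sd := (Num.sqrt v).
Notation M := #|W|.

(** Beyond this radius [expR (- y ^+ 2 / (4 * v))] is at most [m%:R^-1]; the summand 1 keeps the
    radius positive when [m = 1]. *)
Definition key_radius (m : nat) : R := Num.sqrt (4 * v * ln m%:R) + 1.
Definition key_const (m : nat) : R := 2 * key_radius m * normal_peak sd + 2.

Let M_gt0 : (0 < M)%N. Proof. by apply/card_gt0P; exists w0. Qed.
Let J := key_radius M.
Let d := 2 * J / M%:R.
Let a (i : nat) := - J + d * i%:R.
Let cell (w : W) (y : R) := a (enum_rank w) <= y < a (enum_rank w).+1.
(** Outside [[- J, J)] no cell applies and the key is [w0]; the tail bound accounts for this. *)
Let K y := odflt w0 [pick w | cell w y].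

Let sd_gt0 : 0 < sd. Proof. by rewrite sqrtr_gt0. Qed.
Let J_gt0 : 0 < J. Proof. by rewrite ltr_wpDl// sqrtr_ge0. Qed.
Let MR : 0 < M%:R :> R. Proof. by rewrite ltr0n. Qed.
Let d_gt0 : 0 < d. Proof. by apply: divr_gt0 => //; apply: mulr_gt0. Qed.

Let a_le i j : (i <= j)%N -> a i <= a j.
Proof. by move=> ij; rewrite lerD2l ler_pM2l// ler_nat. Qed.

Let cell_inj y w w' : cell w y -> cell w' y -> w = w'.
Proof.
move=> /andP[h1 h2] /andP[h1' h2']; apply/enum_rank_inj/val_inj => /=.
apply/eqP; rewrite eqn_leq -ltnS -[X in _ && X]ltnS.
apply/andP; split; rewrite ltnNge; apply/negP => /a_le h.
- by have := lt_le_trans (le_lt_trans h1 h2') h; rewrite ltxx.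
- by have := lt_le_trans (le_lt_trans h1' h2) h; rewrite ltxx.
Qed.

Let cell_cover y : - J <= y < J -> exists w, cell w y.
Proof.
move=> /andP[h1 h2]; pose i := Num.truncn ((y + J) / d).
have yJ0 : 0 <= (y + J) / d.
  by apply: divr_ge0; [lra|exact: ltW].
have /andP[i1 i2] := truncn_itv yJ0.
have iM : (i < M)%N.
  rewrite -(ltr_nat R); apply: (le_lt_trans i1); rewrite ltr_pdivrMr//.
  rewrite /d mulrC divfK ?gt_eqF//; lra.
exists (enum_val (Ordinal iM)); rewrite /cell enum_valK/= /a.
move: i1 i2; rewrite ler_pdivlMr// ltr_pdivrMr// [_ * d]mulrC [_ * d]mulrC => i1 i2.
apply/andP; split; lra.
Qed.

Let measurable_cell w : measurable_fun setT (cell w).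
Proof.
apply: measurable_and; first by apply: measurable_fun_ler => //; exact: measurable_id.
by apply: measurable_fun_ltr => //; exact: measurable_id.
Qed.

(** A cell has mass at most its length [d] times the peak of the density. Outside the cells the
    density is at most [2 / M] times the Gaussian density of doubled variance, which has mass 1. The
    sum of the two is [key_const M / M]. *)
Lemma exists_key : exists K : R -> W,
  (forall k, measurable [set y | K y = k]) /\
  forall k, (\int[mu]_y ((normal_pdf 0 sd y)%:E * ((K y == k)%:R)%:E) <=
     (key_const M / M%:R)%:E)%E.
Proof.
exists K; have mK k : measurable [set y | K y = k].
  by apply: measurable_pick => // x i j; exact: cell_inj.
split=> // k.
pose s2 := Num.sqrt 2 * sd.
have r20 : 0 < Num.sqrt 2 :> R by rewrite sqrtr_gt0.
have s20 : 0 < s2 by rewrite mulr_gt0.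
have s22 : s2 ^+ 2 = 2 * v by rewrite exprMn !sqr_sqrtr// ltW.
have sd2 : sd ^+ 2 = v by rewrite sqr_sqrtr// ltW.
have r2le : Num.sqrt 2 <= 2 :> R.
  by rewrite -(@ler_pXn2r _ 2) ?nnegrE// ?sqr_sqrtr ?ltW//; lra.
have tail y : J ^+ 2 <= y ^+ 2 -> normal_pdf 0 sd y <= 2 / M%:R * normal_pdf 0 s2 y.
  move=> yJ; rewrite -ler_pdivrMr ?normal_pdf_gt0// normal_pdf_ratio//.
  have -> : s2 / sd = Num.sqrt 2 by rewrite /s2 mulfK// gt_eqF.
  apply: ler_pM => //.
  have -> : M%:R^-1 = expR (- ln M%:R) :> R by rewrite expRN lnK// posrE.
  rewrite ler_expR subr0 s22 sd2.
  have -> : y ^+ 2 / (2 * v *+ 2) - y ^+ 2 / (v *+ 2) = - (y ^+ 2 / (4 * v)).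
    by field; rewrite gt_eqF.
  rewrite lerN2 ler_pdivlMr ?mulr_gt0//; apply: le_trans yJ.
  have lM : 0 <= 4 * v * ln M%:R.
    by rewrite mulr_ge0 ?ln_ge0 ?ler1n// mulr_ge0// ltW.
  rewrite mulrC -[leLHS](sqr_sqrtr lM) ler_pXn2r ?nnegrE ?sqrtr_ge0 ?(ltW J_gt0)//.
  by rewrite /J /key_radius lerDl.
pose I := `[a (enum_rank k), a (enum_rank k).+1]%classic : set R.
apply: (@le_trans _ _ (\int[mu]_y ((normal_peak sd)%:E * (\1_I y)%:E +
    (2 / M%:R)%:E * (normal_pdf 0 s2 y)%:E))%E).
  apply: ge0_le_integral => //.
  - by move=> y _; rewrite -EFinM lee_fin mulr_ge0 ?normal_pdf_ge0.
  - apply: measurable_normal_pdfM; apply/measurable_EFinP.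
    rewrite (_ : (fun _ => _) = \1_[set y | K y = k]); first exact: measurable_indic.
    apply/funext => y; rewrite indicE; case: eqP => h; first by rewrite mem_set.
    by rewrite memNset.
  - apply: emeasurable_funD; apply: measurable_funeM; apply/measurable_EFinP.
      by apply: measurable_indic; exact: measurable_itv.
    exact: measurable_normal_pdf.
  - move=> y _; rewrite -!EFinM -EFinD lee_fin.
    have p0 : 0 <= normal_pdf 0 sd y by exact: normal_pdf_ge0.
    have q0 : 0 <= 2 / M%:R * normal_pdf 0 s2 y.
      by apply: mulr_ge0; [apply: divr_ge0|exact: normal_pdf_ge0].
    have i0 : 0 <= normal_peak sd * \1_I y by rewrite mulr_ge0 ?normal_peak_ge0// indicE.
    case: eqP => [Kk|_]; last by rewrite mulr0 addr_ge0.
    rewrite mulr1; have [ck|nck] := boolP (cell k y).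
      rewrite ler_wpDr// indicE mem_set ?mulr1 ?normal_pdf_ub ?gt_eqF//.
      by move/andP: ck => [h1 /ltW h2]; rewrite /I/= in_itv/= h1.
    rewrite ler_wpDl//; apply: tail; rewrite -[y ^+ 2]real_normK ?num_real//.
    rewrite ler_pXn2r ?nnegrE ?(ltW J_gt0)// leNgt; apply/negP => yJ.
    have [w cw] : exists w, cell w y.
      by apply: cell_cover; move: yJ; rewrite ltr_norml => /andP[/ltW -> ->].
    move: Kk; rewrite /K; case: pickP => [w' cw' /= e|/(_ w)]; last by rewrite cw.
    by rewrite -e cw' in nck.
rewrite ge0_integralD//; last 4 first.
- by move=> y _; rewrite -EFinM lee_fin mulr_ge0 ?normal_peak_ge0// indicE.
- by apply: measurable_funeM; apply/measurable_EFinP/measurable_indic; exact: measurable_itv.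
- by move=> y _; rewrite -EFinM lee_fin mulr_ge0 ?divr_ge0 ?normal_pdf_ge0.
- by apply: measurable_funeM; apply/measurable_EFinP; exact: measurable_normal_pdf.
rewrite !ge0_integralZl//; last 3 first.
- by rewrite lee_fin normal_peak_ge0.
- by apply/measurable_EFinP; exact: measurable_normal_pdf.
- by move=> y _; rewrite lee_fin normal_pdf_ge0.
rewrite integral_normal_pdf mule1 integral_indic//; last exact: measurable_itv.
rewrite /= setIT lebesgue_measure_itv/= lte_fin.
have -> : a (enum_rank k) < a (enum_rank k).+1 by rewrite ltrD2l ltr_pM2l// ltr_nat.
rewrite -EFinB -[(_ * (_ - _)%:E)%E]EFinM -EFinD lee_fin.
have -> : a (enum_rank k).+1 - a (enum_rank k) = d by rewrite /a -natr1; ring.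
  rewrite le_eqVlt; apply/orP; left; apply/eqP.
  by rewrite /key_const -/J /d; field; rewrite gt_eqF.
by apply/measurable_EFinP/measurable_indic; exact: measurable_itv.
Qed.

End secret_key.

(** * One-time pad on top of a feedback code *)

Section keyed_code.
Context {R : realType}.
Notation mu := (@lebesgue_measure R).
Implicit Types (p s : seq R) (H : seq R -> \bar R).

Lemma cexp_uniform_free N M1 M2 (c : gmac_code (R := R) M1 M2) var1 w1 w2 (a : seq R -> R) H :
  rmeas a -> (forall i p u1 u2, enc1 c i w1 p u1 + enc2 c i w2 p u2 = a p) ->
  (forall s, (0 <= H s)%E) -> tmeas N H ->
  cexp N var1 (fun u1 u2 e => H (outputs c w1 w2 u1 u2 e N)) =
  kint (chan a (Num.sqrt var1)) N [::] H.
Proof.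
move=> ma ca H0 mH; rewrite /cexp.
have E u1 u2 : iter_int (normal_pdf 0 (Num.sqrt var1))
    (fun e : N.-tuple R => H (outputs c w1 w2 u1 u2 e N)) =
    kint (chan a (Num.sqrt var1)) N [::] H.
  under eq_fun do rewrite outputs_foldl ?size_tuple// take_oversize ?size_tuple//.
  rewrite -(iter_int_foldl (N := N))//; last 2 first.
  - by move=> y; exact: normal_pdf_ge0.
  - exact: (@kmeas_chan R a (Num.sqrt var1) ma).
  congr iter_int; apply/funext => t; congr (H _).
  by congr foldl; apply/funext => s; apply/funext => x; rewrite ca.
under eq_integral do under eq_integral do rewrite E.
have K0 := kint_ge0 N [::] (chan_ge0 a (Num.sqrt var1)) H0.
have I1 (x : \bar R) : (0 <= x -> \int[mu]_(u in `[0%R, 1%R]) x = x)%E.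
  by move=> x0; rewrite integral_cst//= lebesgue_measure_itv/= lte_fin ltr01 sube0 mule1.
under eq_integral do rewrite I1//.
exact: I1.
Qed.

Lemma kint_chan_cons a sd n y p H :
  kint (chan a sd) n (y :: p) H =
  kint (chan (fun s => a (y :: s)) sd) n p (fun s => H (y :: s)).
Proof. by elim: n p => [//|n IH] p /=; apply: eq_integral => z _; rewrite IH. Qed.

Lemma measurable_discrete (W : finType) d (T : measurableType d) (k : T -> W) (g : W -> T -> R) :
  (forall w, measurable [set x | k x = w]) -> (forall w, measurable_fun setT (g w)) ->
  measurable_fun setT (fun x => g (k x) x).
Proof.
move=> mk mg; rewrite (_ : (fun _ => _) = (fun x =>
  \sum_(w : W) g w x * \1_[set x | k x = w] x)).
  by apply: measurable_sum => w; apply: measurable_funM => //; exact: measurable_indic.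
apply/funext => x; rewrite (bigD1 (k x))//= big1 => [|w wt].
  by rewrite addr0 indicE mem_set//= mulr1.
rewrite indicE memNset ?mulr0//= => tw.
by rewrite tw eqxx in wt.
Qed.

Variables (v1 P1 P2 err : R) (n m1 m2 : nat).
Notation W := ('I_m1.+1 * 'I_m2.+1)%type.
Notation sd1 := (Num.sqrt v1).
Variables (X1 : 'I_m1.+1 -> seq R -> R) (X2 : 'I_m2.+1 -> seq R -> R) (D : seq R -> W).
Variable K : R -> W.
Hypothesis v1_gt0 : 0 < v1.
Hypothesis mX1 : forall w, rmeas (X1 w).
Hypothesis mX2 : forall w, rmeas (X2 w).
Hypothesis mD : forall w, measurable [set t : n.-tuple R | D t = w].
Hypothesis mK : forall w, measurable [set y | K y = w].
Hypotheses (P1_ge0 : 0 <= P1) (P2_ge0 : 0 <= P2) (err_ge0 : 0 <= err).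

Definition inner (w : W) := chan (fun p => X1 w.1 p + X2 w.2 p) sd1.

Hypothesis power1 : forall w i, (kint (inner w) i [::] (fun p => (X1 w.1 p ^+ 2)%:E) <= P1%:E)%E.
Hypothesis power2 : forall w i, (kint (inner w) i [::] (fun p => (X2 w.2 p ^+ 2)%:E) <= P2%:E)%E.
Hypothesis error : forall w, (kint (inner w) n [::] (fun p => ((D p != w)%:R)%:E) <= err%:E)%E.

(* The first output is pure noise and serves as a one-time pad shared by the
   two encoders and the decoder. *)
Definition keyed_enc1 (w : 'I_m1.+1) p := if p is y :: p' then X1 (w + (K y).1) p' else 0.
Definition keyed_enc2 (w : 'I_m2.+1) p := if p is y :: p' then X2 (w + (K y).2) p' else 0.
Definition keyed_dec s : W := if s is y :: s' then D s' - K y else 0.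
Definition keyed_code : gmac_code (R := R) m1.+1 m2.+1 :=
  GmacCode (fun _ w p _ => keyed_enc1 w p) (fun _ w p _ => keyed_enc2 w p) keyed_dec.

Lemma measurable_key i d (T : measurableType d) (f : T -> i.+1.-tuple R) w :
  measurable_fun setT f -> measurable [set x | K (thead (f x)) = w].
Proof.
move=> mf; have mt : measurable_fun setT (fun x => thead (f x)).
  exact: (measurableT_comp (measurable_tnth ord0) mf).
have := mt measurableT _ (mK w); rewrite setTI; exact.
Qed.

Lemma rmeas_keyed_enc1 w : rmeas (keyed_enc1 w).
Proof.
case=> [|i].
  by rewrite (_ : (fun _ => _) = cst 0)//; apply/funext => t; rewrite tuple0.
rewrite (_ : (fun _ => _) = (fun t : i.+1.-tuple R => X1 (w + (K (thead t)).1) (behead t))); last first.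
  by apply/funext => t; rewrite [in LHS](tuple_eta t).
apply: (@measurable_discrete W _ (i.+1.-tuple R) (fun t => K (thead t))
  (fun k t => X1 (w + k.1) (behead t))).
- by move=> k; apply: (@measurable_key i _ _ id); exact: measurable_id.
- move=> k; exact: (measurableT_comp (@mX1 (w + k.1) i) (@measurable_behead _ _ i)).
Qed.

Lemma rmeas_keyed_enc2 w : rmeas (keyed_enc2 w).
Proof.
case=> [|i].
  by rewrite (_ : (fun _ => _) = cst 0)//; apply/funext => t; rewrite tuple0.
rewrite (_ : (fun _ => _) = (fun t : i.+1.-tuple R => X2 (w + (K (thead t)).2) (behead t))); last first.
  by apply/funext => t; rewrite [in LHS](tuple_eta t).
apply: (@measurable_discrete W _ (i.+1.-tuple R) (fun t => K (thead t))
  (fun k t => X2 (w + k.2) (behead t))).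
- by move=> k; apply: (@measurable_key i _ _ id); exact: measurable_id.
- move=> k; exact: (measurableT_comp (@mX2 (w + k.2) i) (@measurable_behead _ _ i)).
Qed.

Lemma keyed_code_measurable : code_measurable n.+1 keyed_code.
Proof.
split=> [i w|i w|w] /=.
- exact: (measurableT_comp (@rmeas_keyed_enc1 w i) measurable_fst).
- exact: (measurableT_comp (@rmeas_keyed_enc2 w i) measurable_fst).
- rewrite (_ : [set t | _] = \bigcup_k ([set t : n.+1.-tuple R | K (thead t) = k] `&`
     [set t | D (behead t) = w + k])).
    apply: fin_bigcup_measurable => // k _; apply: measurableI.
      by apply: (@measurable_key n _ _ id); exact: measurable_id.
    have := @measurable_behead _ _ n measurableT _ (mD (w + k)); rewrite setTI; exact.
  apply/seteqP; split => t /=;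
    have -> : keyed_dec t = D (behead t) - K (thead t) by rewrite [in LHS](tuple_eta t).
    by move=> <-; exists (K (thead t)) => //; split=> //=; rewrite subrK.
  by move=> [k _ [-> ->]]; rewrite addrK.
Qed.

Lemma rmeas_keyed_sum w : rmeas (fun p => keyed_enc1 w.1 p + keyed_enc2 w.2 p).
Proof. by move=> i; apply: measurable_funD; [exact: rmeas_keyed_enc1|exact: rmeas_keyed_enc2]. Qed.

(** At time 0 both encoders send 0, so [y] has the noise density; afterwards the outputs follow the
    inner code for the shifted message. *)
Lemma cexp_keyed w H : (forall s, (0 <= H s)%E) -> tmeas n.+1 H ->
  cexp n.+1 v1 (fun u1 u2 e => H (outputs keyed_code w.1 w.2 u1 u2 e n.+1)) =
  (\int[mu]_y ((normal_pdf 0 sd1 y)%:E *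
     kint (inner (w + K y)%R) n [::] (fun s => H (y :: s))))%E.
Proof.
move=> H0 mH.
apply: (etrans (@cexp_uniform_free n.+1 _ _ keyed_code v1 w.1 w.2
  (fun p => keyed_enc1 w.1 p + keyed_enc2 w.2 p) H (@rmeas_keyed_sum w) (fun _ _ _ _ => erefl) H0 mH)).
rewrite /=; apply: eq_integral => y _.
by rewrite kint_chan_cons /chan/= addr0 subr0.
Qed.

Lemma measurable_keyed w H : (forall s, (0 <= H s)%E) -> tmeas n.+1 H ->
  measurable_fun setT (fun y => ((normal_pdf 0 sd1 y)%:E *
     kint (inner (w + K y)%R) n [::] (fun s => H (y :: s)))%E).
Proof.
move=> H0 mH.
have := @measurable_kint _ _ (chan_ge0 (fun p => keyed_enc1 w.1 p + keyed_enc2 w.2 p) sd1)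
  (kmeas_chan sd1 (@rmeas_keyed_sum w)) n.+1 H n [::] H0 mH erefl.
rewrite (_ : (fun _ => _) = (fun y => ((normal_pdf 0 sd1 y)%:E *
     kint (inner (w + K y)%R) n [::] (fun s => H (y :: s)))%E))//.
by apply/funext => y; rewrite /= kint_chan_cons /chan/= addr0 subr0.
Qed.

Lemma cexp_keyed_le w H (B : R) : 0 <= B -> (forall s, (0 <= H s)%E) -> tmeas n.+1 H ->
  (forall y, (kint (inner (w + K y)%R) n [::] (fun s => H (y :: s)) <= B%:E)%E) ->
  (cexp n.+1 v1 (fun u1 u2 e => H (outputs keyed_code w.1 w.2 u1 u2 e n.+1)) <= B%:E)%E.
Proof.
move=> B0 H0 mH HB; rewrite cexp_keyed//.
apply: (@le_trans _ _ (\int[mu]_y ((normal_pdf 0 sd1 y)%:E * B%:E))%E).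
  apply: ge0_le_integral => //.
  - move=> y _; apply: mule_ge0; first by rewrite lee_fin normal_pdf_ge0.
    by apply: kint_ge0 => // p z; exact: chan_ge0.
  - exact: measurable_keyed.
  - by apply: measurable_normal_pdfM; exact: measurable_cst.
  - by move=> y _; apply: lee_wpmul2l => //; rewrite lee_fin normal_pdf_ge0.
rewrite ge0_integralZr ?lee_fin//; first by rewrite integral_normal_pdf mul1e.
  by apply/measurable_EFinP; exact: measurable_normal_pdf.
by move=> y _; rewrite lee_fin normal_pdf_ge0.
Qed.

Lemma input_power_le (f : W -> seq R -> R) (X : W -> seq R -> R) B w i :
  (forall w, rmeas (f w)) -> (forall w, f w [::] = 0) ->
  (forall w y p, f w (y :: p) = X (w + K y) p) -> (i <= n)%N -> 0 <= B ->
  (forall w i, (kint (inner w) i [::] (fun p => (X w p ^+ 2)%:E) <= B%:E)%E) ->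
  (cexp n.+1 v1 (fun u1 u2 e =>
     (f w (outputs keyed_code w.1 w.2 u1 u2 e i) ^+ 2)%:E) <= B%:E)%E.
Proof.
move=> mf f0 fX ni B0 XB.
pose H s := (f w (take i s) ^+ 2)%:E.
rewrite (_ : (fun _ _ _ => _) =
    (fun u1 u2 e => H (outputs keyed_code w.1 w.2 u1 u2 e n.+1))); last first.
  apply/funext => u1; apply/funext => u2; apply/funext => e.
  by rewrite /H take_outputs// ltnW.
apply: cexp_keyed_le => //.
- by move=> s; rewrite lee_fin sqr_ge0.
- apply/measurable_EFinP; apply: measurable_funX.
  have := measurableT_comp (mf w (minn i n.+1))
    (@measurable_take R n.+1 i _ (n.+1.-tuple R) id (@measurable_id _ _ setT)).
  exact.
- move=> y; case: i ni @H => [_|i ni] H.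
    rewrite /H; under eq_fun do rewrite take0 f0 expr0n/=.
    by rewrite kint0 lee_fin.
  rewrite /H; under eq_fun do rewrite /= fX.
  have ma : rmeas (fun p => X1 (w + K y).1 p + X2 (w + K y).2 p).
    by move=> j; apply: measurable_funD; [exact: mX1|exact: mX2].
  have k0 : forall p z, 0 <= inner (w + K y) p z by exact: chan_ge0.
  have mk : kmeas (inner (w + K y)) by exact: kmeas_chan.
  have k1 p : (\int[mu]_z (inner (w + K y)%R p z)%:E = 1)%E by exact: chan_prob.
  move: (inner (w + K y)) (XB (w + K y) i) k0 mk k1 => k XBk k0 mk k1.
  have := kint_take k0 mk k1 (F := fun p => (X (w + K y) p ^+ 2)%:E) [::] (ltnW ni).
  rewrite [size _]/= add0n => ->; first exact: XBk.
  by move=> s; rewrite lee_fin sqr_ge0.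
Qed.

Lemma avg_power_le (f : nat -> 'I_m1.+1 -> 'I_m2.+1 -> \bar R) (B : R) :
  (forall i w1 w2, (i <= n)%N -> (f i w1 w2 <= B%:E)%E) ->
  ((n.+1%:R)^-1%:E * \sum_(i < n.+1) mavg (f i) <= B%:E)%E.
Proof.
move=> fB.
apply: (@le_trans _ _ ((n.+1%:R)^-1%:E * \sum_(i < n.+1) B%:E)%E).
  apply: lee_wpmul2l; first by rewrite lee_fin invr_ge0.
  apply: lee_sum => i _; rewrite -(@mavg_cst R m1.+1 m2.+1)//.
  by apply: mavg_le => w1 w2; apply: fB; rewrite -ltnS.
by rewrite sumEFin -EFinM lee_fin sumr_const card_ord -[B *+ _]mulr_natl mulKf//.
Qed.

Lemma keyed_power1 : (avg_power1 n.+1 keyed_code v1 <= P1%:E)%E.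
Proof.
apply: (@avg_power_le (fun i w1 w2 => cexp n.+1 v1 (fun u1 u2 e =>
  (keyed_enc1 w1 (outputs keyed_code w1 w2 u1 u2 e i) ^+ 2)%:E))) => i w1 w2 ni.
apply: (@input_power_le (fun w => keyed_enc1 w.1) (fun w => X1 w.1) _ (w1, w2)) => //.
by move=> w; exact: rmeas_keyed_enc1.
Qed.

Lemma keyed_power2 : (avg_power2 n.+1 keyed_code v1 <= P2%:E)%E.
Proof.
apply: (@avg_power_le (fun i w1 w2 => cexp n.+1 v1 (fun u1 u2 e =>
  (keyed_enc2 w2 (outputs keyed_code w1 w2 u1 u2 e i) ^+ 2)%:E))) => i w1 w2 ni.
apply: (@input_power_le (fun w => keyed_enc2 w.2) (fun w => X2 w.2) _ (w1, w2)) => //.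
by move=> w; exact: rmeas_keyed_enc2.
Qed.

Lemma keyed_error : (error_prob n.+1 keyed_code v1 <= err%:E)%E.
Proof.
rewrite -(@mavg_cst R m1.+1 m2.+1)//; apply: mavg_le => w1 w2.
pose H s : \bar R := (if keyed_dec s == (w1, w2) then 0 else 1)%:E.
have H0 s : (0 <= H s)%E by rewrite /H; case: ifP.
apply: (@cexp_keyed_le (w1, w2) H) => //.
- apply/measurable_EFinP.
  have [_ _ mdec] := keyed_code_measurable.
  apply: (@measurable_discrete W _ _ (fun t : n.+1.-tuple R => keyed_dec t)
    (fun k _ => if k == (w1, w2) then 0 else 1)) => //.
- move=> y; apply: le_trans (error ((w1, w2) + K y)).
  rewrite le_eqVlt; apply/orP; left; apply/eqP; congr kint.
  apply/funext => s; rewrite /H /= subr_eq; by case: eqP.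
Qed.

End keyed_code.

Section signed_integral.
Context {R : realType}.
Notation mu := (@lebesgue_measure R).

(** Monotonicity without measurability: positive and negative parts are compared through the simple
    functions below them. The signed entropy integrand thus needs no measurability proof. *)
Lemma le_integralT (f g : R -> \bar R) : (forall x, (f x <= g x)%E) ->
  (\int[mu]_x f x <= \int[mu]_x g x)%E.
Proof.
move=> fg; have ge0_le (h k : R -> \bar R) : (forall x, (0 <= h x)%E) ->
    (forall x, (h x <= k x)%E) -> (\int[mu]_x h x <= \int[mu]_x k x)%E.
  move=> h0 hk; have k0 x : (0 <= k x)%E by apply: le_trans (hk x).
  rewrite !ge0_integralTE//; apply: ge_ereal_sup => /= _ [s sh <-].
  by apply: ereal_sup_ubound; exists s => // x; apply: le_trans (hk x).
rewrite integralE [leRHS]integralE; apply: leeB; apply: ge0_le => x.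
- exact: funepos_ge0.
- by apply: (@funepos_le _ _ setT); rewrite ?inE.
- exact: funeneg_ge0.
- by apply: (@funeneg_le _ _ setT); rewrite ?inE.
Qed.

Lemma le_iter_int (g : R -> R) n (F G : n.-tuple R -> \bar R) : (forall x, 0 <= g x) ->
  (forall t, (F t <= G t)%E) -> (iter_int g F <= iter_int g G)%E.
Proof.
move=> g0; elim: n F G => [|n IH] F G FG /=; first exact: FG.
by apply: le_integralT => x; apply: lee_wpmul2l; [rewrite lee_fin|apply: IH].
Qed.

(** The scalar will contain a lower bound for a logarithm, negative for large observations, whereas
    [kintZl] covers nonnegative factors only. *)
Lemma kint_scale (k : seq R -> R -> R) N (F : seq R -> \bar R) n p (a : R) :
  (forall p y, 0 <= k p y) -> kmeas k -> (forall s, (0 <= F s)%E) -> tmeas N F ->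
  (size p + n)%N = N -> (kint k n p (fun s => a%:E * F s) = a%:E * kint k n p F)%E.
Proof.
move=> k0 mk F0 mF e; have [a0|a0] := leP 0 a.
  by apply: (@kintZl _ _ k0 mk N) => //; rewrite lee_fin.
have Na0 : (0 <= (- a)%:E)%E by rewrite lee_fin oppr_ge0 ltW.
have kN (G : seq R -> \bar R) m q : (forall s, (0 <= G s)%E) ->
    (kint k m q (fun s => - G s) = - kint k m q G)%E.
  move=> G0; elim: m q => [//|m IH] q /=.
  rewrite -integral_ge0N; last by move=> y _; apply: mule_ge0; rewrite ?lee_fin ?kint_ge0.
  by apply: eq_integral => y _; rewrite IH muleN.
transitivity (- kint k n p (fun s => (- a)%:E * F s))%E.
  rewrite -kN; last by move=> s; apply: mule_ge0.
  by apply: (@eq_kint _ k N) => // s _; rewrite EFinN mulNe oppeK.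
by rewrite (@kintZl _ _ k0 mk N)// EFinN mulNe oppeK.
Qed.

End signed_integral.

Section observation.
Context {R : realType}.
Notation mu := (@lebesgue_measure R).
Variables (k : seq R -> R -> R) (n : nat) (sd : R).
Hypotheses (k0 : forall p y, 0 <= k p y) (mk : kmeas k).
Hypothesis k1 : forall p, (\int[mu]_y (k p y)%:E = 1)%E.
Hypothesis sd_gt0 : 0 < sd.

Definition noise_pdf (s z : seq R) : R :=
  \prod_(i < n) normal_pdf (nth 0 s i) sd (nth 0 z i).

Definition obs (z : seq R) : R := fine (kint k n [::] (fun s => (noise_pdf s z)%:E)).

Lemma noise_pdf_ge0 s z : 0 <= noise_pdf s z.
Proof. by apply: prodr_ge0 => i _; exact: normal_pdf_ge0. Qed.

Lemma measurable_noise_pdf d (T : measurableType d) (f g : T -> n.-tuple R) :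
  measurable_fun setT f -> measurable_fun setT g ->
  measurable_fun setT (fun x => noise_pdf (f x) (g x)).
Proof.
move=> mf mg; apply: measurable_prod => i _.
under eq_fun do rewrite normal_pdf_center//.
apply: (measurableT_comp (measurable_normal_pdf 0 sd)).
by apply: measurable_funB; exact: measurable_nth.
Qed.

Lemma noise_pdf_le s z : noise_pdf s z <= normal_peak sd ^+ n.
Proof.
apply: (@le_trans _ _ (\prod_(i < n) normal_peak sd)); last by rewrite prodr_const card_ord.
by apply: ler_prod => i _; rewrite normal_pdf_ge0 normal_pdf_ub// gt_eqF.
Qed.

Lemma noise_pdf_tmeas z : size z = n -> tmeas n (fun s => (noise_pdf s z)%:E).
Proof.
move=> sz; apply/measurable_EFinP.
have := @measurable_noise_pdf _ (n.-tuple R) id (fun=> tcast sz (in_tuple z))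
  (@measurable_id _ _ setT) (measurable_cst _).
by rewrite (_ : (fun _ => _) = (fun s : n.-tuple R => noise_pdf s z))//;
  apply/funext => s; rewrite val_tcast.
Qed.

Lemma obsE z : size z = n -> (obs z)%:E = kint k n [::] (fun s => (noise_pdf s z)%:E).
Proof.
move=> sz; rewrite /obs fineK// ge0_fin_numE; last first.
  by apply: kint_ge0 => // s; rewrite lee_fin noise_pdf_ge0.
have p0 : (0 <= (normal_peak sd ^+ n)%:E)%E by rewrite lee_fin exprn_ge0 ?normal_peak_ge0.
apply: (@le_lt_trans _ _ (normal_peak sd ^+ n)%:E); last exact: ltry.
rewrite -[leRHS](kint_cst k0 mk k1 n [::])//.
apply: (@kint_le _ _ k0 mk n) => //.
- by move=> s; rewrite lee_fin noise_pdf_ge0.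
- exact: noise_pdf_tmeas.
- exact: measurable_cst.
- by move=> s _; rewrite lee_fin noise_pdf_le.
Qed.

Lemma obs_ge0 z : 0 <= obs z.
Proof. by apply: fine_ge0; apply: kint_ge0 => // s; rewrite lee_fin noise_pdf_ge0. Qed.

Lemma obs_tmeas : tmeas n (fun z => (obs z)%:E).
Proof.
have mS : smeas n (fun (z : n.-tuple R) s => (noise_pdf s z)%:E).
  by apply/measurable_EFinP; apply: measurable_noise_pdf;
    [exact: measurable_snd|exact: measurable_fst].
have mS0 : smeas 0 (fun (z : n.-tuple R) p => kint k n p (fun s => (noise_pdf s z)%:E)).
  apply: (smeas_kint (fun _ => k0) (kmeas_ukmeas mk) _ mS) => // z s.
  by rewrite lee_fin noise_pdf_ge0.
rewrite /tmeas; under eq_fun do rewrite obsE ?size_tuple//.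
have := @smeas_comp R _ (n.-tuple R) _ (n.-tuple R) 0
  (fun z p => kint k n p (fun s => (noise_pdf s z)%:E)) id (fun=> [tuple]) mS0.
by apply => //; exact: measurable_id.
Qed.

Lemma obs_prob : kint (fun _ _ => 1) n [::] (fun z => (obs z)%:E) = 1%E.
Proof.
have c0 (p : seq R) (y : R) : 0 <= (1 : R) by [].
have mc : @kmeas R (fun _ _ => 1) by move=> m; exact: measurable_cst.
transitivity (kint (fun _ _ => 1) n [::]
    (fun z => kint k n [::] (fun s => (noise_pdf s z)%:E))).
  by apply: (@eq_kint _ _ n) => // z sz; exact: obsE.
rewrite (@kint_exchange _ _ _ n n n n (fun z s => (noise_pdf s z)%:E))//; last 2 first.
- by move=> z s; rewrite lee_fin noise_pdf_ge0.
- by apply/measurable_EFinP; apply: measurable_noise_pdf;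
    [exact: measurable_snd|exact: measurable_fst].
rewrite -[RHS](kint_cst k0 mk k1 n [::] lee01); apply: (@eq_kint _ _ n) => // s ss.
(* For fixed [s] the noise density is the likelihood ratio of [k'] relative to the constant kernel
   1, so [kint_lr] shows that its integral is 1. *)
pose k' (p : seq R) y := normal_pdf (nth 0 s (size p)) sd y.
have k'0 p y : 0 <= k' p y by exact: normal_pdf_ge0.
have mk' : kmeas k'.
  move=> m; rewrite /k'; under eq_fun do rewrite size_tuple.
  exact: (measurableT_comp (measurable_normal_pdf _ sd) measurable_snd).
rewrite -[RHS](@kint_cst _ k' k'0 mk' _ n [::] 1%E lee01); last first.
  by move=> p; exact: integral_normal_pdf.
rewrite -(@kint_lr _ (fun _ _ => 1) k' n)//; last exact: measurable_cst.
apply: (@eq_kint _ _ n) => // z sz; rewrite mule1 big_mkord; congr EFin.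
apply: eq_bigr => i _; rewrite /k' divr1 size_take_min sz.
by rewrite (minn_idPl (ltnW (ltn_ord i))).
Qed.

End observation.

(** * The wiretapper's view of the key *)

Section first_slot.
Context {R : realType}.
Notation mu := (@lebesgue_measure R).
Variables (v1 v2 B : R) (W : finType) (K : R -> W).
Notation sd1 := (Num.sqrt v1).
Notation sd2 := (Num.sqrt v2).
Hypotheses (v1_gt0 : 0 < v1) (v2_gt0 : 0 < v2).
Hypothesis mK : forall w, measurable [set y | K y = w].
Hypothesis key_le : forall k,
  (\int[mu]_y ((normal_pdf 0 sd1 y)%:E * ((K y == k)%:R)%:E) <= B%:E)%E.

Let sd1_gt0 : 0 < sd1. Proof. by rewrite sqrtr_gt0. Qed.
Let sd2_gt0 : 0 < sd2. Proof. by rewrite sqrtr_gt0. Qed.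

Let F (k : W) (z y : R) : R := normal_pdf y sd2 z * (K y == k)%:R.

Let F0 k z y : 0 <= F k z y.
Proof. by rewrite mulr_ge0 ?normal_pdf_ge0. Qed.

Let mkey k : measurable_fun setT (fun y => (K y == k)%:R : R).
Proof.
rewrite (_ : (fun _ => _) = \1_[set y | K y = k]); first exact: measurable_indic.
apply/funext => y; rewrite indicE; case: eqP => h; first by rewrite mem_set.
by rewrite memNset.
Qed.

Let mpdf (z : R) : measurable_fun setT (fun y => normal_pdf y sd2 z).
Proof.
under eq_fun do rewrite normal_pdf_center//.
by apply: (measurableT_comp (measurable_normal_pdf 0 sd2)); exact: measurable_funB.
Qed.

Let mF k z : measurable_fun setT (F k z).
Proof. by apply: measurable_funM; [exact: mpdf|exact: mkey]. Qed.

Lemma measurable_slot0 k z : measurable_fun setT (fun y =>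
  ((normal_pdf 0 sd1 y)%:E * (normal_pdf y sd2 z * (K y == k)%:R)%:E)%E).
Proof. by apply: measurable_normal_pdfM; apply/measurable_EFinP; exact: mF. Qed.

(** Joint density of the first observation at [z] and the event that the key is [k]. *)
Definition slot0 (k : W) (z : R) : R :=
  fine (\int[mu]_y ((normal_pdf 0 sd1 y)%:E * (F k z y)%:E))%E.

Let int_ge0 (G : R -> R) : (forall y, 0 <= G y) ->
  (0 <= \int[mu]_y ((normal_pdf 0 sd1 y)%:E * (G y)%:E))%E.
Proof.
by move=> G0; apply: integral_ge0 => y _; rewrite -EFinM lee_fin mulr_ge0 ?normal_pdf_ge0.
Qed.

Let int_le k z : (\int[mu]_y ((normal_pdf 0 sd1 y)%:E * (F k z y)%:E) <=
  (normal_peak sd2 * B)%:E)%E.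
Proof.
apply: (@le_trans _ _ (\int[mu]_y ((normal_peak sd2)%:E *
    ((normal_pdf 0 sd1 y)%:E * ((K y == k)%:R)%:E)))%E).
  apply: ge0_le_integral => //.
  - by move=> y _; rewrite -EFinM lee_fin mulr_ge0 ?normal_pdf_ge0.
  - by apply: measurable_normal_pdfM; apply/measurable_EFinP; exact: mF.
  - by apply: measurable_funeM; apply: measurable_normal_pdfM; apply/measurable_EFinP; exact: mkey.
  - move=> y _; rewrite -!EFinM lee_fin mulrCA; apply: ler_wpM2r.
      by rewrite mulr_ge0 ?normal_pdf_ge0.
    by rewrite normal_pdf_ub// gt_eqF.
rewrite ge0_integralZl//.
- by rewrite EFinM; apply: lee_wpmul2l => //; rewrite lee_fin normal_peak_ge0.
- by apply: measurable_normal_pdfM; apply/measurable_EFinP; exact: mkey.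
- by move=> y _; rewrite -EFinM lee_fin mulr_ge0 ?normal_pdf_ge0.
- by rewrite lee_fin normal_peak_ge0.
Qed.

Lemma slot0_ge0 k z : 0 <= slot0 k z.
Proof. by apply: fine_ge0; exact: int_ge0. Qed.

Lemma slot0E k z : (slot0 k z)%:E =
  (\int[mu]_y ((normal_pdf 0 sd1 y)%:E * (normal_pdf y sd2 z * (K y == k)%:R)%:E))%E.
Proof.
rewrite /slot0 fineK// ge0_fin_numE; last exact: int_ge0.
by apply: le_lt_trans (int_le k z) _; exact: ltry.
Qed.

(** The source of secrecy: the wiretapper's noise density never exceeds its peak, so no observation
    can favor a key by more than a constant factor over its prior bound [B]. *)
Lemma slot0_le k z : slot0 k z <= normal_peak sd2 * B.
Proof. by rewrite -lee_fin slot0E; exact: int_le. Qed.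

Definition slot0_sum (z : R) : R := \sum_k slot0 k z.

Lemma slot0_sumE z : (slot0_sum z)%:E =
  (\int[mu]_y ((normal_pdf 0 sd1 y)%:E * (normal_pdf y sd2 z)%:E))%E.
Proof.
rewrite /slot0_sum -sumEFin; under eq_bigr do rewrite slot0E.
rewrite -ge0_integral_sum//.
- apply: eq_integral => y _; rewrite -ge0_sume_distrr; last first.
    by move=> k _; rewrite lee_fin F0.
  congr (_ * _)%E; rewrite sumEFin -mulr_sumr (bigD1 (K y))//= eqxx big1 ?addr0 ?mulr1//.
  by move=> k kK; rewrite eq_sym (negbTE kK).
- by move=> k; apply: measurable_normal_pdfM; apply/measurable_EFinP; exact: mF.
- by move=> k y _; rewrite -EFinM lee_fin mulr_ge0 ?normal_pdf_ge0// F0.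
Qed.

(** Only first outputs in [[0, 1]] are kept; there [(z - y) ^+ 2 <= 2 * (z ^+ 2 + 1)], so the
    logarithm of the density falls at most quadratically, which the second moment controls. *)
Lemma slot0_sum_ge z :
  normal_pdf 0 sd1 1 * (normal_peak sd2 * expR (- ((z ^+ 2 + 1) / v2))) <= slot0_sum z.
Proof.
set g := (X in X <= _).
have g0 : 0 <= g.
  by rewrite !mulr_ge0 ?normal_pdf_ge0 ?normal_peak_ge0 ?expR_ge0.
rewrite -lee_fin slot0_sumE.
pose I := `[0, 1]%classic : set R.
have mI : measurable I by exact: measurable_itv.
apply: (@le_trans _ _ (\int[mu]_y (g%:E * (\1_I y)%:E))%E).
  rewrite ge0_integralZl//; last first.
    by apply/measurable_EFinP; exact: measurable_indic.
  rewrite integral_indic//= setIT lebesgue_measure_itv/= lte_fin ltr01.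
  by rewrite sube0 mule1.
apply: ge0_le_integral => //.
- by move=> y _; rewrite -EFinM lee_fin mulr_ge0// indicE.
- by apply: measurable_funeM; apply/measurable_EFinP; exact: measurable_indic.
- by apply: measurable_normal_pdfM; apply/measurable_EFinP; exact: mpdf.
- move=> y _; rewrite -!EFinM lee_fin indicE.
  case: (boolP (y \in I)) => yI; last by rewrite mulr0 mulr_ge0 ?normal_pdf_ge0.
  rewrite mulr1; move: yI; rewrite inE /I/= in_itv/= => /andP[y0 y1].
  apply: ler_pM; rewrite ?normal_pdf_ge0 ?mulr_ge0 ?normal_peak_ge0 ?expR_ge0//.
    rewrite !normal_pdfE ?gt_eqF// ler_wpM2l ?normal_peak_ge0// /normal_fun ler_expR.
    rewrite !subr0 !mulNr lerN2 ler_wpM2r ?invr_ge0 ?mulrn_wge0 ?sqr_ge0//.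
    by rewrite ler_pXn2r// nnegrE.
  rewrite normal_pdfE ?gt_eqF// ler_wpM2l ?normal_peak_ge0// /normal_fun ler_expR.
  rewrite (sqr_sqrtr (ltW v2_gt0)) mulNr lerN2.
  have -> : (z - y) ^+ 2 / (v2 *+ 2) = (z - y) ^+ 2 / 2 / v2 by field; rewrite gt_eqF.
  rewrite ler_pM2r ?invr_gt0//.
  have := sqr_ge0 (z + y); have : y ^+ 2 <= 1 by rewrite expr_le1.
  rewrite ler_pdivrMr// => h1 h2; rewrite -subr_ge0.
  rewrite (_ : _ - _ = (z + y) ^+ 2 + (1 - y ^+ 2) * 2)/=; last by ring.
  by rewrite addr_ge0// mulr_ge0// subr_ge0.
Qed.

Let G (a c : R) (q : R * R) : \bar R :=
  ((normal_pdf 0 sd1 q.2)%:E * ((normal_pdf q.2 sd2 q.1)%:E * (a + (0 + Num.sqrt c * q.1) ^+ 2)%:E))%E.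

Let mG a c : measurable_fun setT (G a c).
Proof.
apply: emeasurable_funM.
  apply/measurable_EFinP.
  exact: (measurableT_comp (measurable_normal_pdf 0 sd1) measurable_snd).
apply: emeasurable_funM.
  apply/measurable_EFinP; under eq_fun do rewrite normal_pdf_center//.
  apply: (measurableT_comp (measurable_normal_pdf 0 sd2)).
  by apply: measurable_funB; [exact: measurable_fst|exact: measurable_snd].
apply/measurable_EFinP; apply: measurable_funD => //; apply: measurable_funX.
by apply: measurable_funD => //; apply: measurable_funM => //; exact: measurable_fst.
Qed.

Let G0 a c : 0 <= a -> forall q, (0 <= G a c q)%E.
Proof.
by move=> a0 q; rewrite /G -!EFinM lee_fin !mulr_ge0 ?normal_pdf_ge0// addr_ge0 ?sqr_ge0.
Qed.

Let intG a c z : 0 <= a -> 0 <= c ->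
  (\int[mu]_y G a c (z, y) = (slot0_sum z * (a + c * z ^+ 2))%:E)%E.
Proof.
move=> a0 c0; rewrite EFinM slot0_sumE muleC -ge0_integralZl//.
- apply: eq_integral => y _; rewrite /G/= add0r exprMn sqr_sqrtr//.
  by rewrite -!EFinM; congr EFin; ring.
- by apply: measurable_normal_pdfM; apply/measurable_EFinP; exact: mpdf.
- by move=> y _; rewrite -EFinM lee_fin mulr_ge0 ?normal_pdf_ge0.
- by rewrite lee_fin addr_ge0// mulr_ge0// sqr_ge0.
Qed.

Lemma measurable_slot0_sum : measurable_fun setT slot0_sum.
Proof.
have := @measurable_fun_fubini_tonelli_F _ _ _ _ R mu _ (@mG 1 0) (G0 0 ler01).
rewrite /fubini_F; under eq_fun do rewrite intG// mul0r addr0 mulr1.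
by move/measurable_EFinP.
Qed.

Lemma slot0_sum_moment a c : 0 <= a -> 0 <= c ->
  (\int[mu]_z (slot0_sum z * (a + c * z ^+ 2))%:E = (a + c * (v1 + v2))%:E)%E.
Proof.
move=> a0 c0; under eq_integral do rewrite -intG//.
have := @fubini_tonelli _ _ _ _ R mu mu _ (@mG a c) (G0 c a0); rewrite /= => ->.
transitivity (\int[mu]_y ((normal_pdf 0 sd1 y)%:E *
    ((a + c * v2) + (0 + Num.sqrt c * y) ^+ 2)%:E))%E.
  apply: eq_integral => y _.
  rewrite /G/= ge0_integralZl//; last 3 first.
  - apply: emeasurable_funM; apply/measurable_EFinP; first exact: measurable_normal_pdf.
    apply: measurable_funD => //; apply: measurable_funX.
    by apply: measurable_funD => //; exact: measurable_funM.
  - by move=> z _; rewrite -EFinM lee_fin mulr_ge0 ?normal_pdf_ge0// addr_ge0 ?sqr_ge0.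
  - by rewrite lee_fin normal_pdf_ge0.
  under eq_integral do rewrite normal_pdf_center// -/(chan (fun=> y) sd2 [::] _).
  rewrite chan_quadratic// !sqr_sqrtr ?(ltW v2_gt0)//.
  by congr (_ * _%:E)%E; ring.
have b0 : 0 <= a + c * v2 by apply: addr_ge0 => //; apply: mulr_ge0 => //; exact: ltW.
apply: (etrans (integral_normal_pdf_quadratic sd1_gt0 0 (Num.sqrt c) b0)).
by rewrite !sqr_sqrtr ?(ltW v1_gt0)//; congr EFin; ring.
Qed.

End first_slot.

(** * Equivocation of the keyed code *)

Section keyed_entropy.
Context {R : realType}.
Notation mu := (@lebesgue_measure R).
Variables (v1 v2 C : R) (n m1 m2 : nat).
Notation W := ('I_m1.+1 * 'I_m2.+1)%type.
Notation sd1 := (Num.sqrt v1).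
Notation sd2 := (Num.sqrt v2).
Variables (X1 : 'I_m1.+1 -> seq R -> R) (X2 : 'I_m2.+1 -> seq R -> R) (D : seq R -> W).
Variable K : R -> W.
Hypotheses (v1_gt0 : 0 < v1) (v2_gt0 : 0 < v2) (C_gt0 : 0 < C).
Hypothesis mX1 : forall w, rmeas (X1 w).
Hypothesis mX2 : forall w, rmeas (X2 w).
Hypothesis mK : forall w, measurable [set y | K y = w].
Notation M := ((m1.+1 * m2.+1)%:R : R).
Hypothesis key_le : forall k,
  (\int[mu]_y ((normal_pdf 0 sd1 y)%:E * ((K y == k)%:R)%:E) <= (C / M)%:E)%E.

Let sd1_gt0 : 0 < sd1. Proof. by rewrite sqrtr_gt0. Qed.
Let sd2_gt0 : 0 < sd2. Proof. by rewrite sqrtr_gt0. Qed.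
Let M_gt0 : 0 < M. Proof. by rewrite ltr0n muln_gt0. Qed.

Notation code := (keyed_code X1 X2 D K).
Let k0 w p y : 0 <= inner v1 X1 X2 w p y. Proof. exact: chan_ge0. Qed.
Let mk w : kmeas (inner v1 X1 X2 w).
Proof. by apply: kmeas_chan => i; apply: measurable_funD; [exact: mX1|exact: mX2]. Qed.
Let k1 w p : (\int[mu]_y (inner v1 X1 X2 w p y)%:E = 1)%E. Proof. exact: chan_prob. Qed.

Let f w z := obs (inner v1 X1 X2 w) n sd2 z.
Let pi k z0 := slot0 v1 v2 K k z0.
Let ga z0 := slot0_sum v1 v2 K z0.
Let fbar z := M^-1 * \sum_w f w z.

Let f_ge0 w z : 0 <= f w z. Proof. exact: obs_ge0. Qed.
Let pi_ge0 k z0 : 0 <= pi k z0. Proof. exact: slot0_ge0. Qed.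
Let f_tmeas w : tmeas n (fun z => (f w z)%:E).
Proof. exact: obs_tmeas. Qed.

(** Given the key [k], the later observations are those of the inner code for the message [w + k];
    the first output influences them through [k] only. *)
Lemma zdens_cond_keyed w z0 (z : n.-tuple R) :
  zdens_cond code v1 v2 w.1 w.2 (cons_tuple z0 z) = \sum_k pi k z0 * f (w + k) z.
Proof.
rewrite /zdens_cond.
pose H s := (\prod_(i < n.+1) normal_pdf (nth 0 s i) sd2 (tnth (cons_tuple z0 z) i))%:E.
have H0 s : (0 <= H s)%E by rewrite lee_fin prodr_ge0// => i _; exact: normal_pdf_ge0.
have mH : tmeas n.+1 H.
  apply/measurable_EFinP; apply: measurable_prod => i _.
  under eq_fun do rewrite normal_pdf_center//.
  apply: (measurableT_comp (measurable_normal_pdf 0 sd2)); apply: measurable_funB => //.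
  by apply: measurable_nth; exact: measurable_id.
rewrite (_ : cexp _ _ _ = (\sum_k pi k z0 * f (w + k) z)%:E)//.
apply: (etrans (@cexp_keyed R v1 n m1 m2 X1 X2 D K mX1 mX2 mK w H H0 mH)).
transitivity (\int[mu]_y \sum_(k : W) ((f (w + k)%R z)%:E *
    ((normal_pdf 0 sd1 y)%:E * (normal_pdf y sd2 z0 * (K y == k)%:R)%:E)))%E.
  apply: eq_integral => y _.
  have -> : kint (inner v1 X1 X2 (w + K y)) n [::] (fun s => H (y :: s)) =
      (normal_pdf y sd2 z0 * f (w + K y) z)%:E.
    rewrite EFinM obsE ?size_tuple// -(@kintZl _ _ (k0 _) (mk _) n) ?lee_fin ?normal_pdf_ge0//.
    - apply: (@eq_kint _ _ n) => // s _; rewrite /H big_ord_recl EFinM; congr (_ * _%:E)%E.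
      by apply: eq_bigr => i _; rewrite (tnth_nth 0).
    - by move=> s; rewrite lee_fin noise_pdf_ge0.
    - by apply: noise_pdf_tmeas => //; rewrite size_tuple.
  rewrite (bigD1 (K y))//= big1 => [|k kK].
    by rewrite adde0 eqxx mulr1 -!EFinM; congr EFin; ring.
  by rewrite eq_sym (negbTE kK) mulr0 !mule0.
rewrite ge0_integral_sum//.
- rewrite -sumEFin; apply: eq_bigr => k _; rewrite ge0_integralZl//.
  + by rewrite -(slot0E v2_gt0 mK key_le) muleC.
  + exact: measurable_slot0.
  + by move=> y _; rewrite -EFinM lee_fin !mulr_ge0 ?normal_pdf_ge0.
  + by rewrite lee_fin.
- by move=> k; apply: measurable_funeM; exact: measurable_slot0.
- by move=> k y _; rewrite -!EFinM lee_fin !mulr_ge0 ?normal_pdf_ge0.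
Qed.

Let sum_shift (g : W -> R) (k : W) : \sum_(w : W) g (w + k) = \sum_w g w.
Proof. by rewrite [RHS](reindex_inj (addIr k)). Qed.

(** Averaged over [w], the message [w + k] is uniform whatever [k] is, so the first observation
    becomes independent of the others. *)
Lemma zdens_keyed z0 (z : n.-tuple R) : zdens code v1 v2 (cons_tuple z0 z) = ga z0 * fbar z.
Proof.
rewrite /zdens /fbar mulrCA; congr (_ * _).
rewrite pair_big/=; under eq_bigr do rewrite -/(zdens_cond _ _ _ _ _ _) zdens_cond_keyed.
rewrite exchange_big/= /ga /slot0_sum mulr_suml; apply: eq_bigr => k _.
by rewrite -mulr_sumr (sum_shift (f^~ z)).
Qed.

Let phi : R := normal_pdf 0 sd1 1.
Let c2 : R := (v2 * ln 2)^-1.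
(** A lower bound, in bits, for the logarithm of the inverse posterior probability of a message
    pair; [c2] converts the exponent of [slot0_sum_ge] to base 2. *)
Let Q z0 : R := log2 (M * phi / C) - c2 * (z0 ^+ 2 + 1).

Let ln2_gt0 : 0 < ln 2 :> R. Proof. by rewrite ln_gt0// ltr1n. Qed.
Let phi_gt0 : 0 < phi. Proof. exact: normal_pdf_gt0. Qed.
Let c2_gt0 : 0 < c2. Proof. by rewrite invr_gt0 mulr_gt0. Qed.

Let cond_le w z0 (z : seq R) :
  \sum_k pi k z0 * f (w + k) z <= normal_peak sd2 * C * fbar z.
Proof.
have -> : fbar z = M^-1 * \sum_(k : W) f (w + k) z.
  congr (_ * _); under [RHS]eq_bigr do rewrite addrC.
  exact/esym/(sum_shift (fun w => f w z) w).
rewrite mulrA mulr_sumr.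
apply: ler_sum => k _; apply: ler_wpM2r => //.
rewrite -mulrA; exact: (slot0_le v2_gt0 mK key_le).
Qed.

(** In the quotient under the logarithm [fb] and the peak cancel, leaving [M * phi / C] times the
    exponential. For [p = 0] both sides are 0. *)
Let pointwise p fb g z0 : 0 <= p -> 0 <= fb -> p <= normal_peak sd2 * C * fb ->
  phi * (normal_peak sd2 * expR (- ((z0 ^+ 2 + 1) / v2))) <= g ->
  Q z0 * (M^-1 * p) <= M^-1 * p * log2 (g * fb / (M^-1 * p)).
Proof.
move=> p0 fb0 pfb gle; have [->|pN0] := eqVneq p 0; first by rewrite !(mulr0, mul0r).
have {}p0 : 0 < p by rewrite lt_neqAle eq_sym pN0.
have peak0 : 0 < normal_peak sd2 by rewrite normal_peak_gt0// gt_eqF.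
have {}fb0 : 0 < fb.
  rewrite lt_neqAle fb0 andbT eq_sym; apply/eqP => e.
  by move: pfb; rewrite e mulr0 leNgt p0.
have pw0 : 0 < M^-1 * p by rewrite mulr_gt0// invr_gt0.
rewrite mulrC ler_pM2l//.
set e := expR _ in gle; have e0 : 0 < e by exact: expR_gt0.
have mp0 : 0 < M * phi / C by apply: divr_gt0 => //; apply: mulr_gt0.
have -> : Q z0 = log2 (M * phi / C * e).
  rewrite /Q /log2 [ln (_ * e)]lnM ?posrE// /e expRK mulrDl mulNr; congr (_ - _).
  by rewrite /c2; field; rewrite !gt_eqF.
rewrite /log2 ler_pM2r ?invr_gt0// ler_ln ?posrE; last 2 first.
- by apply: mulr_gt0.
- apply: divr_gt0 => //; apply: mulr_gt0 => //; apply: lt_le_trans gle.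
  by rewrite !mulr_gt0.
rewrite ler_pdivlMr//; apply: (@le_trans _ _ (phi * (normal_peak sd2 * e) * fb)); last first.
  by rewrite ler_pM2r.
apply: (@le_trans _ _ (M * phi / C * e * (M^-1 * (normal_peak sd2 * C * fb)))).
  rewrite ler_pM2l ?ler_pM2l ?invr_gt0//; by apply: mulr_gt0.
by rewrite le_eqVlt; apply/orP; left; apply/eqP; field; rewrite !gt_eqF.
Qed.

Let inner_integral w z0 :
  iter_int (fun=> 1) (fun z : n.-tuple R =>
    (Q z0 * (M^-1 * \sum_k pi k z0 * f (w + k) z))%:E) =
  (M^-1 * (Q z0 * ga z0))%:E.
Proof.
have mc : @kmeas R (fun _ _ => 1) by move=> m; exact: measurable_cst.
have c0 (p : seq R) (y : R) : 0 <= (1 : R) by [].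
have F0 s : (0 <= (\sum_k pi k z0 * f (w + k) s)%:E)%E.
  by rewrite lee_fin sumr_ge0// => k _; rewrite mulr_ge0.
have mF : tmeas n (fun s => (\sum_k pi k z0 * f (w + k) s)%:E).
  apply/measurable_EFinP; apply: measurable_sum => k; apply: measurable_funM => //.
  by apply/measurable_EFinP; exact: f_tmeas.
rewrite (iter_int_kint _ n (fun z : seq R =>
  (Q z0 * (M^-1 * \sum_k pi k z0 * f (w + k) z))%:E)).
transitivity (kint (fun _ _ => 1%R) n [::] (fun s =>
    (Q z0 * M^-1)%:E * (\sum_k pi k z0 * f (w + k) s)%:E))%E.
  by apply: (@eq_kint _ _ n) => // s _; rewrite -EFinM mulrA.
rewrite (@kint_scale _ _ n)//.
have -> : kint (fun _ _ => 1%R) n [::] (fun s => (\sum_k pi k z0 * f (w + k) s)%:E) = (ga z0)%:E.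
  transitivity (kint (fun _ _ => 1%R) n [::] (fun s => \sum_k ((pi k z0)%:E * (f (w + k)%R s)%:E)))%E.
    by apply: (@eq_kint _ _ n) => // s _; rewrite -sumEFin.
  rewrite (@kint_sum _ _ c0 mc _ _ n)//; last 2 first.
  - by move=> k s; rewrite -EFinM lee_fin mulr_ge0.
  - by move=> k; apply: measurable_funeM; exact: f_tmeas.
  rewrite /ga /slot0_sum -sumEFin; apply: eq_bigr => k _.
  rewrite (@kintZl _ _ c0 mc n) ?lee_fin//; last first.
    by move=> s; rewrite lee_fin.
  by rewrite obs_prob// mule1.
by rewrite -EFinM; congr EFin; ring.
Qed.

Let outer_integral :
  (\int[mu]_z (M^-1 * (Q z * ga z))%:E =
   (M^-1 * (log2 (M * phi / C) - c2 * (1 + v1 + v2)))%:E)%E.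
Proof.
set A := log2 _.
have mga : measurable_fun setT ga by exact: measurable_slot0_sum.
have ga0 z : 0 <= ga z by apply: sumr_ge0 => k _; exact: slot0_ge0.
have Mn : `|M| = M by rewrite ger0_norm// ltW.
(* [Q] may change sign, so it is split into two integrable parts; the term [0 * z ^+ 2] fits
   [slot0_sum_moment]. *)
pose f1 z := M^-1 * A * (ga z * (1 + 0 * z ^+ 2)).
pose f2 z := ga z * (M^-1 * c2 + M^-1 * c2 * z ^+ 2).
have Mc0 : 0 <= M^-1 * c2 by rewrite ltW// mulr_gt0// invr_gt0.
have I (a c : R) : 0 <= a -> 0 <= c ->
    mu.-integrable setT (EFin \o (fun z => ga z * (a + c * z ^+ 2))).
  move=> a0 c0; apply/integrableP; split.
    apply/measurable_EFinP; apply: measurable_funM => //.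
    apply: measurable_funD => //; apply: measurable_funM => //; exact: measurable_funX.
  under eq_integral => z _.
    rewrite /= ger0_norm; last by rewrite mulr_ge0// addr_ge0// mulr_ge0// sqr_ge0.
    over.
  by rewrite (slot0_sum_moment v1_gt0 v2_gt0 mK key_le)// ltry.
transitivity (\int[mu]_z ((f1 z)%:E - (f2 z)%:E))%E.
  apply: eq_integral => z _; rewrite -EFinB; congr EFin.
  by rewrite /f1 /f2 /Q -/A; ring.
rewrite integralB_EFin//; last 2 first.
- have h := integrableZl measurableT (M^-1 * A) (I 1 0 ler01 (lexx 0)); exact: h.
- exact: I.
rewrite /f1 /f2; under eq_integral do rewrite EFinM.
rewrite integralZl//; last exact: I.
rewrite !(slot0_sum_moment v1_gt0 v2_gt0 mK key_le)//.
by rewrite -EFinM -EFinB; congr EFin; ring.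
Qed.

Lemma keyed_entropy :
  ((log2 (M * phi / C) - c2 * (1 + v1 + v2))%:E <= cond_entropy n.+1 code v1 v2)%E.
Proof.
rewrite /cond_entropy pair_big /=.
set B := _ - _.
have -> : B%:E = (\sum_(w : W) (M^-1 * B)%:E)%E.
  by rewrite sumEFin sumr_const card_prod !card_ord -[_ *+ _]mulr_natl mulVKf// gt_eqF.
apply: lee_sum => w _; rewrite -outer_integral.
apply: le_integralT => z0; rewrite mul1e -(inner_integral w).
apply: le_iter_int => // z; rewrite lee_fin.
rewrite -/(zdens_cond _ _ _ _ _ _) zdens_cond_keyed zdens_keyed.
apply: pointwise.
- by apply: sumr_ge0 => k _; rewrite mulr_ge0.
- by rewrite mulr_ge0 ?sumr_ge0// invr_ge0 ltW.
- exact: cond_le.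
- exact: (slot0_sum_ge v1_gt0 v2_gt0 mK key_le).
Qed.

End keyed_entropy.

(** * Rates *)

Section achievability.
Context {R : realType}.

Lemma secure_code (v1 v2 P1 P2 err : R) n M1 M2 : 0 < v1 -> 0 < v2 -> 0 <= P1 -> 0 <= P2 ->
  0 <= err -> (0 < M1)%N -> (0 < M2)%N -> det_scheme v1 P1 P2 n M1 M2 err ->
  exists c : gmac_code (R := R) M1 M2, [/\ code_measurable n.+1 c,
    (avg_power1 n.+1 c v1 <= P1%:E)%E, (avg_power2 n.+1 c v1 <= P2%:E)%E,
    ((log2 ((M1 * M2)%:R * normal_pdf 0 (Num.sqrt v1) 1 / key_const v1 (M1 * M2)) -
      (v2 * ln 2)^-1 * (1 + v1 + v2))%:E <= cond_entropy n.+1 c v1 v2)%E &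
    (error_prob n.+1 c v1 <= err%:E)%E].
Proof.
case: M1 => // m1; case: M2 => // m2 v10 v20 P10 P20 err0 _ _.
move=> [X1 [X2 [D [mX1 mX2 mD pow dec_err]]]].
have [K [mK key_le]] := @exists_key R v1 ('I_m1.+1 * 'I_m2.+1)%type 0 v10.
have cM : #|{: 'I_m1.+1 * 'I_m2.+1}| = (m1.+1 * m2.+1)%N by rewrite card_prod !card_ord.
rewrite cM in key_le.
have C0 : 0 < key_const v1 (m1.+1 * m2.+1).
  rewrite /key_const ltr_wpDl// !mulr_ge0 ?normal_peak_ge0// /key_radius.
  by rewrite addr_ge0 ?sqrtr_ge0.
exists (keyed_code X1 X2 D K); split.
- exact: (@keyed_code_measurable R).
- by apply: (@keyed_power1 R) => // w i; have [] := pow w.1 w.2 i.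
- by apply: (@keyed_power2 R) => // w i; have [] := pow w.1 w.2 i.
- exact: keyed_entropy.
- by apply: (@keyed_error R) => // -[w1 w2]; exact: dec_err.
Qed.

(* Just enough grid points for the rate rho, with the spacing 2 n required for
   an error probability of order 1 / n^2. *)
Definition block_size (c rho : R) (n : nat) : nat :=
  (Num.truncn (c * expR (rho * n%:R) / (2 * n%:R))).+1.

Lemma ln_le_sqrt (x : R) : 1 <= x -> ln x <= 2 * Num.sqrt x.
Proof.
move=> x1; have x0 : 0 < x by apply: lt_le_trans x1.
have s0 : 0 < Num.sqrt x by rewrite sqrtr_gt0.
rewrite -[in leLHS](sqr_sqrtr (ltW x0)) lnXn// -[leLHS]mulr_natl ler_pM2l//.
exact: ltW (ln_sublinear s0).
Qed.

Section block_size.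
Variables (c rho : R) (n : nat).
Hypotheses (c_gt0 : 0 < c) (rho_ge0 : 0 <= rho) (n_gt0 : (0 < n)%N).
Let nR : 1 <= n%:R :> R. Proof. by rewrite ler1n. Qed.
Let x := c * expR (rho * n%:R) / (2 * n%:R).
Let n2_gt0 : 0 < 2 * n%:R :> R. Proof. by rewrite mulr_gt0// (lt_le_trans _ nR). Qed.
Let x_gt0 : 0 < x. Proof. by rewrite /x !mulr_gt0 ?invr_gt0 ?expR_gt0. Qed.

Lemma block_size_le : (block_size c rho n).-1%:R * (2 * n%:R) <= c * expR rho ^+ n.
Proof.
rewrite -ler_pdivlMr// -expRM_natr.
by have /andP[] := truncn_itv (ltW x_gt0).
Qed.

(** Rounding and the factor [2 * n] cost a logarithm, bounded by [Num.sqrt n%:R] so that all losses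
    have one form. *)
Lemma ln_block_size :
  `|ln (block_size c rho n)%:R - rho * n%:R| <= (`|ln c| + c + 3) * Num.sqrt n%:R.
Proof.
have s1 : 1 <= Num.sqrt n%:R :> R by rewrite -[leLHS]sqrtr1; exact: ler_wsqrtr.
have /andP[t1 t2] := truncn_itv (ltW x_gt0).
have c0 : 0 <= c by exact: ltW.
have e0 := expR_gt0 (rho * n%:R).
have e1 : 1 <= expR (rho * n%:R) by rewrite -expR0 ler_expR mulr_ge0.
have lo : ln c + rho * n%:R - ln (2 * n%:R) <= ln (block_size c rho n)%:R.
  have <- : ln x = ln c + rho * n%:R - ln (2 * n%:R).
    by rewrite /x ln_div ?posrE ?[0 < _ * expR _]mulr_gt0// lnM ?posrE// expRK.
  by rewrite ler_ln ?posrE ?ltr0n//; exact: ltW.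
have hi : ln (block_size c rho n)%:R <= c + rho * n%:R.
  apply: (@le_trans _ _ (ln ((1 + c) * expR (rho * n%:R)))).
    have h : (block_size c rho n)%:R <= (1 + c) * expR (rho * n%:R).
      have -> : (block_size c rho n)%:R = (Num.truncn x)%:R + 1 :> R by rewrite natr1.
      rewrite mulrDl mul1r addrC; apply: lerD => //; apply: (le_trans t1).
      rewrite /x ler_pdivrMr//; apply: ler_peMr; first by rewrite mulr_ge0// expR_ge0.
      by have n1 := nR; lra.
    by rewrite ler_ln ?posrE ?ltr0n// mulr_gt0// ltr_wpDr.
  rewrite lnM ?posrE ?ltr_wpDr// expRK lerD2r.
  by have := @le_ln1Dx R c; rewrite (lt_le_trans _ c0)//; apply.
have l2 : ln (2 * n%:R) <= 1 + 2 * Num.sqrt n%:R :> R.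
  rewrite lnM ?posrE//; last by rewrite (lt_le_trans _ nR).
  apply: lerD; last exact: ln_le_sqrt.
  by have := @le_ln1Dx R 1; apply; lra.
have a1 : `|ln c| <= `|ln c| * Num.sqrt n%:R by rewrite ler_peMr.
have a2 : c <= c * Num.sqrt n%:R by rewrite ler_peMr.
have a3 : - `|ln c| <= ln c by rewrite lerNl ler_normr lexx orbT.
have a4 := normr_ge0 (ln c).
by rewrite ler_norml; apply/andP; split; lra.
Qed.
End block_size.
End achievability.

Section det_rates.
Context {R : realType}.

(** Rates in nats. [A] and [E] do not depend on [n], and the square root absorbs the sublinear
    losses. *)
Definition det_rates (v P1 P2 rho1 rho2 : R) : Prop :=
  exists A E : R, [/\ 0 <= A, 0 <= E & forall n, (0 < n)%N ->
    exists M1 M2, [/\ (0 < M1)%N /\ (0 < M2)%N, det_scheme v P1 P2 n M1 M2 (E / n%:R ^+ 2),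
      `|ln M1%:R - rho1 * n%:R| <= A * Num.sqrt n%:R &
      `|ln M2%:R - rho2 * n%:R| <= A * Num.sqrt n%:R]].

Lemma det_scheme_swap (v P1 P2 err : R) n M1 M2 :
  det_scheme v P1 P2 n M1 M2 err -> det_scheme v P2 P1 n M2 M1 err.
Proof.
move=> [X1 [X2 [D [mX1 mX2 mD pow dec_err]]]].
have chanC w1 w2 : (fun p : seq R => X2 w2 p + X1 w1 p) = (fun p => X1 w1 p + X2 w2 p).
  by apply/funext => p; rewrite addrC.
exists X2, X1, (fun p => ((D p).2, (D p).1)); split => //.
- move=> [w2 w1]; rewrite (_ : [set t | _] = [set t : n.-tuple R | D t = (w1, w2)]) //.
  by apply/seteqP; split => t /=; case: (D t) => a b /= [-> ->].
- by move=> w2 w1 i; rewrite chanC; have [] := pow w1 w2 i.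
- move=> w2 w1; rewrite chanC; apply: le_trans (dec_err w1 w2).
  rewrite le_eqVlt; apply/orP; left; apply/eqP; congr kint; apply/funext => p.
  by case: (D p) => a b; rewrite !xpair_eqE /= andbC.
Qed.

Lemma det_rates_swap (v P1 P2 rho1 rho2 : R) :
  det_rates v P1 P2 rho1 rho2 -> det_rates v P2 P1 rho2 rho1.
Proof.
move=> [A [E [A0 E0 H]]]; exists A, E; split=> // n n0.
have [M1 [M2 [[? ?] ds h1 h2]]] := H n n0; exists M2, M1; split=> //.
exact: det_scheme_swap.
Qed.

Lemma linear_scheme_rates (v P1 P2 r1 r2 la1 la2 la3 c1 c2 c3 b1 b2 b3 rho1 rho2 : R) Q :
  0 < v -> linear_scheme v P1 P2 r1 r2 la1 la2 la3 c1 c2 c3 b1 b2 b3 Q ->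
  0 <= rho1 -> 2 * rho1 <= ln r1 -> 0 <= rho2 -> 2 * rho2 <= ln r2 ->
  det_rates v P1 P2 rho1 rho2.
Proof.
move=> v0 LS rho10 rho1r rho20 rho2r.
have [[l1 l2 l3] [r1E r2E] _ _ [[ka ka0 Qpd] _]] := LS.
have la0 (la : R) : 1 <= `|la| -> 0 < `|la| by move=> h; apply: lt_le_trans h.
have lnr1 : ln r1 = 2 * (ln `|la1| + ln `|la2|).
  rewrite -r1E -[(_ * _) ^+ 2]real_normK ?num_real// normrM lnXn ?mulr_gt0 ?la0//.
  by rewrite lnM ?posrE ?la0// mulr_natl.
have lnr2 : ln r2 = 2 * ln `|la3|.
  by rewrite -r2E -[la3 ^+ 2]real_normK ?num_real// lnXn ?la0// mulr_natl.
have ln1 := ln_ge0 l1; have ln2 := ln_ge0 l2.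
(* The first state carries as much of the rate as it can and the second the rest; [lnr1] guarantees
   that this fits. *)
pose rhoa := Num.min rho1 (ln `|la1|); pose rhob := rho1 - rhoa.
have rhoa0 : 0 <= rhoa by rewrite le_min rho10.
have rhoal : rhoa <= ln `|la1| by rewrite ge_min lexx orbT.
have rhob0 : 0 <= rhob by rewrite subr_ge0 ge_min lexx.
have rhobl : rhob <= ln `|la2|.
  by rewrite /rhob /rhoa /Num.min; case: ifP => _; lra.
have rho2l : rho2 <= ln `|la3| by lra.
pose c0 : R := Num.sqrt (ka / 3).
have c00 : 0 < c0 by rewrite sqrtr_gt0 divr_gt0.
have Q0 x y z : 0 <= Q x y z.
  by apply: le_trans (Qpd x y z); rewrite mulr_ge0 ?addr_ge0 ?sqr_ge0// ltW.
exists (2 * (`|ln c0| + c0 + 3)), (Q 1 0 0 + Q 0 1 0 + Q 0 0 1); split.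
- by rewrite mulr_ge0// !addr_ge0// ltW.
- by rewrite !addr_ge0.
move=> n n0; have nR : 0 < n%:R :> R by rewrite ltr0n.
have bs (la rho : R) : 1 <= `|la| -> 0 <= rho -> rho <= ln `|la| ->
    (block_size c0 rho n).-1%:R * (2 * n%:R) <= c0 * `|la| ^+ n.
  move=> h rho0 rhol; apply: (le_trans (@block_size_le R c0 rho n c00 n0)).
  rewrite ler_pM2l//; apply: lerXn2r; rewrite ?nnegrE ?expR_ge0//.
  have <- : expR (ln `|la|) = `|la| by apply: lnK; rewrite posrE; exact: la0.
  by rewrite ler_expR.
have lb rho : 0 <= rho -> `|ln (block_size c0 rho n)%:R - rho * n%:R| <=
    (`|ln c0| + c0 + 3) * Num.sqrt n%:R by move=> rho0; exact: ln_block_size.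
exists (block_size c0 rhoa n * block_size c0 rhob n)%N, (block_size c0 rho2 n); split => //.
- exact: (linear_code_det v0 LS _ _ _ nR ka0 Qpd (bs _ _ l1 rhoa0 rhoal)
    (bs _ _ l2 rhob0 rhobl) (bs _ _ l3 rho20 rho2l)).
- rewrite natrM lnM ?posrE ?ltr0n//.
  rewrite (_ : _ - _ = (ln (block_size c0 rhoa n)%:R - rhoa * n%:R) +
     (ln (block_size c0 rhob n)%:R - rhob * n%:R)); last by rewrite /rhob; ring.
  apply: (le_trans (ler_normD _ _)).
  by have := lb _ rhoa0; have := lb _ rhob0; lra.
- apply: (le_trans (lb _ rho20)); apply: ler_wpM2r; first exact: sqrtr_ge0.
  by rewrite ler_peMl ?ler1n// !addr_ge0// ltW.
Qed.

End det_rates.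

(** * Choice of the block length *)

Section asymptotics.
Context {R : realType}.

(** The key constant grows like the square root of [ln m], hence at most linearly in [s], which will
    be the square root of the block length; its logarithm is bounded crudely by a multiple of
    [s]. *)
Lemma ln_key_const (v K s : R) (m : nat) : 0 < v -> 0 <= K -> 1 <= s ->
  ln m%:R <= K * s ^+ 2 ->
  ln (key_const v m) <= (2 * (Num.sqrt (4 * v * K) + 1) * normal_peak (Num.sqrt v) + 3) * s.
Proof.
move=> v0 K0 s1 lm; have s0 : 0 < s by apply: lt_le_trans s1.
have vK0 : 0 <= 4 * v * K by rewrite !mulr_ge0// ltW.
set pk := normal_peak _; have pk0 : 0 <= pk by exact: normal_peak_ge0.
set q := Num.sqrt (4 * v * K); have q0 : 0 <= q by exact: sqrtr_ge0.
pose B := 2 * (q + 1) * pk + 2.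
have B2 : 2 <= B by rewrite lerDr !mulr_ge0 ?addr_ge0.
have rad : key_radius v m <= (q + 1) * s.
  rewrite /key_radius [leRHS]mulrDl mul1r; apply: lerD => //.
  rewrite -[leRHS]ger0_norm ?mulr_ge0 ?(ltW s0)// -sqrtr_sqr exprMn sqr_sqrtr//.
  apply: ler_wsqrtr; rewrite -[leRHS]mulrA; apply: ler_wpM2l => //.
  by rewrite mulr_ge0// ltW.
have kc : key_const v m <= B * s.
  rewrite /key_const -/pk /B [leRHS]mulrDl; apply: lerD; last by rewrite ler_peMr.
  rewrite [leRHS]mulrAC; apply: ler_wpM2r => //; rewrite -[leRHS]mulrA.
  by apply: ler_wpM2l.
have kc0 : 0 < key_const v m.
  by rewrite /key_const ltr_wpDl// !mulr_ge0// /key_radius addr_ge0 ?sqrtr_ge0.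
have B0 : 0 < B by lra.
apply: (@le_trans _ _ (ln (B * s))); first by rewrite ler_ln ?posrE// mulr_gt0.
rewrite lnM ?posrE//; have := ln_sublinear B0; have := ln_sublinear s0.
have : B <= B * s by rewrite ler_peMr// ltW.
rewrite -/q; have -> : 2 * (q + 1) * pk + 3 = B + 1 by rewrite /B; ring.
move: (ln B) (ln s) => lB ls h1 h2 h3; lra.
Qed.

Lemma det_rates_achievable (v1 v2 P1 P2 R1 R2 : R) : 0 < v1 -> 0 < v2 -> 0 <= P1 -> 0 <= P2 ->
  0 <= R1 -> 0 <= R2 ->
  det_rates v1 P1 P2 (R1 * ln 2) (R2 * ln 2) -> secrecy_achievable P1 P2 v1 v2 R1 R2.
Proof.
move=> v10 v20 P10 P20 R10 R20 [A [E [A0 E0 codes]]] eps eps0.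
have l2 : 0 < ln 2 :> R by rewrite ln_gt0// ltr1n.
set rho1 := R1 * ln 2 in codes; set rho2 := R2 * ln 2 in codes.
have rho10 : 0 <= rho1 by rewrite mulr_ge0// ltW.
have rho20 : 0 <= rho2 by rewrite mulr_ge0// ltW.
pose K := rho1 + rho2 + 2 * A.
have K0 : 0 <= K by rewrite !addr_ge0// mulr_ge0.
pose B := 2 * (Num.sqrt (4 * v1 * K) + 1) * normal_peak (Num.sqrt v1) + 3.
have B0 : 0 <= B by rewrite addr_ge0// !mulr_ge0 ?normal_peak_ge0// addr_ge0 ?sqrtr_ge0.
pose phi : R := normal_pdf 0 (Num.sqrt v1) 1.
have phi0 : 0 < phi by rewrite normal_pdf_gt0// sqrtr_gt0.
pose V := (1 + v1 + v2) / v2.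
have V0 : 0 <= V by apply: divr_ge0; [rewrite !addr_ge0//; exact: ltW|exact: ltW].
pose T := K + `|ln phi| + B + V.
have T0 : 0 <= T.
  by move: (normr_ge0 (ln phi)) K0 B0 V0; rewrite /T => *; do 3?[apply: addr_ge0 => //].
(* Once the square root [s] of [n] is at least [X], the losses [T * s] are at most [eps * ln 2 * n]
   and the error [E / n ^+ 2] is at most [eps]. *)
pose X := T / (eps * ln 2) + E / eps.
have el : 0 < eps * ln 2 by rewrite mulr_gt0.
have X0 : 0 <= X by rewrite addr_ge0// divr_ge0// ltW.
(* One unit makes [n] exceed [X ^+ 2], the other pays for the key slot: the code of length [n.+1]
   contains an inner code of length [n]. *)
exists (Num.truncn (X ^+ 2)).+2 => -[//|n]; rewrite ltnS => Xn.
have n0 : (0 < n)%N by apply: leq_ltn_trans Xn.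
have nX : X ^+ 2 <= n%:R.
  have /andP[_ h] := truncn_itv (sqr_ge0 X).
  by apply: (le_trans (ltW h)); rewrite ler_nat.
pose s : R := Num.sqrt n%:R.
have s2 : s ^+ 2 = n%:R by rewrite sqr_sqrtr.
have s1 : 1 <= s by rewrite -[leLHS]sqrtr1; apply: ler_wsqrtr; rewrite ler1n.
have s0 : 0 < s by apply: lt_le_trans s1.
have sX : X <= s by rewrite -[X]ger0_norm// -sqrtr_sqr; exact: ler_wsqrtr.
have Ts : T * s <= eps * ln 2 * n%:R.
  rewrite -s2 expr2 mulrA ler_pM2r// mulrC -ler_pdivrMr//.
  by apply: le_trans sX; rewrite lerDl divr_ge0// ltW.
have Es : E / n%:R ^+ 2 <= eps.
  rewrite ler_pdivrMr ?exprn_gt0 ?ltr0n// mulrC -ler_pdivrMr//.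
  apply: (@le_trans _ _ s); first by apply: le_trans sX; rewrite lerDr divr_ge0// ltW.
  by rewrite -s2 -exprM; apply: ler_eXnr.
have [M1 [M2 [[M10 M20] ds r1 r2]]] := codes n n0.
rewrite -/s in r1 r2.
have En : 0 <= E / n%:R ^+ 2 by rewrite divr_ge0// exprn_ge0.
have [c [mc pw1 pw2 ce pe]] := secure_code v10 v20 P10 P20 En M10 M20 ds.
have NR : n.+1%:R = n%:R + 1 :> R by rewrite natr1.
have N0 : 0 < n.+1%:R :> R by rewrite ltr0n.
have AT : (A + rho1 + rho2) * s <= T * s.
  by apply: ler_wpM2r; [exact: ltW|rewrite /T /K; have := normr_ge0 (ln phi); lra].
have rs1 : rho1 <= rho1 * s by rewrite ler_peMr.
have rs2 : rho2 <= rho2 * s by rewrite ler_peMr.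
have rate (L Rj rhoj : R) : rhoj = Rj * ln 2 -> 0 <= rhoj ->
    rhoj * s <= (rho1 + rho2) * s ->
    `|L - rhoj * n%:R| <= A * s -> `|L / ln 2 / n.+1%:R - Rj| <= eps.
  move=> rE rj0 rjs h.
  have -> : L / ln 2 / n.+1%:R - Rj = (L - rhoj * n.+1%:R) / (ln 2 * n.+1%:R).
    by rewrite rE; field; rewrite !gt_eqF.
  rewrite normrM [`|_^-1|]gtr0_norm ?invr_gt0 ?mulr_gt0// ler_pdivrMr ?mulr_gt0//.
  have -> : L - rhoj * n.+1%:R = L - rhoj * n%:R - rhoj by rewrite NR; ring.
  apply: (le_trans (ler_normB _ _)); rewrite [`|rhoj|]ger0_norm//.
  have : rhoj <= rhoj * s by rewrite ler_peMr.
  rewrite NR; lra.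
exists M1, M2, c; split=> //.
- by split; apply: rate; rewrite ?lerD2r// ler_wpM2r ?(ltW s0) ?lerDl ?lerDr.
- rewrite /equivocation; apply: (@le_trans _ _ ((n.+1%:R)^-1%:E *
    (log2 ((M1 * M2)%:R * phi / key_const v1 (M1 * M2)) - (v2 * ln 2)^-1 * (1 + v1 + v2))%:E)%E).
    rewrite -EFinM lee_fin ler_pdivlMl//.
    have MR : 0 < (M1 * M2)%:R :> R by rewrite ltr0n muln_gt0 M10.
    have kc0 : 0 < key_const v1 (M1 * M2) :> R.
      rewrite /key_const ltr_wpDl// !mulr_ge0 ?normal_peak_ge0// /key_radius.
      by rewrite addr_ge0 ?sqrtr_ge0.
    have lnM12 : ln (M1 * M2)%:R = ln M1%:R + ln M2%:R :> R by rewrite natrM lnM ?posrE ?ltr0n.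
    have -> : log2 ((M1 * M2)%:R * phi / key_const v1 (M1 * M2)) -
        (v2 * ln 2)^-1 * (1 + v1 + v2) =
        (ln M1%:R + ln M2%:R + ln phi - ln (key_const v1 (M1 * M2)) - V) / ln 2.
      rewrite /log2 ln_div ?posrE ?mulr_gt0// [ln (_ * phi)]lnM ?posrE// lnM12 /V.
      by field; rewrite !gt_eqF.
    rewrite ler_pdivlMr//.
    have kc : ln (key_const v1 (M1 * M2)) <= B * s.
      apply: ln_key_const => //; rewrite lnM12 s2 /K.
      have : A * s <= A * n%:R by rewrite -s2; apply: ler_wpM2l => //; rewrite expr2 ler_peMr// ltW.
      by move: r1 r2; rewrite !ler_norml => /andP[_ a1] /andP[_ a2]; lra.
    have Vs : V <= V * s by rewrite ler_peMr.
    have ps : `|ln phi| <= `|ln phi| * s by rewrite ler_peMr.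
    have pl : - `|ln phi| <= ln phi by rewrite lerNl ler_normr lexx orbT.
    have -> : n.+1%:R * (R1 + R2 - eps) * ln 2 = (n%:R + 1) * (rho1 + rho2 - eps * ln 2).
      by rewrite NR /rho1 /rho2; ring.
    move: Ts; rewrite /T /K; move: r1 r2; rewrite !ler_norml => /andP[a1 _] /andP[a2 _] Ts.
    have := ltW el; nra.
  by apply: lee_wpmul2l => //; rewrite lee_fin invr_ge0.
- by apply: (le_trans pe); rewrite lee_fin.
Qed.

End asymptotics.

(** * Corner points and the union over correlations *)

Section region.
Context {R : realType}.
Variable v : R.
Hypothesis v_gt0 : 0 < v.

Definition snr (P rho : R) := 1 + P * (1 - rho ^+ 2) / v.
Definition sum_snr (P P' rho : R) := 1 + (P + P' + 2 * Num.sqrt (P * P') * rho) / v.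

Lemma sum_snrC P P' rho : sum_snr P P' rho = sum_snr P' P rho.
Proof. by rewrite /sum_snr [P + P']addrC [P * P']mulrC. Qed.

Lemma snr_gt0 P rho : 0 < P -> 0 <= rho <= 1 -> 0 < snr P rho.
Proof.
move=> P0 /andP[r0 r1]; rewrite ltr_pwDl// divr_ge0 ?(ltW v_gt0)// mulr_ge0 ?(ltW P0)//.
by rewrite subr_ge0 expr_le1.
Qed.

Lemma sum_snr_gt0 P P' rho : 0 < P -> 0 < P' -> 0 <= rho -> 0 < sum_snr P P' rho.
Proof.
move=> P0 P'0 r0; rewrite ltr_pwDl// divr_ge0 ?(ltW v_gt0)// addr_ge0 ?addr_ge0 ?(ltW P0) ?(ltW P'0)//.
by rewrite !mulr_ge0 ?sqrtr_ge0.
Qed.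

Lemma le_snr P a b : 0 < P -> 0 <= a -> a <= b -> snr P b <= snr P a.
Proof.
move=> P0 a0 ab; rewrite lerD2l ler_wpM2r ?invr_ge0 ?(ltW v_gt0)// ler_wpM2l ?(ltW P0)//.
by rewrite lerD2l lerN2; apply: lerXn2r; rewrite ?nnegrE ?(le_trans a0 ab).
Qed.

Lemma le_sum_snr P P' a b : a <= b -> sum_snr P P' a <= sum_snr P P' b.
Proof.
by move=> ab; rewrite lerD2l ler_wpM2r ?invr_ge0 ?(ltW v_gt0)// lerD2l ler_wpM2l.
Qed.

Lemma poly_ivt_decr (p : {poly R}) a b : a <= b -> p.[b] <= 0 -> 0 <= p.[a] ->
  exists2 x, a <= x <= b & p.[x] = 0.
Proof.
move=> ab pb pa; have [|x xab] := @poly_ivt R (- p) a b ab.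
  by rewrite !hornerN oppr_le0 oppr_ge0 pa.
by rewrite rootN => /rootP px; exists x.
Qed.

(** The corner at which user 1 has its full individual rate and user 2 what the sum bound leaves;
    the halves come from the factor one half of the Gaussian capacities. *)
Lemma corner_rates P P' rho x x' : 0 < P -> 0 < P' -> 0 <= rho < 1 ->
  sum_snr P P' rho <= snr P rho * snr P' rho -> 0 <= x -> 0 <= x' ->
  x <= ln (snr P rho) -> x' <= ln (sum_snr P P' rho / snr P rho) ->
  det_rates v P P' (x / 2) (x' / 2).
Proof.
move=> P0 P'0 r01 h x0 x'0 hx hx'.
have [|la1 [la2 [la3 [c1 [c2 [c3 [b1 [b2 [b3 [Q LS]]]]]]]]]] :=
  exists_scheme v_gt0 P0 P'0 r01.
  have v2 : 0 < v ^+ 2 by rewrite exprn_gt0.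
  rewrite -(ler_pM2l v2) in h; move: h; rewrite /sum_snr /snr.
  set S := _ + _ + _; set a := P * _; set b := P' * _.
  have -> : v ^+ 2 * (1 + S / v) = v * (v + S) by field; rewrite gt_eqF.
  by have -> : v ^+ 2 * ((1 + a / v) * (1 + b / v)) = (v + a) * (v + b)
    by field; rewrite gt_eqF.
by apply: (linear_scheme_rates v_gt0 LS); rewrite ?divr_ge0// mulrC divfK.
Qed.

Variables (P1 P2 : R).
Hypotheses (P1_gt0 : 0 < P1) (P2_gt0 : 0 < P2).

(* Where the gap is nonnegative, the sum constraint cuts the rectangle of the individual
   bounds, and linear codes achieve both corners of the resulting pentagon. *)
Let gap rho := snr P1 rho * snr P2 rho - sum_snr P1 P2 rho.

Let gapP : {poly R} :=
  (1 + (P1 / v) *: (1 - 'X^2)) * (1 + (P2 / v) *: (1 - 'X^2)) -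
  (1 + ((P1 + P2) / v)%:P + (2 * Num.sqrt (P1 * P2) / v) *: 'X).

Let gapE rho : gapP.[rho] = gap rho.
Proof. by rewrite /gapP /gap /snr /sum_snr !hornerE; field; rewrite gt_eqF. Qed.

Let gap1 : gap 1 < 0.
Proof.
rewrite /gap /snr /sum_snr expr1n subrr !mulr0 !mul0r addr0 !mulr1 subr_lt0 ltrDl.
by apply: divr_gt0 => //; rewrite !addr_gt0// !mulr_gt0// sqrtr_gt0 mulr_gt0.
Qed.

Let gap0 : 0 <= gap 0.
Proof.
have -> : gap 0 = P1 * P2 / v ^+ 2.
  by rewrite /gap /snr /sum_snr; field; rewrite gt_eqF.
by apply: divr_ge0; [rewrite mulr_ge0 ?ltW|rewrite sqr_ge0].
Qed.

Let gap_le a b : 0 <= a -> a <= b -> b <= 1 -> gap b <= gap a.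
Proof.
move=> a0 ab b1; have b01 : 0 <= b <= 1 by rewrite (le_trans a0 ab).
apply: lerB; last exact: le_sum_snr.
by apply: ler_pM; rewrite ?(ltW (snr_gt0 _ b01))// le_snr.
Qed.

Lemma region_rates rho x1 x2 : 0 <= rho <= 1 -> 0 <= x1 -> 0 <= x2 ->
  x1 <= ln (snr P1 rho) -> x2 <= ln (snr P2 rho) -> x1 + x2 <= ln (sum_snr P1 P2 rho) ->
  det_rates v P1 P2 (x1 / 2) (x2 / 2).
Proof.
move=> /[dup] r01 /andP[r0 r1] x10 x20 h1 h2 h12.
have le_ln_snr P a b : 0 < P -> 0 <= a -> a <= b -> b <= 1 ->
    ln (snr P b) <= ln (snr P a).
  move=> P0 a0 ab b1; have b01 : 0 <= b <= 1 by rewrite (le_trans a0 ab).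
  have a01 : 0 <= a <= 1 by rewrite a0 (le_trans ab b1).
  by rewrite ler_ln ?posrE ?snr_gt0// le_snr.
have lnS r : 0 <= r <= 1 -> ln (sum_snr P1 P2 r / snr P1 r) =
    ln (sum_snr P1 P2 r) - ln (snr P1 r).
  by move=> r'01; case/andP: (r'01) => ? _; rewrite ln_div ?posrE ?snr_gt0 ?sum_snr_gt0.
have lnS' r : 0 <= r <= 1 -> ln (sum_snr P2 P1 r / snr P2 r) =
    ln (sum_snr P1 P2 r) - ln (snr P2 r).
  by move=> r'01; case/andP: (r'01) => ? _; rewrite sum_snrC ln_div ?posrE ?snr_gt0 ?sum_snr_gt0.
have lt1 r : r <= 1 -> 0 <= gap r -> r < 1.
  by move=> r'1 g0; rewrite lt_neqAle r'1 andbT; apply/eqP => e; move: gap1; rewrite -e ltNge g0.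
have at_zero r : 0 <= r <= 1 -> gap r = 0 ->
    x1 <= ln (snr P1 r) -> x2 <= ln (snr P2 r) -> det_rates v P1 P2 (x1 / 2) (x2 / 2).
  move=> r'01 g0 hx1 hx2; have [r'0 r'1] := andP r'01.
  have e : sum_snr P1 P2 r = snr P1 r * snr P2 r by apply/esym/eqP; rewrite -subr_eq0 -/(gap r) g0.
  apply: (corner_rates (rho := r)) => //.
  - by rewrite r'0 lt1// g0.
  - by rewrite e.
  - by rewrite e mulrAC mulfV ?mul1r// gt_eqF// snr_gt0.
(* The sum bound is not active: lowering the correlation to a zero of the gap only enlarges the
   individual bounds, and there the pentagon is a rectangle with a single corner. *)
have [g0|g0] := leP (gap rho) 0.
  have [||r /andP[r'0 r'r]] := @poly_ivt_decr gapP 0 rho r0; rewrite ?gapE// => gr.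
  have r'1 := le_trans r'r r1.
  apply: (at_zero r) => //; first by rewrite r'0.
  - by apply: (le_trans h1); apply: le_ln_snr.
  - by apply: (le_trans h2); apply: le_ln_snr.
(* The gap is positive and [rs] is a zero of it beyond [rho]. If both rates fit the rectangle at
   [rs], its corner serves. *)
have [||rs /andP[rrs rs1]] := @poly_ivt_decr gapP rho 1 r1; rewrite ?gapE ?ltW// => grs.
have rs0 := le_trans r0 rrs.
(* Otherwise one rate exceeds its individual bound at [rs], and some [r] between [rho] and [rs]
   makes this bound tight. The sum bound has only grown from [rho] to [r], so the pair lies below a
   corner at [r]. *)
have solve P x : 0 < P -> x <= ln (snr P rho) -> ln (snr P rs) < x ->
    exists2 r, rho <= r <= rs & ln (snr P r) = x.
  move=> P0 xr xrs; pose p : {poly R} := (1 + (P / v) *: (1 - 'X^2)) - (expR x)%:P.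
  have pE r : p.[r] = snr P r - expR x.
    by rewrite /p /snr !hornerE; field; rewrite gt_eqF.
  have snr0 r : 0 <= r <= 1 -> expR (ln (snr P r)) = snr P r.
    by move=> r'01; rewrite lnK// posrE snr_gt0.
  have [||r rrs' ] := @poly_ivt_decr p rho rs rrs.
  - by rewrite pE subr_le0 -snr0 ?rs0// ler_expR ltW.
  - by rewrite pE subr_ge0 -snr0 ?r0// ler_expR.
  by rewrite pE => /eqP; rewrite subr_eq0 => /eqP e; exists r => //; rewrite e expRK.
have inner r : rho <= r <= rs -> [/\ 0 <= r < 1, 0 <= r <= 1,
    sum_snr P1 P2 r <= snr P1 r * snr P2 r & x1 + x2 <= ln (sum_snr P1 P2 r)].
  move=> /andP[rr rrs']; have r'0 := le_trans r0 rr; have r'1 := le_trans rrs' rs1.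
  have gr : 0 <= gap r by rewrite -grs gap_le.
  split; rewrite ?r'0 ?lt1//; first by rewrite -subr_ge0.
  apply: (le_trans h12); rewrite ler_ln ?posrE ?sum_snr_gt0//; exact: le_sum_snr.
have [hx1|hx1] := leP x1 (ln (snr P1 rs)).
  have [hx2|hx2] := leP x2 (ln (snr P2 rs)).
    by apply: (at_zero rs) => //; rewrite rs0.
  have [r rr e] := solve P2 x2 P2_gt0 h2 hx2; have [i1 i2 i3 i4] := inner r rr.
  apply: det_rates_swap; apply: (corner_rates (rho := r)) => //.
  - by rewrite sum_snrC mulrC.
  - by rewrite e.
  - by rewrite lnS'// e; lra.
have [r rr e] := solve P1 x1 P1_gt0 h1 hx1; have [i1 i2 i3 i4] := inner r rr.
apply: (corner_rates (rho := r)) => //.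
- by rewrite e.
- by rewrite lnS// e; lra.
Qed.

End region.

Theorem theorem1 (R : realType) (P1 P2 var1 var2 : R) :
  0 < P1 -> 0 < P2 -> 0 < var1 -> 0 < var2 ->
  secrecy_capacity_region P1 P2 var1 var2 = gmac_feedback_region P1 P2 var1.
Proof.
move=> P10 P20 v10 v20; apply/seteqP; split => -[R1 R2].
  exact: converse.
move=> [rho]; rewrite /= in_itv/= => r01 [/= R10 R20 h1 h2 h12].
have l2 : 0 < ln 2 :> R by rewrite ln_gt0// ltr1n.
have half (x y : R) : x <= 2^-1 * log2 y -> 2 * (x * ln 2) <= ln y.
  have -> : ln y = 2 * (2^-1 * log2 y * ln 2) by rewrite /log2; field; rewrite gt_eqF.
  by move=> h; rewrite !(ler_pM2l, ler_pM2r).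
apply: det_rates_achievable => //; rewrite ?ltW//.
have twice (x : R) : x = 2 * x / 2 by field.
rewrite [R1 * _]twice [R2 * _]twice.
apply: (region_rates v10 P10 P20 (rho := rho)) => //.
- by rewrite !mulr_ge0// ltW.
- by rewrite !mulr_ge0// ltW.
- exact: half.
- exact: half.
- by have := half _ _ h12; rewrite [(R1 + R2) * _]mulrDl mulrDr.
Qed.
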